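(* Let $K$ be an algebraically closed field complete with respect to a nontrivial non-Archimedean absolute value, with residue field $k$, and let $\varphi\in K(z)$ have degree $d\geq 2$. The following are equivalent. (i) For every $n\geq1$ the minimal resultant iteration formula \[ R_{[\varphi^n]} = \frac{d^n(d^n-1)}{d(d-1)}\, R_{[\varphi]} \] holds. (ii) For every $\gamma\in\mathrm{PGL}_2(K)$ such that $\varphi^\gamma$ has semistable reduction, we have $(\varphi^\gamma)_v\notin I(d)$, and $(\varphi^\gamma)^n$ has semistable reduction for all $n\geq1$.
   Context: Let $\mathcal{O}$ be the valuation ring of $K$ and $\mathfrak{m}$ its maximal ideal, so $k=\mathcal{O}/\mathfrak{m}$. Let $q_v=e$ if $\mathrm{char}(k)=0$ and $q_v=\mathrm{char}(k)$ otherwise, and normalize $|\cdot|$ so that $\mathrm{ord}(x):=-\log_{q_v}|x|$. A homogeneous lift of a rational map $\psi$ of degree $D$ is a pair $(F,G)$ of coprime degree-$D$ forms in $K[X,Y]$ with $\psi(z)=F(z,1)/G(z,1)$. It is normalized if the maximal absolute value of its coefficients is $1$. We set $R_\psi:=\mathrm{ord}\,\mathrm{Res}(F,G)$ for a normalized lift. For $\gamma\in\mathrm{PGL}_2(K)$ we write $\psi^\gamma=\gamma^{-1}\circ\psi\circ\gamma$, and the minimal resultant is $R_{[\psi]}:=\min_{\gamma\in\mathrm{PGL}_2(K)}R_{\psi^\gamma}$. The reduction $\psi_v\in\mathbb{P}^{2D+1}(k)$ is the point given by the coefficients of a normalized lift reduced modulo $\mathfrak{m}$. It is a pair of degree-$D$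 forms over $k$, possibly with a common factor. $\psi$ has semistable reduction if $\psi_v$ lies in the GIT-semistable locus of $\mathbb{P}^{2D+1}_k$ for the conjugation action of $\mathrm{SL}_2$ (with respect to $\mathcal{O}(1)$). Equivalently, some $\mathrm{SL}_2$-invariant homogeneous form of positive degree in the coefficients does not vanish at $\psi_v$. $I(d)\subseteq\mathbb{P}^{2d+1}(k)$ is the set of pairs $[\tilde F:\tilde G]$ satisfying the following. Write $\tilde A=\gcd(\tilde F,\tilde G)$ and $\tilde F=\tilde A\tilde F_0$, $\tilde G=\tilde A\tilde G_0$. Then $[\tilde F_0:\tilde G_0]$ is a constant map whose value $c\in\mathbb{P}^1(k)$ is a root of $\tilde A$. This is the indeterminacy locus of the iteration maps $\mathbb{P}^{2d+1}\dashrightarrow\mathbb{P}^{2d^n+1}$. *)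

(* Defs.v *)
From HB Require Import structures.
From mathcomp Require Import all_boot all_order all_algebra.
From mathcomp Require Import all_classical all_reals all_analysis.
From mathcomp Require mpoly.
Unset Printing Implicit Defensive.
Import Order.TTheory GRing.Theory Num.Theory.
Local Open Scope ring_scope.

(* Binary forms of degree D over a commutative ring F are represented  *)
(* by their dehomogenisation: the form                                 *)
(*    F(X,Y) = \sum_(i <= D) f_i X^i Y^(D-i)                           *)
(* is the polynomial f = \sum f_i 'X^i with size f <= D.+1.            *)
(* A pair (F,G) of degree-D forms is a pair of such polynomials.       *)
Section Forms.
Variable F : comNzRingType.

Definition is_form (D : nat) (f : {poly F}) : bool := (size f <= D.+1)%N.

Definition heval (D : nat) (f : {poly F}) (x y : F) : F :=
  \sum_(i < D.+1) f`_i * x ^+ i * y ^+ (D - i).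

(* substitution F(P,Q) of forms P,Q of degree e into the degree-D form F;
   the result is a form of degree D*e (dehomogenised). *)
Definition hcomp (D : nat) (f p q : {poly F}) : {poly F} :=
  \sum_(i < D.+1) f`_i *: (p ^+ i * q ^+ (D - i)).

Definition hsylvester (D : nat) (f g : {poly F}) : 'M[F]_(D + D) :=
  \matrix_(i < D + D, j < D + D)
    (if (i < D)%N then (if (i <= j)%N then f`_(j - i) else 0)
     else (if (i - D <= j)%N then g`_(j - (i - D)) else 0)).

Definition hres (D : nat) (f g : {poly F}) : F := \det (hsylvester D f g).

(* Conjugation of a homogeneous lift by gamma = [[a, b], [c, e]]:
   psi^gamma = gamma^-1 o psi o gamma, gamma(X,Y) = (aX+bY, cX+eY),
   gamma^-1 lifted by the adjugate [[e, -b], [-c, a]]. *)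
Definition hconj (D : nat) (M : 'M[F]_2) (fg : {poly F} * {poly F}) :
    {poly F} * {poly F} :=
  let a := M ord0 ord0 in let b := M ord0 ord_max in
  let c := M ord_max ord0 in let e := M ord_max ord_max in
  let p := a *: 'X + b%:P in let q := c *: 'X + e%:P in
  let F1 := hcomp D fg.1 p q in let G1 := hcomp D fg.2 p q in
  (e *: F1 - b *: G1, - (c *: F1) + a *: G1).

(* Homogeneous lift of the n-th iterate psi^n of psi (lift fg of degree d);
   it is a pair of forms of degree d^n; psi^0 = id with lift (X, Y). *)
Fixpoint hiter (d : nat) (fg : {poly F} * {poly F}) (n : nat) :
    {poly F} * {poly F} :=
  match n with
  | 0 => ('X, 1)
  | n'.+1 => let pq := hiter d fg n' in
             (hcomp d fg.1 pq.1 pq.2, hcomp d fg.2 pq.1 pq.2)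
  end.

Definition hcoefs (D : nat) (fg : {poly F} * {poly F}) :
    'I_(D.+1 + D.+1) -> F :=
  fun i => match fintype.split i with inl j => fg.1`_j | inr j => fg.2`_j end.

Definition hofvec (D : nat) (v : 'I_(D.+1 + D.+1) -> F) :
    {poly F} * {poly F} :=
  (\poly_(i < D.+1) v (lshift D.+1 (inord i)),
   \poly_(i < D.+1) v (rshift D.+1 (inord i))).

End Forms.
Arguments is_form {F}.
Arguments heval {F}.
Arguments hcomp {F}.
Arguments hsylvester {F}.
Arguments hres {F}.
Arguments hconj {F}.
Arguments hiter {F}.
Arguments hcoefs {F}.
Arguments hofvec {F}.

Section FieldForms.
Variable F : fieldType.

(* Two degree-D forms are coprime (no nonconstant common factor in F[X,Y]):
   their dehomogenisations are coprime and Y does not divide both. *)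
Definition hcoprime (D : nat) (f g : {poly F}) : bool :=
  coprimep f g && ((size f == D.+1) || (size g == D.+1)).

Definition is_lift (d : nat) (fg : {poly F} * {poly F}) : Prop :=
  [/\ is_form d fg.1, is_form d fg.2 & hcoprime d fg.1 fg.2].

(* GIT-semistability of a point of P^(2D+1)(F) (given by a nonzero coefficient
   vector) for the conjugation action of SL_2: some SL_2-invariant homogeneous
   form of positive degree in the 2D+2 coefficients does not vanish at it. *)
Definition sl2_invariant (D : nat) (P : mpoly.mpoly (D.+1 + D.+1) F) : Prop :=
  forall M : 'M[F]_2, \det M = 1 ->
  forall v : 'I_(D.+1 + D.+1) -> F,
    mpoly.meval (hcoefs D (hconj D M (hofvec D v))) P = mpoly.meval v P.

Definition semistable_pt (D : nat) (fg : {poly F} * {poly F}) : Prop :=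
  exists m : nat, (0 < m)%N /\
  exists P : mpoly.mpoly (D.+1 + D.+1) F,
    [/\ all (fun mn => mpoly.mdeg mn == m) (mpoly.msupp P), sl2_invariant D P
      & mpoly.meval (hcoefs D fg) P != 0].

(* The set I(d) in P^(2d+1)(F): writing Ft = A*F0, Gt = A*G0 with
   A = gcd(Ft, Gt), the map [F0 : G0] is constant (F0, G0 of degree 0, i.e.
   F0 = a, G0 = b, (a,b) <> (0,0)) with value c = [a : b] a root of A. *)
Definition in_I (d : nat) (fg : {poly F} * {poly F}) : Prop :=
  exists (A : {poly F}) (a b : F),
    [/\ A != 0, is_form d A, (a, b) != (0, 0),
        fg = (a *: A, b *: A) & heval d A a b = 0].

End FieldForms.
Arguments hcoprime {F}.
Arguments is_lift {F}.
Arguments sl2_invariant {F}.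
Arguments semistable_pt {F}.
Arguments in_I {F}.

Section Valued.
Variables (K : fieldType) (R : realType) (absK : K -> R).

Definition nonarch_abs : Prop :=
  [/\ forall x, 0 <= absK x,
      forall x, absK x = 0 <-> x = 0,
      forall x y, absK (x * y) = absK x * absK y
    & forall x y, absK (x + y) <= Num.max (absK x) (absK y)].

Definition nontrivial_abs : Prop := exists x, absK x != 0 /\ absK x != 1.

Definition complete_abs : Prop :=
  forall u : nat -> K,
    (forall eps, 0 < eps -> exists N : nat, forall m n : nat,
        (N <= m)%N -> (N <= n)%N -> absK (u m - u n) < eps) ->
    exists l : K, forall eps, 0 < eps -> exists N : nat, forall n : nat,
        (N <= n)%N -> absK (u n - l) < eps.

(* k, together with red : K -> k, is the residue field O/m:
   red restricted to O = {|x| <= 1} is a surjective ring morphism onto k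
   with kernel m = {|x| < 1}. (Values of red outside O are irrelevant.) *)
Variables (k : fieldType) (red : K -> k).

Definition residue_map : Prop :=
  [/\ red 1 = 1,
      forall x y, absK x <= 1 -> absK y <= 1 -> red (x + y) = red x + red y,
      forall x y, absK x <= 1 -> absK y <= 1 -> red (x * y) = red x * red y,
      forall x, absK x <= 1 -> (red x = 0 <-> absK x < 1)
    & forall a : k, exists x, absK x <= 1 /\ red x = a].

Definition char_res : nat := xget 0%N [set p : nat | p \in [pchar k]].
Definition qv : R := if char_res == 0%N then expR 1 else (char_res)%:R.

Definition ord (x : K) : R := - (ln (absK x) / ln qv).

Definition norm_const (D : nat) (fg : {poly K} * {poly K}) : K :=
  let v := hcoefs D fg in
  v (Order.arg_max (lshift D.+1 (@ord0 D)) xpredT (fun i => absK (v i))).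

Definition normalize (D : nat) (fg : {poly K} * {poly K}) :
    {poly K} * {poly K} :=
  let c := norm_const D fg in (c^-1 *: fg.1, c^-1 *: fg.2).

Definition Rres (D : nat) (fg : {poly K} * {poly K}) : R :=
  ord (hres D (normalize D fg).1 (normalize D fg).2).

(* minimal resultant R_[psi] = min over gamma in PGL_2(K) of R_(psi^gamma),
   taken as the infimum over invertible 2x2 matrices (it is attained). *)
Definition minres (D : nat) (fg : {poly K} * {poly K}) : R :=
  inf [set Rres D (hconj D M fg) | M in [set M : 'M[K]_2 | M \in unitmx]].

Definition hred (D : nat) (fg : {poly K} * {poly K}) : {poly k} * {poly k} :=
  let n := normalize D fg in
  (\poly_(i < D.+1) red (n.1)`_i, \poly_(i < D.+1) red (n.2)`_i).

Definition ss_red (D : nat) (fg : {poly K} * {poly K}) : Prop :=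
  semistable_pt D (hred D fg).

End Valued.
Arguments nonarch_abs {K R}.
Arguments nontrivial_abs {K R}.
Arguments complete_abs {K R}.
Arguments residue_map {K R} absK {k}.
Arguments char_res k.
Arguments qv R k.
Arguments ord {K R} absK k.
Arguments norm_const {K R}.
Arguments normalize {K R}.
Arguments Rres {K R} absK k.
Arguments minres {K R} absK k.
Arguments hred {K R} absK {k}.
Arguments ss_red {K R} absK {k}.

(* Main.v *)
(* Up to a constant, R_{psi^gamma} is 2D times the logarithm to base q_v of
   |psi^gamma| / |det gamma|^((D+1)/2), where |.| is the largest coefficient of a fixed lift
   acted on by the adjugate; call the square of this quotient the cost of gamma.  The
   reduction of psi^gamma is semistable iff gamma minimizes the cost: a destabilizing
   torus over k lifts to a strictly cheaper conjugate; if there is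
   none, the Cartan decomposition shows that nothing is cheaper, and a nonvanishing invariant
   is found among those of the binary form theta^2a omega^2b (theta the form of fixed points,
   omega the Wronskian), explicit in every characteristic as symmetrized products of brackets.
   The minimum is attained since the cost does not increase when a disc is recentered at a
   fixed point or a pole and its radius moved to one of finitely many critical values.

   For a normalized lift Phi of phi^gamma with reduction phi', Res(Phi^n) = +-Res(Phi)^(N_n)
   with N_n = d^n(d^n - 1)/(d(d - 1)), hence R_{(phi^gamma)^n} = N_n R_{phi^gamma} + lam_n,
   where lam_n <= 0, and lam_n = 0 iff the n-th iterate of phi' is nonzero.  The latter holds
   for every n when phi' is not in I(d), and fails for n = 2 when it is.  Both implications
   follow by comparing the minimizers of R_{phi^gamma} with those of R_{(phi^gamma)^n}. *)
Require Import Defs.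
From HB Require Import structures.
From mathcomp Require Import all_boot all_order all_fingroup all_algebra.
From mathcomp Require Import ring zify.
From mathcomp Require mpoly boolp.
Set Implicit Arguments.
Unset Strict Implicit.
Unset Printing Implicit Defensive.
Import Order.TTheory GRing.Theory Num.Theory.
Local Open Scope ring_scope.

(** * Binary forms and conjugation *)

Section Substitution.
Variable F : comNzRingType.
Implicit Types (f g p q u v : {poly F}) (a b c x y : F) (D e m n : nat).

(** The exponent (D+1)/2 is forced twice: it makes the cost invariant under scaling of gamma, and it
    is the midpoint of the weights, since conjugation by diag(t, 1) gives the coefficients of F and
    G the weights i and i + 1, which run from 0 to D + 1. The residue field may have any
    characteristic, so invariants cannot be obtained by averaging and have to be exhibited. Two
    covariants are taken because each alone can vanish: theta does so on a common factor times the
    identity, omega on constant and on inseparable maps. The exponents a and b are chosen so that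
    theta^2a omega^2b, of degree 2m, has no root of multiplicity above m; then its roots can be
    matched into m pairs of distinct points, and the product of the corresponding brackets is a
    nonzero starting point for an invariant. Attainment of the minimum matters because (ii)
    constrains only conjugates with semistable reduction and would say nothing if there were none.
    The sign of lam_n comes from integrality: iterating a normalized lift keeps the coefficients in
    the valuation ring, and renormalizing can only lower the order of the resultant. *)

Lemma form_sum D f : is_form D f -> f = \sum_(i < D.+1) f`_i *: 'X^i.
Proof.
move=> hf; rewrite -poly_def; apply/polyP => i; rewrite coef_poly.
by case: ltnP => // hi; rewrite nth_default // (leq_trans hf).
Qed.

Lemma formP D f : reflect (forall i, (D < i)%N -> f`_i = 0) (is_form D f).
Proof. exact: leq_sizeP. Qed.

Lemma is_formD D f g : is_form D f -> is_form D g -> is_form D (f + g).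
Proof.
by move=> /formP hf /formP hg; apply/formP => i hi; rewrite coefD hf ?hg ?addr0.
Qed.

Lemma is_formZ D a f : is_form D f -> is_form D (a *: f).
Proof. by move=> /formP hf; apply/formP => i hi; rewrite coefZ hf ?mulr0. Qed.

Lemma is_formN D f : is_form D f -> is_form D (- f).
Proof. by move=> /formP hf; apply/formP => i hi; rewrite coefN hf ?oppr0. Qed.

Lemma is_formM m n f g : is_form m f -> is_form n g -> is_form (m + n) (f * g).
Proof.
move=> hf hg; rewrite /is_form (leq_trans (size_polyMleq f g)) //.
by move: hf hg; rewrite /is_form; lia.
Qed.

Lemma is_formX m n f : is_form m f -> is_form (m * n) (f ^+ n).
Proof.
move=> hf; elim: n => [|n IH]; first by rewrite muln0 expr0 /is_form size_poly1.
by rewrite mulnS exprS is_formM.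
Qed.

Lemma is_form_sum D (I : Type) (r : seq I) (P : pred I) (h : I -> {poly F}) :
  (forall i, P i -> is_form D (h i)) -> is_form D (\sum_(i <- r | P i) h i).
Proof.
move=> hh; apply: (big_ind (is_form D)) => //; first by rewrite /is_form size_poly0.
by move=> f g hf hg; apply: is_formD.
Qed.

Lemma is_form_linear a b : is_form 1 (a *: 'X + b%:P).
Proof. by apply/formP => i hi; rewrite coefD coefZ coefX coefC; case: i hi => [|[]] //= i _; rewrite mulr0 addr0. Qed.

Lemma hcompD D f g p q : hcomp D (f + g) p q = hcomp D f p q + hcomp D g p q.
Proof. by rewrite -big_split; apply: eq_bigr => i _; rewrite coefD scalerDl. Qed.

Lemma hcompZ D a f p q : hcomp D (a *: f) p q = a *: hcomp D f p q.
Proof. by rewrite scaler_sumr; apply: eq_bigr => i _; rewrite coefZ scalerA. Qed.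

Lemma hcompN D f p q : hcomp D (- f) p q = - hcomp D f p q.
Proof. by rewrite -scaleN1r hcompZ scaleN1r. Qed.

Lemma hcomp0 D p q : hcomp D 0 p q = 0.
Proof. by have := hcompZ D 0 0 p q; rewrite !scale0r. Qed.

Lemma hcomp_sum D (I : Type) (r : seq I) (P : pred I) (h : I -> {poly F}) p q :
  hcomp D (\sum_(i <- r | P i) h i) p q = \sum_(i <- r | P i) hcomp D (h i) p q.
Proof.
by apply: (big_morph (fun f => hcomp D f p q)) => [f g|]; rewrite ?hcompD ?hcomp0.
Qed.

Lemma hcompXn D k p q : (k <= D)%N -> hcomp D 'X^k p q = p ^+ k * q ^+ (D - k).
Proof.
move=> hk; have hk' : (k < D.+1)%N by [].
rewrite /hcomp (bigD1 (Ordinal hk')) //= coefXn eqxx scale1r big1 ?addr0 // => i.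
by rewrite -val_eqE coefXn => /negbTE /= ->; rewrite scale0r.
Qed.

Lemma hcompM m n f g p q : is_form m f -> is_form n g ->
  hcomp (m + n) (f * g) p q = hcomp m f p q * hcomp n g p q.
Proof.
move=> hf hg; rewrite {1}(form_sum hf) {1}(form_sum hg) mulr_suml hcomp_sum.
rewrite [in RHS]/hcomp mulr_suml; apply: eq_bigr => i _.
rewrite mulr_sumr hcomp_sum mulr_sumr; apply: eq_bigr => j _.
rewrite -!scalerAl -!scalerAr -exprD !hcompZ hcompXn; last by have := ltn_ord i; have := ltn_ord j; lia.
congr (_ *: (_ *: _)); have hi := ltn_ord i; have hj := ltn_ord j.
have -> : (m + n - (i + j) = (m - i) + (n - j))%N by lia.
by rewrite !exprD; ring.
Qed.

Lemma hcomp1 p q : hcomp 0 1 p q = 1.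
Proof. by rewrite /hcomp big_ord1 coefC eqxx !expr0 mulr1 scale1r. Qed.

Lemma hcompX m n f p q : is_form m f ->
  hcomp (m * n) (f ^+ n) p q = hcomp m f p q ^+ n.
Proof.
move=> hf; elim: n => [|n IH]; first by rewrite muln0 !expr0 hcomp1.
by rewrite mulnS !exprS hcompM ?IH ?is_formX.
Qed.

Lemma hcomp_id D f : is_form D f -> hcomp D f 'X 1 = f.
Proof.
move=> hf; rewrite [RHS](form_sum hf); apply: eq_bigr => i _.
by rewrite expr1n mulr1.
Qed.

Lemma hcomp_linear p q a b : hcomp 1 (a *: 'X + b%:P) p q = a *: p + b *: q.
Proof.
have hq : hcomp 1 1 p q = q by rewrite -(expr0 'X) hcompXn // expr0 mul1r expr1.
have hp : hcomp 1 'X p q = p by rewrite -['X]expr1 hcompXn // expr1 expr0 mulr1.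
by rewrite -(alg_polyC b) hcompD !hcompZ hp hq.
Qed.

Lemma is_form_hcomp D e f p q :
  is_form e p -> is_form e q -> is_form (D * e) (hcomp D f p q).
Proof.
move=> hp hq; apply: is_form_sum => i _; apply: is_formZ.
have hi := ltn_ord i; have -> : (D * e = e * i + e * (D - i))%N by rewrite -mulnDr mulnC; congr muln; lia.
by apply: is_formM; apply: is_formX.
Qed.

Lemma hcomp_scale D f p q c : hcomp D f (c *: p) (c *: q) = c ^+ D *: hcomp D f p q.
Proof.
rewrite scaler_sumr; apply: eq_bigr => i _; have hi := ltn_ord i.
have -> : c ^+ D = c ^+ i * c ^+ (D - i) by rewrite -exprD; congr (_ ^+ _); lia.
by rewrite !exprZn -!scalerAl -!scalerAr !scalerA; congr (_ *: _); ring.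
Qed.

Lemma hcomp_mul D f p q u : hcomp D f (u * p) (u * q) = u ^+ D * hcomp D f p q.
Proof.
rewrite mulr_sumr; apply: eq_bigr => i _; have hi := ltn_ord i.
have -> : u ^+ D = u ^+ i * u ^+ (D - i) by rewrite -exprD; congr (_ ^+ _); lia.
by rewrite !exprMn -scalerAr; congr (_ *: _); ring.
Qed.

Lemma hcomp_comp D e f p q u v : is_form e p -> is_form e q ->
  hcomp (D * e) (hcomp D f p q) u v = hcomp D f (hcomp e p u v) (hcomp e q u v).
Proof.
move=> hp hq; rewrite hcomp_sum; apply: eq_bigr => i _; rewrite hcompZ; congr (_ *: _).
have hi := ltn_ord i; have -> : (D * e = e * i + e * (D - i))%N by rewrite -mulnDr mulnC; congr muln; lia.
by rewrite hcompM ?is_formX // !hcompX.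
Qed.

(** Evaluation is composition with constant forms, so the identities for [heval] below are read off
    from those for [hcomp] by injectivity of [polyC]. *)
Lemma hevalE D f x y : (heval D f x y)%:P = hcomp D f x%:P y%:P.
Proof.
rewrite /heval raddf_sum; apply: eq_bigr => i _ /=.
by rewrite !polyCM !rmorphXn /= -mulrA mul_polyC.
Qed.

Lemma hevalM m n f g x y : is_form m f -> is_form n g ->
  heval (m + n) (f * g) x y = heval m f x y * heval n g x y.
Proof. by move=> hf hg; apply: polyC_inj; rewrite polyCM !hevalE hcompM. Qed.

Lemma hevalX m n f x y : is_form m f ->
  heval (m * n) (f ^+ n) x y = heval m f x y ^+ n.
Proof. by move=> hf; apply: polyC_inj; rewrite rmorphXn /= !hevalE hcompX. Qed.

Lemma hevalZ D a f x y : heval D (a *: f) x y = a * heval D f x y.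
Proof. by apply: polyC_inj; rewrite polyCM !hevalE hcompZ mul_polyC. Qed.

Lemma hevalD D f g x y : heval D (f + g) x y = heval D f x y + heval D g x y.
Proof. by apply: polyC_inj; rewrite polyCD !hevalE hcompD. Qed.

Lemma heval_linear a b x y : heval 1 (a *: 'X + b%:P) x y = a * x + b * y.
Proof.
by apply: polyC_inj; rewrite hevalE hcomp_linear polyCD !polyCM !mul_polyC.
Qed.

Lemma hcomp_heval D f x y u :
  hcomp D f (x *: u) (y *: u) = heval D f x y *: u ^+ D.
Proof.
by rewrite -!mul_polyC mulrC [y%:P * u]mulrC hcomp_mul -hevalE mulrC mul_polyC.
Qed.

Lemma heval_hcomp D e f p q x y : is_form e p -> is_form e q ->
  heval (D * e) (hcomp D f p q) x y = heval D f (heval e p x y) (heval e q x y).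
Proof. by move=> hp hq; apply: polyC_inj; rewrite !hevalE hcomp_comp. Qed.

End Substitution.

Definition scale_pair (F : nzRingType) (c : F) (w : {poly F} * {poly F}) :=
  (c *: w.1, c *: w.2).

Definition is_form2 (F : comNzRingType) D (w : {poly F} * {poly F}) :=
  is_form D w.1 && is_form D w.2.

Section Conjugation.
Variable F : comNzRingType.
Implicit Types (w : {poly F} * {poly F}) (M N : 'M[F]_2) (D e n : nat).

Definition mxnum M : {poly F} := M ord0 ord0 *: 'X + (M ord0 ord_max)%:P.
Definition mxden M : {poly F} := M ord_max ord0 *: 'X + (M ord_max ord_max)%:P.

Lemma det2 M : \det M = M ord0 ord0 * M ord_max ord_max - M ord0 ord_max * M ord_max ord0.
Proof.
rewrite (expand_det_row _ ord0) big_ord_recl big_ord1 /cofactor !det_mx11 !mxE /=.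
rewrite !expr0 expr1 mul1r mulN1r mulrN.
by congr (M _ _ * M _ _ - M _ _ * M _ _); apply: val_inj.
Qed.

Lemma mul2E M N i j : (M *m N) i j = M i ord0 * N ord0 j + M i ord_max * N ord_max j.
Proof.
rewrite mxE big_ord_recl big_ord1; congr (_ + M _ _ * N _ _); exact/val_inj.
Qed.

Lemma hconjE D M w : hconj D M w =
  (M ord_max ord_max *: hcomp D w.1 (mxnum M) (mxden M)
     - M ord0 ord_max *: hcomp D w.2 (mxnum M) (mxden M),
   - (M ord_max ord0 *: hcomp D w.1 (mxnum M) (mxden M))
     + M ord0 ord0 *: hcomp D w.2 (mxnum M) (mxden M)).
Proof. by []. Qed.

Lemma is_form_mxnum M : is_form 1 (mxnum M). Proof. exact: is_form_linear. Qed.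
Lemma is_form_mxden M : is_form 1 (mxden M). Proof. exact: is_form_linear. Qed.

Lemma is_form_comp1 D f M : is_form D (hcomp D f (mxnum M) (mxden M)).
Proof. by rewrite -{1}[D]muln1; apply: is_form_hcomp; apply: is_form_linear. Qed.

Lemma is_form_hconj D M w : is_form2 D (hconj D M w).
Proof.
by rewrite hconjE /is_form2 /= !(is_formD, is_formN, is_formZ, is_form_comp1).
Qed.

Lemma hcomp_mx_comp D M N f :
  hcomp D (hcomp D f (mxnum M) (mxden M)) (mxnum N) (mxden N) =
  hcomp D f (mxnum (M *m N)) (mxden (M *m N)).
Proof.
have := @hcomp_comp F D 1 f (mxnum M) (mxden M) (mxnum N) (mxden N).
rewrite muln1 => ->; rewrite ?is_form_linear // !hcomp_linear.
congr (hcomp D f _ _); rewrite /mxnum /mxden !mul2E !scalerDr !scalerA !scalerDl.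
  by rewrite !polyCD !polyCM -!mul_polyC !polyCM; ring.
by rewrite !polyCD !polyCM -!mul_polyC !polyCM; ring.
Qed.

Lemma hconjM D M N w : hconj D (M *m N) w = hconj D N (hconj D M w).
Proof.
rewrite !hconjE /= !(hcompD, hcompN, hcompZ) !hcomp_mx_comp !mul2E.
by congr pair; rewrite -!mul_polyC !polyCD !polyCM; ring.
Qed.

Lemma mxnum1 : mxnum 1%:M = 'X.
Proof. by rewrite /mxnum !mxE /= scale1r addr0. Qed.
Lemma mxden1 : mxden 1%:M = 1.
Proof. by rewrite /mxden !mxE /= scale0r add0r. Qed.

Lemma hconj1 D w : is_form2 D w -> hconj D 1%:M w = w.
Proof.
case: w => f g /andP[/= hf hg]; rewrite hconjE mxnum1 mxden1 /= !hcomp_id // !mxE /=.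
by rewrite !scale1r !scale0r subr0 oppr0 add0r.
Qed.

Lemma hconj_scale D M c w : hconj D M (scale_pair c w) = scale_pair c (hconj D M w).
Proof.
rewrite /scale_pair !hconjE /= !hcompZ.
by congr pair; rewrite -!mul_polyC; ring.
Qed.

(** The substitution contributes [D] factors of [c] and the adjugate one more; this matches the
    power [D.+1] of the determinant in the cost. *)
Lemma hconj_scalemx D M c w : hconj D (c *: M) w = scale_pair (c ^+ D.+1) (hconj D M w).
Proof.
rewrite /scale_pair !hconjE /= !mxE.
have -> : mxnum (c *: M) = c *: mxnum M.
  by rewrite /mxnum !mxE -!mul_polyC !polyCM; ring.
have -> : mxden (c *: M) = c *: mxden M.
  by rewrite /mxden !mxE -!mul_polyC !polyCM; ring.
by rewrite !hcomp_scale exprS; congr pair; rewrite -!mul_polyC !polyCM; ring.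
Qed.

Definition hcomp2 D w (v : {poly F} * {poly F}) :=
  (hcomp D w.1 v.1 v.2, hcomp D w.2 v.1 v.2).

Lemma hiterS D w n : hiter D w n.+1 = hcomp2 D w (hiter D w n).
Proof. by []. Qed.

Lemma is_form_hiter D w n : is_form2 D w -> is_form2 (D ^ n) (hiter D w n).
Proof.
move=> hw; elim: n => [|n /andP[h1 h2]]; first by rewrite /is_form2 /is_form /= size_polyX size_poly1.
by rewrite hiterS expnS /is_form2 /= !is_form_hcomp.
Qed.

(** Equals 1 + D + ... + D^(n-1), the degree of the n-th iterate in the coefficients of the map. *)
Fixpoint iter_expo (D n : nat) : nat := if n is n'.+1 then (1 + D * iter_expo D n')%N else 0%N.

Lemma hiter_scale D c w n :
  hiter D (scale_pair c w) n = scale_pair (c ^+ iter_expo D n) (hiter D w n).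
Proof.
elim: n => [|n IH]; first by rewrite /scale_pair /= expr0 !scale1r.
rewrite !hiterS IH /hcomp2 /scale_pair /= !hcompZ !hcomp_scale !scalerA.
by rewrite exprD expr1 -exprM mulnC.
Qed.

(* The adjugate lift only inverts gamma up to det gamma, whence the scalar. *)
Lemma hiter_hconj D M w n : is_form2 D w ->
  exists k, hiter D (hconj D M w) n.+1 =
    scale_pair (\det M ^+ k) (hconj (D ^ n.+1) M (hiter D w n.+1)).
Proof.
move=> hw; elim: n => [|n [k IH]].
  exists 0%N; rewrite expr0 /scale_pair !scale1r !hiterS expn1 /hcomp2 /=.
  have /andP[h1 h2] := is_form_hconj D M w; case/andP: hw => h3 h4.
  by rewrite !hcomp_id // -surjective_pairing; congr hconj; case: (w).
exists (D * k + D)%N; rewrite hiterS IH (hiterS _ w n.+1).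
move: (hiter D w n.+1) (is_form_hiter n.+1 hw).
move=> v /andP[hv1 hv2]; rewrite /hcomp2 /scale_pair /=.
rewrite !hcomp_scale -!exprM [(k * D)%N]mulnC; set s := \det M ^+ (D * k).
set V1 := hcomp (D ^ n.+1) v.1 (mxnum M) (mxden M).
set V2 := hcomp (D ^ n.+1) v.2 (mxnum M) (mxden M).
have key f : hcomp D (hcomp D f (mxnum M) (mxden M))
    (M ord_max ord_max *: V1 - M ord0 ord_max *: V2)
    (- (M ord_max ord0 *: V1) + M ord0 ord0 *: V2) = \det M ^+ D *: hcomp D f V1 V2.
  have := @hcomp_comp F D 1 f (mxnum M) (mxden M)
    (M ord_max ord_max *: V1 - M ord0 ord_max *: V2)
    (- (M ord_max ord0 *: V1) + M ord0 ord0 *: V2).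
  rewrite muln1 => ->; rewrite ?is_form_linear // -hcomp_scale !hcomp_linear det2.
  by congr hcomp; rewrite -!mul_polyC !polyCB !polyCM; ring.
rewrite !(hcompD, hcompN, hcompZ) !key expnS !hcomp_comp //.
rewrite -/V1 -/V2 exprD -/s.
by congr pair; rewrite -!mul_polyC !polyCM; ring.
Qed.

End Conjugation.

(** * Sylvester determinants and the resultant of binary forms *)

Section Rows.
Variable R : comNzRingType.
Implicit Types (f g : {poly R}) (h : nat -> {poly R}) (x y : R) (m n N : nat).

(* The linear form yX - xY vanishing at the point l = (x, y). *)
Definition lin (l : R * R) : {poly R} := l.2 *: 'X + (- l.1)%:P.

(** The classical bracket of two points, that is the value of [lin l] at [u]. Over a field and for
    nonzero pairs it vanishes exactly when they define the same point of the projective line. *)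
Definition br (l u : R * R) : R := l.2 * u.1 - l.1 * u.2.

Lemma is_form_lin l : is_form 1 (lin l). Proof. exact: is_form_linear. Qed.

Lemma heval_lin l x y : heval 1 (lin l) x y = br l (x, y).
Proof. by rewrite heval_linear mulNr. Qed.

(** Rows are polynomials indexed by [nat], so that a row can be prepended or divided by a linear
    factor without casts between ordinals. *)
Definition rowdet N h : R := \det (\matrix_(i < N, j < N) (h i)`_j).

Definition sylrow n f g (i : nat) : {poly R} :=
  if (i < n)%N then 'X^i * f else 'X^(i - n) * g.

(** The resultant for independent formal degrees [m] of [f] and [n] of [g]: even when the degrees
    start equal, removing linear factors of [g] one at a time makes them differ. *)
Definition res m n f g : R := rowdet (n + m) (sylrow n f g).

Lemma hres_res D f g : hres D f g = res D D f g.
Proof.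
congr (\det _); apply/matrixP => i j; rewrite !mxE /sylrow.
by case: ifP => hi; rewrite coefXnM; case: ltnP => // hij; rewrite leqNgt hij.
Qed.

Lemma eq_rowdet N h h' : (forall i, (i < N)%N -> h i = h' i) -> rowdet N h = rowdet N h'.
Proof. by move=> e; congr (\det _); apply/matrixP => i j; rewrite !mxE e. Qed.

Lemma res_scale m n a b f g : res m n (a *: f) (b *: g) = a ^+ n * b ^+ m * res m n f g.
Proof.
pose d := \row_(i < n + m) (if (i < n)%N then a else b).
have -> : res m n (a *: f) (b *: g) =
    \det (diag_mx d *m \matrix_(i < n + m, j < n + m) (sylrow n f g i)`_j).
  congr (\det _); rewrite mul_diag_mx; apply/matrixP => i j; rewrite !mxE /sylrow.
  by case: ifP => _; rewrite -scalerAr coefZ.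
rewrite det_mulmx det_diag big_split_ord /=; congr (_ * _ * _).
  by rewrite (eq_bigr (fun=> a)) ?prodr_const ?card_ord // => i _; rewrite mxE /= ltn_ord.
rewrite (eq_bigr (fun=> b)) ?prodr_const ?card_ord // => i _.
by rewrite mxE /= ltnNge leq_addr.
Qed.

(* Rows [a F + b G; c F + e G] come from [F; G] by the block matrix of scalars. *)
Lemma res_comb D a b c e f g :
  res D D (a *: f + b *: g) (c *: f + e *: g) = (a * e - b * c) ^+ D * res D D f g.
Proof.
pose S f g := \matrix_(i < D + D, j < D + D) (sylrow D f g i)`_j.
pose A := block_mx (a%:M : 'M_D) b%:M c%:M e%:M.
have hA : S (a *: f + b *: g) (c *: f + e *: g) = A *m S f g.
  have Sc u v : S u v = col_mx (\matrix_(i < D, j < D + D) ('X^i * u)`_j)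
      (\matrix_(i < D, j < D + D) ('X^i * v)`_j).
    apply/matrixP => i j; rewrite /S !mxE /sylrow.
    case: splitP => k hk; by rewrite !mxE hk ?addKn.
  rewrite !Sc mul_block_col !mul_scalar_mx; congr col_mx; apply/matrixP => i j; rewrite !mxE;
  by rewrite mulrDr -!scalerAr coefD !coefZ.
have -> : res D D (a *: f + b *: g) (c *: f + e *: g) = \det A * res D D f g.
  by rewrite -det_mulmx -hA.
congr (_ * _); rewrite /A {A hA S f g}.
(* Generic [a] avoids a case analysis: cancel ['X + a] and specialize at 0. *)
pose a' : {poly R} := 'X + a%:P.
pose B : 'M[{poly R}]_(D + D) := block_mx a'%:M (b%:P)%:M (c%:P)%:M (e%:P)%:M.
have key : \det B = (a' * e%:P - b%:P * c%:P) ^+ D.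
  have hr : GRing.rreg (a' ^+ D) by apply/monic_rreg/monic_exp/monicXaddC.
  apply: hr.
  have := det_mulmx B (block_mx 1%:M (- b%:P)%:M 0 a'%:M).
  rewrite mulmx_block !mulmx1 !mulmx0 !addr0 det_ublock det1 mul1r !det_scalar => <-.
  rewrite -!scalar_mxM mulrN (mulrC b%:P a') raddfN /= addNr det_lblock !det_scalar.
  by rewrite -mulrC -raddfD /= mulrN addrC det_scalar [e%:P * _]mulrC [c%:P * _]mulrC.
have := congr1 (horner_eval 0) key.
rewrite rmorphXn rmorphB !rmorphM -det_map_mx /= /horner_eval !hornerE => <-.
have ev0 (u : {poly R}) : map_mx (horner^~ 0) (u%:M : 'M_D) = (u.[0])%:M.
  by apply/matrixP => i j; rewrite !mxE hornerMn.
by rewrite /B map_block_mx !ev0 !hornerE.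
Qed.
End Rows.

Lemma rowdet_map (R S : comNzRingType) (phi : {rmorphism R -> S}) N (h : nat -> {poly R}) :
  phi (rowdet N h) = rowdet N (fun i => map_poly phi (h i)).
Proof.
rewrite -det_map_mx; congr (\det _); apply/matrixP => i j.
by rewrite !mxE coef_map.
Qed.

Section ResultantStep.
Variable R : idomainType.
Implicit Types (f g : {poly R}) (h : nat -> {poly R}) (x y : R) (m n N : nat).

Lemma heval_widen m n f x y : is_form m f ->
  heval (n + m) f x y = y ^+ n * heval m f x y.
Proof.
move=> hf; rewrite -{1}[f]mul1r hevalM //; last by rewrite /is_form size_poly1.
congr (_ * _); rewrite /heval (bigD1 ord0) //= coefC eqxx expr0 !mul1r subn0.
rewrite big1 ?addr0 // => i; rewrite -val_eqE /= coefC => /negbTE ->.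
by rewrite !mul0r.
Qed.

(** The matrix [V] replaces the first column by the values of the rows at the point [l], where all
    rows but the first vanish. The remaining minor is the matrix of the [h i] times the matrix [T]
    of multiplication by [lin l]. Both [V] and [T] are triangular of determinant [l.2 ^+ N], which
    cancels. *)
Lemma rowdet_lin (l : R * R) N (f0 : {poly R}) h : l.2 != 0 ->
  is_form N f0 -> (forall i, (i < N)%N -> (size (h i) <= N)%N) ->
  rowdet N.+1 (fun i => if i is i'.+1 then lin l * h i' else f0) =
    heval N f0 l.1 l.2 * rowdet N h.
Proof.
case: l => x y /= hy hf0 hh.
pose h' i := if i is i'.+1 then lin (x, y) * h i' else f0.
pose S := \matrix_(i < N.+1, j < N.+1) (h' i)`_j.
pose V : 'M[R]_N.+1 :=
  \matrix_(i, j) if j == ord0 then x ^+ i * y ^+ (N - i) else (i == j)%:R.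
pose T : 'M[R]_N := \matrix_(i, j) (y *+ (i == j) - x *+ (i == j.+1 :> nat)).
have hform i : (i < N)%N -> is_form N (lin (x, y) * h i).
  move=> hi; case: N hi hh {hf0 h' S V T} => // N hi hh.
  by rewrite -add1n is_formM ?is_form_lin // /is_form hh.
have dV : \det V = y ^+ N.
  rewrite det_trig; last first.
    apply/is_trig_mxP => i j hij; rewrite !mxE -!val_eqE /=.
    by rewrite (gtn_eqF (leq_ltn_trans _ hij)) // (ltn_eqF hij).
  rewrite big_ord_recl mxE eqxx mul1r subn0 big1 ?mulr1 // => i _.
  by rewrite mxE eqxx.
have dT : \det T = y ^+ N.
  rewrite det_trig; last first.
    apply/is_trig_mxP => i j hij; rewrite mxE -val_eqE /= (ltn_eqF hij).
    by rewrite (ltn_eqF (leqW hij)) !mulr0n subr0.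
  rewrite (eq_bigr (fun=> y)) ?prodr_const ?card_ord // => i _.
  by rewrite mxE eqxx (ltn_eqF (ltnSn i)) mulr0n subr0.
have SVE i j : (S *m V) i j = if j == ord0 then heval N (h' i) x y else S i j.
  rewrite mxE; case: eqP => [->|/eqP hj].
    by apply: eq_bigr => k _; rewrite !mxE eqxx mulrA.
  rewrite (bigD1 j) //= big1 => [|k hk]; rewrite !mxE (negbTE hj).
    by rewrite eqxx mulr1 addr0.
  by rewrite (negbTE hk) mulr0.
have hS0 i : (i < N)%N -> heval N (lin (x, y) * h i) x y = 0.
  move=> hi; have hN : N = (1 + N.-1)%N by case: N hi {hh hf0 h' S V T hform dV dT SVE}.
  have hf : is_form N.-1 (h i) by rewrite /is_form -add1n -hN hh.
  by rewrite hN hevalM ?is_form_lin // heval_lin /br /= [y * x]mulrC subrr mul0r.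
have dSV : \det (S *m V) = heval N f0 x y * \det (\matrix_(i < N, j < N) (h i)`_j *m T).
  rewrite (expand_det_col _ ord0) big_ord_recl big1 ?addr0; last first.
    by move=> k _; rewrite SVE eqxx hS0 ?mul0r.
  rewrite SVE eqxx; congr (_ * _); rewrite /cofactor expr0 mul1r; congr (\det _).
  apply/matrixP => i j; rewrite mxE [LHS]mxE SVE /= mxE /h' /lift /=.
  rewrite /lin mulrDl -scalerAl mul_polyC coefD !coefZ coefXM /=.
  have TE k : T k j = y *+ (k == j) - x *+ (k == j.+1 :> nat) by rewrite mxE.
  rewrite mxE (bigD1 j) //= TE mxE eqxx (ltn_eqF (ltnSn j)) mulr0n subr0 mulr1n mulrC add0n.
  congr (_ + _); rewrite mulNr.
  case: (ltnP j.+1 N) => hj.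
    have hjj : Ordinal hj != j by rewrite -val_eqE /= gtn_eqF.
    rewrite (bigD1 (Ordinal hj)) //= TE mxE (negbTE hjj) eqxx mulr0n sub0r mulr1n.
    rewrite mulrN mulrC big1 ?addr0 // => k /andP[h1 h2].
    by rewrite TE (negbTE h1) -[(k == j.+1 :> nat)]/(k == Ordinal hj) (negbTE h2) !mulr0n subr0 mulr0.
  rewrite nth_default ?mulr0 ?oppr0 ?(leq_trans (hh i _)) // big1 // => k hk.
  rewrite TE (negbTE hk) (ltn_eqF (leq_trans (ltn_ord k) hj)).
  by rewrite !mulr0n subr0 mulr0.
have hyN : y ^+ N != 0 by rewrite expf_neq0.
apply: (mulIf hyN); rewrite -{1}dV -det_mulmx -/S dSV det_mulmx dT.
by rewrite mulrA.
Qed.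

(** Replacing the row X^i f by l.2 X^i f - l.1 X^(i-1) f for 0 < i <= n makes every row but the
    first a multiple of [lin l], so that [rowdet_lin] applies. This multiplies the determinant by
    [l.2 ^+ n], the same factor that [heval_widen] produces on the other side. *)
Lemma res_lin_neq0 (l : R * R) m n f g : l.2 != 0 -> is_form m f -> is_form n g ->
  res m n.+1 f (g * lin l) = heval m f l.1 l.2 * res m n f g.
Proof.
move=> hy hf hg.
pose A : 'M[R]_(n.+1 + m) := \matrix_(i, j)
  (if (0 < i <= n)%N then l.2 *+ (i == j) - l.1 *+ (i == j.+1 :> nat) else (i == j)%:R).
have dA : \det A = l.2 ^+ n.
  rewrite det_trig; last first.
    apply/is_trig_mxP => i j hij; rewrite mxE -val_eqE /= (ltn_eqF hij).
    by rewrite (ltn_eqF (leqW hij)) !mulr0n subr0 if_same.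
  rewrite big_split_ord /= [X in _ * X]big1 ?mulr1 => [|i _]; last first.
    by rewrite mxE /= eqxx; case: ifP => //; lia.
  rewrite big_ord_recl mxE /= mul1r (eq_bigr (fun=> l.2)) ?prodr_const ?card_ord // => i _.
  by rewrite mxE /= /bump /= add1n ltn_ord eqxx (ltn_eqF (ltnSn _)) mulr0n subr0.
have hN : rowdet (n.+1 + m) (fun i => if i is i'.+1 then lin l * sylrow n f g i' else f) =
    l.2 ^+ n * res m n.+1 f (g * lin l).
  rewrite -dA -det_mulmx; congr (\det _); apply/matrixP => i j; rewrite [LHS]mxE [RHS]mxE.
  have AE k : A i k = if (0 < i <= n)%N then l.2 *+ (i == k) - l.1 *+ (i == k.+1 :> nat)
     else (i == k)%:R by rewrite mxE.
  rewrite (bigD1 i) //= AE mxE eqxx; case: ifP => hi; last first.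
    rewrite mul1r big1 ?addr0 => [|k hk]; last by rewrite AE hi eq_sym (negbTE hk) mul0r.
    case: i hi {AE} => [[|i] hi] //= hin; first by rewrite /sylrow /= expr0 mul1r.
    by rewrite /sylrow !ltnS ltnNge in hin *; rewrite (negbFE hin) /= subSS mulrC mulrA.
  have hi1 : (i.-1 < n.+1 + m)%N by rewrite (leq_ltn_trans (leq_pred i)).
  have hne : Ordinal hi1 != i by rewrite -val_eqE /=; case/andP: hi; lia.
  rewrite (ltn_eqF (ltnSn i)) mulr0n subr0 (bigD1 (Ordinal hi1)) //= AE hi mxE.
  rewrite eq_sym (negbTE hne) /= prednK ?eqxx ?mulr0n ?sub0r; last by case/andP: hi.
  rewrite big1 ?addr0 => [|k /andP[h1 h2]]; last first.
    rewrite AE hi eq_sym (negbTE h1) mulr0n sub0r.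
    have -> : (i == k.+1 :> nat) = false; last by rewrite mulr0n oppr0 mul0r.
    by apply/eqP => e; case/eqP: h2; apply: val_inj; rewrite /= e.
  case: i hi {AE hi1 hne} => [[|i] hi] //= hin; rewrite /sylrow !ltnS hin (ltnW hin).
  rewrite /lin mulrDl -scalerAl ['X * (_ * _)]mulrA -exprS mul_polyC coefD !coefZ.
  by rewrite !mulNr.
have := @rowdet_lin l (n + m) f (sylrow n f g) hy.
rewrite addSn in hN; rewrite hN heval_widen // => e.
have hyn : l.2 ^+ n != 0 by rewrite expf_neq0.
apply: (mulfI hyn); rewrite e ?mulrA // => [|i hi].
  by rewrite /is_form (leq_trans hf) // ltnS leq_addl.
rewrite /sylrow; case: ltnP => hin; rewrite (leq_trans (size_polyMleq _ _)) // size_polyXn.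
  by rewrite addSn /= -ltnS -addSn -addnS leq_add.
move: hg; rewrite addSn /= /is_form; move: (size g) => s; lia.
Qed.
End ResultantStep.

Lemma res_map (R S : comNzRingType) (phi : {rmorphism R -> S}) m n (f g : {poly R}) :
  phi (res m n f g) = res m n (map_poly phi f) (map_poly phi g).
Proof.
rewrite rowdet_map; apply: eq_rowdet => i _; rewrite /sylrow.
by case: ifP => _; rewrite rmorphM /= map_polyXn.
Qed.

Section ProductFormula.
Variable R : idomainType.
Implicit Types (f g : {poly R}) (m n : nat).

(* The case [l.2 = 0] is obtained by specializing ['X + l.2] at 0. *)
Lemma res_lin (l : R * R) m n f g : is_form m f -> is_form n g ->
  res m n.+1 f (g * lin l) = heval m f l.1 l.2 * res m n f g.
Proof.
move=> hf hg; pose l' : {poly R} * {poly R} := (l.1%:P, 'X + l.2%:P).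
have hl' : l'.2 != 0 by rewrite -size_poly_eq0 size_XaddC.
have sz (h : {poly R}) : size (map_poly polyC h) = size h by apply: size_map_polyC.
have := @res_lin_neq0 _ l' m n (map_poly polyC f) (map_poly polyC g) hl'.
rewrite /is_form !sz => /(_ hf hg) /(congr1 (horner_eval 0)).
have ev (h : {poly R}) : map_poly (horner_eval 0) (map_poly polyC h) = h.
  by rewrite -map_poly_comp map_poly_id // => c _; rewrite /= /horner_eval hornerC.
rewrite rmorphM !res_map rmorphM /= !ev.
have -> : map_poly (horner_eval 0) (lin l') = lin l.
  rewrite /lin rmorphD /= map_polyZ map_polyX map_polyC /= /horner_eval !hornerE.
  by [].
move=> ->; congr (_ * _); rewrite /heval rmorph_sum; apply: eq_bigr => i _ /=.
by rewrite !rmorphM !rmorphXn /= coef_map /= /horner_eval !hornerE.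
Qed.

Lemma is_form_prod_seq (I : Type) (L : seq I) D (h : I -> {poly R}) :
  (forall i, is_form D (h i)) -> is_form (size L * D) (\prod_(i <- L) h i).
Proof.
move=> hh; elim: L => [|i L IH]; first by rewrite big_nil /is_form size_poly1.
by rewrite big_cons mulSn is_formM.
Qed.

Lemma hcomp_prod_seq (I : Type) (L : seq I) D (h : I -> {poly R}) p q :
  (forall i, is_form D (h i)) ->
  hcomp (size L * D) (\prod_(i <- L) h i) p q = \prod_(i <- L) hcomp D (h i) p q.
Proof.
move=> hh; elim: L => [|i L IH]; first by rewrite !big_nil hcomp1.
by rewrite !big_cons mulSn hcompM ?is_form_prod_seq // IH.
Qed.

Lemma heval_prod_seq (I : Type) (L : seq I) D (h : I -> {poly R}) x y :
  (forall i, is_form D (h i)) ->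
  heval (size L * D) (\prod_(i <- L) h i) x y = \prod_(i <- L) heval D (h i) x y.
Proof.
move=> hh; apply: polyC_inj; rewrite rmorph_prod hevalE hcomp_prod_seq //.
by apply: eq_bigr => i _; rewrite -hevalE.
Qed.

Definition linprod (L : seq (R * R)) : {poly R} := \prod_(l <- L) lin l.

Lemma is_form_linprod L : is_form (size L) (linprod L).
Proof. by rewrite -[size L]muln1 is_form_prod_seq // => l; apply: is_form_lin. Qed.

Lemma heval_linprod L x y : heval (size L) (linprod L) x y = \prod_(l <- L) br l (x, y).
Proof.
rewrite -[size L in LHS]muln1 heval_prod_seq => [|l]; last exact: is_form_lin.
by apply: eq_bigr => l _; rewrite heval_lin.
Qed.

Lemma hcomp_linprod L p q :
  hcomp (size L) (linprod L) p q = \prod_(l <- L) (l.2 *: p - l.1 *: q).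
Proof.
rewrite -[size L in LHS]muln1 hcomp_prod_seq => [|l]; last exact: is_form_lin.
by apply: eq_bigr => l _; rewrite hcomp_linear scaleNr.
Qed.

Lemma res_linprod L m f : is_form m f ->
  res m (size L) f (linprod L) = \prod_(l <- L) heval m f l.1 l.2.
Proof.
move=> hf; elim: L => [|l L IH].
  rewrite /linprod !big_nil -[RHS](det1 _ (0 + m)); congr (\det _); apply/matrixP => i j.
  by rewrite !mxE /sylrow /= subn0 mulr1 coefXn eq_sym.
rewrite /linprod !big_cons mulrC res_lin ?is_form_linprod //.
by congr (_ * _); rewrite -IH.
Qed.

End ProductFormula.

(** Algebraic closedness as a property of a plain field: the residue field comes without a
    closed-field structure and acquires this property in [root_closed_residue]. *)
Definition root_closed (F : fieldType) :=
  forall p : {poly F}, (1 < size p)%N -> exists x, root p x.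

Section RootClosed.
Variable F : fieldType.
Hypothesis hF : root_closed F.
Implicit Types (f g p q : {poly F}) (m n D e : nat).

Lemma form_split D f : is_form D f ->
  exists c L, [/\ size L = D, f = c *: linprod L & all (fun l => l != 0) L].
Proof.
elim: D f => [|D IH] f hf.
  exists f`_0, [::]; split => //; rewrite /linprod big_nil alg_polyC.
  by apply: size1_polyC.
have [hsz|hsz] := leqP (size f) 1.
  have [c [L [hL hfc hall]]] := IH f (leq_trans hsz (ltn0Sn _)).
  exists c, ((-1, 0) :: L); rewrite /= hL; split => //.
    by rewrite /linprod big_cons /lin /= scale0r add0r opprK mul1r.
  by rewrite hall andbT xpair_eqE oppr_eq0 oner_eq0.
have [x /factor_theorem[g hg]] := hF hsz.
have hgD : is_form D g.
  have [->|g0] := eqVneq g 0; first by rewrite /is_form size_poly0.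
  by move: hf; rewrite /is_form hg size_Mmonic ?monicXsubC // size_XsubC addn2.
have [c [L [hL hgc hall]]] := IH g hgD.
exists c, ((x, 1) :: L); rewrite /= hL; split => //.
  by rewrite hg hgc /linprod big_cons /lin /= scale1r polyCN mulrC scalerAr.
by rewrite hall andbT xpair_eqE oner_eq0 andbF.
Qed.

Lemma resZr m n a f g : res m n f (a *: g) = a ^+ m * res m n f g.
Proof. by have := res_scale m n 1 a f g; rewrite scale1r expr1n mul1r. Qed.

Lemma resMr m n1 n2 f g1 g2 : is_form m f -> is_form n1 g1 -> is_form n2 g2 ->
  res m (n1 + n2) f (g1 * g2) = res m n1 f g1 * res m n2 f g2.
Proof.
move=> hf /form_split[c1 [L1 [<- -> _]]] /form_split[c2 [L2 [<- -> _]]].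
rewrite -scalerAl -scalerAr scalerA -size_cat /linprod -big_cat.
by rewrite !resZr !res_linprod // big_cat exprMn mulrACA.
Qed.

Lemma resMl m1 m2 n f1 f2 g : is_form m1 f1 -> is_form m2 f2 -> is_form n g ->
  res (m1 + m2) n (f1 * f2) g = res m1 n f1 g * res m2 n f2 g.
Proof.
move=> h1 h2 /form_split[c [L [<- -> _]]].
rewrite !resZr !res_linprod ?is_formM //.
rewrite (eq_bigr (fun l => heval m1 f1 l.1 l.2 * heval m2 f2 l.1 l.2)) => [|l _].
  by rewrite big_split exprD mulrACA.
by rewrite hevalM.
Qed.

Lemma res_prodr (I : Type) (L : seq I) m e f (h : I -> {poly F}) :
  is_form m f -> (forall i, is_form e (h i)) ->
  res m (size L * e) f (\prod_(i <- L) h i) = \prod_(i <- L) res m e f (h i).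
Proof.
move=> hf hh; elim: L => [|i L IH].
  by have := res_linprod [::] hf; rewrite /linprod !big_nil.
by rewrite !big_cons mulSn resMr ?is_form_prod_seq // IH.
Qed.

Lemma res_form0l n g : is_form n g -> res 0 n 1 g = 1.
Proof.
move=> /form_split[c [L [<- -> _]]]; rewrite resZr res_linprod ?mul1r /is_form ?size_poly1 //.
by rewrite big1 // => l _; rewrite /heval big_ord1 coefC eqxx !expr0 !mulr1.
Qed.

Lemma res_prodl (I : Type) (L : seq I) n e g (h : I -> {poly F}) :
  is_form n g -> (forall i, is_form e (h i)) ->
  res (size L * e) n (\prod_(i <- L) h i) g = \prod_(i <- L) res e n (h i) g.
Proof.
move=> hg hh; elim: L => [|i L IH]; first by rewrite !big_nil res_form0l.
by rewrite !big_cons mulSn resMl ?is_form_prod_seq // IH.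
Qed.

(** Splitting the outer forms into lines turns both compositions into products of members l.2 p -
    l.1 q of the pencil of p and q. By [res_comb] two such members have resultant a power of their
    bracket times Res(p, q), up to sign, and there are D * D pairs. *)
Lemma hres_hcomp D e f g p q :
  is_form D f -> is_form D g -> is_form e p -> is_form e q ->
  hres (D * e) (hcomp D f p q) (hcomp D g p q) =
    (-1) ^+ (e * (D * D)) * hres D f g ^+ e * hres e p q ^+ (D * D).
Proof.
move=> hf hg hp hq; rewrite !hres_res.
have [c [L [hL -> _]]] := form_split hf; have [c' [L' [hL' -> _]]] := form_split hg.
have hform (l : F * F) : is_form e (l.2 *: p - l.1 *: q).
  by rewrite is_formD ?is_formN ?is_formZ.
have -> : hcomp D (c *: linprod L) p q = c *: \prod_(l <- L) (l.2 *: p - l.1 *: q).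
  by rewrite hcompZ -hL hcomp_linprod.
have -> : hcomp D (c' *: linprod L') p q = c' *: \prod_(l <- L') (l.2 *: p - l.1 *: q).
  by rewrite hcompZ -hL' hcomp_linprod.
rewrite res_scale.
have := @res_prodl _ L (size L' * e) e _ _ (is_form_prod_seq L' hform) hform.
rewrite hL hL' => ->.
rewrite (eq_bigr (fun l => \prod_(l' <- L') (br l l' ^+ e * ((-1) ^+ e * res e e p q)))); last first.
  move=> l _; have := @res_prodr _ L' e e _ _ (hform l) hform; rewrite hL' => ->.
  apply: eq_bigr => l' _; rewrite -!scaleNr res_comb /br mulrA -exprMn.
  by congr (_ ^+ _ * _); ring.
have -> : res D D (c *: linprod L) (c' *: linprod L') =
    c ^+ D * c' ^+ D * \prod_(l <- L) \prod_(l' <- L') br l l'.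
  rewrite res_scale; congr (_ * _).
  have := @res_linprod _ L' D (linprod L); rewrite hL' => ->; last by rewrite -hL is_form_linprod.
  rewrite exchange_big /=; apply: eq_bigr => l' _.
  by rewrite -hL heval_linprod; apply: eq_bigr => l _; case: (l').
have prodc (I : Type) (r : seq I) (a : F) : \prod_(i <- r) a = a ^+ size r.
  by rewrite big_const_seq count_predT -Monoid.iteropE.
under eq_bigr => l _ do rewrite big_split /= prodc prodrXl hL'.
rewrite big_split /= prodc prodrXl hL -exprM !exprMn -!exprM.
by rewrite [(D * e)%N]mulnC !(mulnC e) !mulrA; ring.
Qed.

End RootClosed.

(** * Resultants of lifts, conjugates and iterates *)

Section ResultantOfLifts.
Variable F : fieldType.
Hypothesis hF : root_closed F.
Implicit Types (f g p q : {poly F}) (w : {poly F} * {poly F}) (m n D e : nat).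

Lemma heval_root D f x y : y != 0 -> is_form D f -> heval D f x y = y ^+ D * f.[x / y].
Proof.
move=> hy hf; rewrite (horner_coef_wide _ hf) mulr_sumr; apply: eq_bigr => i _.
have -> : y ^+ D = y ^+ i * y ^+ (D - i) by rewrite -exprD subnKC // -ltnS.
by rewrite expr_div_n mulrCA -!mulrA; congr (_ * _); field; rewrite expf_neq0.
Qed.

Lemma heval_inf D f x : heval D f x 0 = f`_D * x ^+ D.
Proof.
rewrite /heval big_ord_recr /= subnn expr0 mulr1 big1 ?add0r // => i _.
by rewrite expr0n subn_eq0 leqNgt ltn_ord mulr0.
Qed.

Lemma hcoprime_heval D f g x y : is_form D f -> is_form D g -> hcoprime D f g ->
  heval D f x y = 0 -> heval D g x y = 0 -> (0 < D)%N -> (x, y) = 0.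
Proof.
move=> hf hg /andP[hc hs] f0 g0 hD; apply/eqP; apply: contraLR hc => hxy.
have [y0|y0] := eqVneq y 0.
  have x0 : x != 0 by apply: contra hxy => /eqP->; rewrite y0.
  have top h : is_form D h -> heval D h x y = 0 -> size h != D.+1.
    move=> hh; rewrite y0 heval_inf => /eqP; rewrite mulf_eq0 expf_eq0 (negbTE x0) andbF orbF.
    move=> hD0; apply/eqP => hsz; move: hD0; rewrite -[D]/(D.+1.-1) -hsz -/(lead_coef h).
    by rewrite lead_coef_eq0 -size_poly_eq0 hsz.
  by case/orP: hs => hs; [have := top f hf f0 | have := top g hg g0]; rewrite hs.
move/eqP: f0; move/eqP: g0; rewrite !heval_root // !mulf_eq0 !expf_eq0 (negbTE y0) andbF /=.
by move=> g0 f0; apply/negP => /coprimep_root/(_ f0)/negP; rewrite g0.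
Qed.

Lemma hres_neq0 D w : (0 < D)%N -> is_lift D w -> hres D w.1 w.2 != 0.
Proof.
case: w => f g hD [/= hf hg hc]; have [c [L [hL hgL hall]]] := form_split hF hg.
rewrite hres_res hgL resZr; have := res_linprod L hf; rewrite hL => ->.
rewrite mulf_neq0 //.
  rewrite expf_neq0 //; apply/eqP => c0; rewrite hgL c0 scale0r /hcoprime in hc.
  case/andP: hc; rewrite coprimep0 -size_poly_eq1 => /eqP ->.
  by rewrite size_poly0 /= orbF eqSS (ltn_eqF hD).
rewrite prodf_seq_neq0; apply/allP => l hl /=; apply/eqP => f0.
have : (l.1, l.2) = 0; last by rewrite -surjective_pairing => l0; have := allP hall l hl; rewrite l0 eqxx.
apply: (hcoprime_heval hf hg hc) => //; rewrite hgL hevalZ -{1}hL heval_linprod.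
have -> : \prod_(l' <- L) br l' (l.1, l.2) = 0.
  by apply/eqP; rewrite prodf_seq_eq0; apply/hasP; exists l; rewrite // /br /= mulrC subrr.
by rewrite mulr0.
Qed.

Lemma hres_scale D c w :
  hres D (scale_pair c w).1 (scale_pair c w).2 = c ^+ (D + D) * hres D w.1 w.2.
Proof. by rewrite !hres_res res_scale exprD. Qed.

(** The substitution contributes [D * D] factors of the determinant and the adjugate combination [D]
    more. *)
Lemma hres_hconj D M w : is_form2 D w ->
  hres D (hconj D M w).1 (hconj D M w).2 = \det M ^+ (D.+1 * D) * hres D w.1 w.2.
Proof.
case/andP=> h1 h2; rewrite hconjE hres_res /= -!scaleNr.
rewrite res_comb -hres_res.
have := @hres_hcomp F hF D 1 w.1 w.2 (mxnum M) (mxden M).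
rewrite muln1 => -> //; rewrite ?is_form_linear // !hres_res.
have -> : res 1 1 (mxnum M) (mxden M) = - \det M.
  rewrite det2 /res /rowdet det2 !mxE /sylrow /= expr0 !mul1r /mxnum /mxden.
  by rewrite !coefD !coefZ !coefX !coefC /=; ring.
rewrite mul1n expr1 mulSn exprD (exprNn (\det M)).
have -> : M ord_max ord_max * M ord0 ord0 - - M ord0 ord_max * - M ord_max ord0 = \det M.
  by rewrite det2; ring.
rewrite -!mulrA; congr (_ * _).
have : (-1) ^+ (D * D) * (-1) ^+ (D * D) = 1 :> F by rewrite -exprMn mulrNN mulr1 expr1n.
set s := _ ^+ _ => ss.
by rewrite (mulrCA _ s) (mulrA s s) ss mul1r mulrC.
Qed.

(** The factor of the iteration formula, as [res_expoE] shows. The recursion is [hres_hcomp] with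
    outer degree [D] and inner degree [D ^ n']. *)
Fixpoint res_expo (D n : nat) : nat :=
  if n is n'.+1 then (D ^ n' + D * D * res_expo D n')%N else 0%N.

Lemma res_expoE D n : (D * D.-1 * res_expo D n = D ^ n * (D ^ n).-1)%N.
Proof.
case: D => [|D]; first by rewrite !mul0n; case: n => //= n; rewrite exp0n.
elim: n => [|n IH]; first by rewrite muln0.
rewrite [res_expo _ _]/= mulnDr mulnCA IH expnS.
have : (0 < D.+1 ^ n)%N by rewrite expn_gt0.
case: (D.+1 ^ n)%N => // k _; rewrite [(D.+1).-1]/= [(k.+1).-1]/=.
have -> : ((D.+1 * k.+1).-1 = D * k.+1 + k)%N by rewrite mulSn addSn /= addnC.
by rewrite -addn1 -[k.+1]addn1; ring.
Qed.

Lemma hres_hiter D w n : is_form2 D w -> exists s,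
  hres (D ^ n) (hiter D w n).1 (hiter D w n).2 = (-1) ^+ s * hres D w.1 w.2 ^+ res_expo D n.
Proof.
move=> hw; elim: n => [|n [s IH]].
  exists 1%N; rewrite expn0 hres_res /res /rowdet det2 !mxE /sylrow /= !coefXnM !coefX !coefC /=.
  by ring.
rewrite hiterS /hcomp2 /= expnS; case/andP: (hw) => h1 h2; case/andP: (is_form_hiter n hw) => h3 h4.
rewrite hres_hcomp // IH exprMn -!exprM.
exists (D ^ n * (D * D) + s * (D * D))%N; rewrite !exprD [(D * D * _)%N]mulnC.
by rewrite !mulrA; congr (_ * _); rewrite mulrAC.
Qed.

End ResultantOfLifts.

(** * Invariants of binary forms *)

Section InfiniteField.
Variable F : fieldType.
Hypothesis hF : root_closed F.

Lemma root_closed_fresh (s : seq F) : exists x, x \notin s.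
Proof.
case: s => [|a s]; first by exists 0.
have hs : size (\prod_(b <- a :: s) ('X - b%:P) + 1) = (size s).+2.
  by rewrite size_polyDl size_prod_XsubC // size_poly1.
have [x hx] : exists x, root (\prod_(b <- a :: s) ('X - b%:P) + 1) x.
  by apply: hF; rewrite hs.
exists x; rewrite -root_prod_XsubC; apply/negP => /eqP h.
by move: hx; rewrite /root hornerD h hornerC add0r oner_eq0.
Qed.

Lemma root_closed_uniq n : exists s : seq F, uniq s /\ size s = n.
Proof.
elim: n => [|n [s [us hs]]]; first by exists [::].
by have [x hx] := root_closed_fresh s; exists (x :: s); rewrite /= hx us hs.
Qed.

Lemma poly_fun_eq0 (p : {poly F}) (s : seq F) :
  (forall x, x \notin s -> p.[x] = 0) -> p = 0.
Proof.
move=> hp; have [t [ut ht]] := root_closed_uniq (size p + size s).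
apply: (@roots_geq_poly_eq0 _ _ [seq x <- t | x \notin s]).
- by apply/allP => x; rewrite mem_filter => /andP[hx _]; apply/eqP/hp.
- exact: filter_uniq.
have e1 : (size [seq x <- t | x \in s] + size [seq x <- t | x \notin s] = size p + size s)%N.
  by rewrite !size_filter -ht; apply: count_predC.
have : (size [seq x <- t | x \in s] <= size s)%N.
  apply: uniq_leq_size; first exact: filter_uniq.
  by move=> x; rewrite mem_filter => /andP[].
by move=> h1; rewrite -(leq_add2r (size s)) -e1 addnC leq_add2l.
Qed.

Lemma coef_interpolation n : exists (x : 'I_n -> F) (lam : 'I_n -> 'I_n -> F),
  forall (Q : {poly F}) (k : 'I_n),
    (size Q <= n)%N -> Q`_k = \sum_(t < n) lam k t * Q.[x t].
Proof.
have [s [us hs]] := root_closed_uniq n.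
pose a : 'rV[F]_n := \row_t s`_t; pose V := Vandermonde n a.
have hV : V \in unitmx.
  rewrite unitmxE unitfE det_Vandermonde; apply/prodf_neq0 => i _.
  apply/prodf_neq0 => j hij; rewrite !mxE subr_eq0 nth_uniq ?hs //.
  by rewrite gtn_eqF.
exists (fun t => s`_t), (fun k t => invmx V t k) => Q k hQ.
pose q : 'rV[F]_n := \row_t Q`_t.
have <- : q ord0 k = Q`_k by rewrite mxE.
rewrite -[q](mulmxK hV) mxE; apply: eq_bigr => t _.
rewrite mulrC; congr (_ * _); rewrite mxE (horner_coef_wide _ hQ).
by apply: eq_bigr => i _; rewrite !mxE.
Qed.

End InfiniteField.

Lemma digit_inj B n (a b : 'I_n -> nat) :
  (forall i, (a i < B)%N) -> (forall i, (b i < B)%N) ->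
  (\sum_i a i * B ^ i = \sum_i b i * B ^ i)%N -> a =1 b.
Proof.
elim: n a b => [|n IH] a b ha hb; first by move=> _ [].
have expand c : (\sum_(i < n.+1) c i * B ^ i =
    (\sum_(i < n) c (lift ord0 i) * B ^ i) * B + c ord0)%N.
  rewrite big_ord_recl muln1 addnC; congr (_ + _)%N; rewrite big_distrl /=.
  by apply: eq_bigr => i _; rewrite -mulnA -expnSr.
rewrite !expand => e i.
have e0 : a ord0 = b ord0.
  by have /(congr1 (modn^~ B)) := e; rewrite !modnMDl !modn_small.
have eS : a \o lift ord0 =1 b \o lift ord0.
  apply: IH => [j|j|]; [exact: ha|exact: hb|].
  apply/eqP; rewrite -(eqn_pmul2r (leq_ltn_trans (leq0n _) (ha ord0))).
  by apply/eqP; move: e; rewrite e0 => /addIn.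
by case: (unliftP ord0 i) => [j ->|->]; [exact: eS|].
Qed.

(** * Symmetric multihomogeneous functions of points *)

Section MultiHomogeneous.
Variable F : fieldType.
Hypothesis hF : root_closed F.
Variable N : nat.
Implicit Types (l : 'I_N -> F * F) (r : nat).

Definition monom r (e : {ffun 'I_N -> nat}) l : F :=
  \prod_i ((l i).1 ^+ e i * (l i).2 ^+ (r - e i)).

Definition multihom r (I : ('I_N -> F * F) -> F) :=
  exists s : seq (F * {ffun 'I_N -> nat}),
    (forall t, t \in s -> forall i, (t.2 i <= r)%N) /\
    forall l, I l = \sum_(t <- s) t.1 * monom r t.2 l.

Lemma eq_multihom r I J : I =1 J -> multihom r I -> multihom r J.
Proof. by move=> e [s [h1 h2]]; exists s; split=> // l; rewrite -e. Qed.

Lemma multihom0 r : multihom r (fun=> 0).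
Proof. by exists [::]; split => // l; rewrite big_nil. Qed.

Lemma multihom1 : multihom 0 (fun=> 1).
Proof.
exists [:: (1, [ffun=> 0%N])]; split=> [t|l]; first by rewrite inE => /eqP-> i; rewrite ffunE.
by rewrite big_seq1 mul1r /monom big1 // => i _; rewrite ffunE !expr0 mulr1.
Qed.

Lemma multihomD r I J : multihom r I -> multihom r J -> multihom r (fun l => I l + J l).
Proof.
move=> [s [h1 h2]] [t [h3 h4]]; exists (s ++ t); split => [u|l].
  by rewrite mem_cat => /orP[/h1|/h3].
by rewrite big_cat h2 h4.
Qed.

Lemma multihomM r r' I J : multihom r I -> multihom r' J ->
  multihom (r + r') (fun l => I l * J l).
Proof.
move=> [s [h1 h2]] [t [h3 h4]].
pose mul (u v : F * {ffun 'I_N -> nat}) := (u.1 * v.1, [ffun i => (u.2 i + v.2 i)%N]).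
exists [seq mul u v | u <- s, v <- t]; split.
  move=> w /allpairsP[[u v] /= [hu hv ->]] i; rewrite ffunE leq_add ?h1 ?h3 //.
move=> l; rewrite big_allpairs_dep h2 h4 mulr_suml big_seq [RHS]big_seq; apply: eq_bigr => u hu.
rewrite mulr_sumr big_seq [RHS]big_seq; apply: eq_bigr => v hv /=.
rewrite mulrACA; congr (_ * _); rewrite -big_split; apply: eq_bigr => i _ /=.
rewrite ffunE mulrACA -!exprD; congr (_ * _ ^+ _).
by move: (u.2 i) (v.2 i) (h1 _ hu i) (h3 _ hv i) => a b; lia.
Qed.

Lemma multihom_array r I : multihom r I ->
  exists c : {ffun 'I_N -> 'I_r.+1} -> F,
    forall l, I l = \sum_e c e * monom r [ffun i => e i : nat] l.
Proof.
move=> [s [h1 h2]].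
exists (fun e : {ffun 'I_N -> 'I_r.+1} => \sum_(t <- s | t.2 == [ffun i => e i : nat]) t.1) => l.
rewrite h2; under [RHS]eq_bigr => e _ do rewrite mulr_suml.
rewrite (exchange_big_dep xpredT) //= big_seq [RHS]big_seq; apply: eq_bigr => t ht.
rewrite (big_pred1 [ffun i => inord (t.2 i)]) => [|e].
  congr (_ * monom _ _ _); apply/ffunP => i; rewrite !ffunE inordK // ltnS.
  exact: h1.
apply/eqP/eqP => [->|->]; apply/ffunP => i; rewrite !ffunE ?inord_val ?inordK //.
by rewrite ltnS h1.
Qed.

Lemma array_uniq r (c : {ffun 'I_N -> 'I_r.+1} -> F) :
  (forall l, \sum_e c e * monom r [ffun i => e i : nat] l = 0) -> forall e, c e = 0.
Proof.
move=> hc e0.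
(* Kronecker substitution: at the points (x^(B^i), 1) with B = r + 1 distinct exponent arrays give
   distinct powers of x, by uniqueness of digits in base B. *)
pose key (e : {ffun 'I_N -> 'I_r.+1}) := (\sum_i e i * r.+1 ^ i)%N.
have key_inj : injective key.
  move=> e e' he; apply/ffunP => i; apply: val_inj.
  by apply: (digit_inj (a := fun i => e i) (b := fun i => e' i) _ _ he).
pose Q := \sum_e c e *: 'X^(key e).
have Q0 : Q = 0.
  apply: (@poly_fun_eq0 _ hF _ [::]) => x _.
  rewrite -[RHS](hc (fun i => (x ^+ (r.+1 ^ i), 1))) horner_sum.
  apply: eq_bigr => e _; rewrite hornerZ hornerXn; congr (_ * _).
  rewrite -prodrXr; apply: eq_bigr => i _.
  by rewrite ffunE /= expr1n mulr1 -exprM mulnC.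
have := congr1 (fun p : {poly F} => p`_(key e0)) Q0; rewrite coef0 coef_sum.
rewrite (bigD1 e0) //= coefZ coefXn eqxx mulr1 big1 ?addr0 // => e he.
by rewrite coefZ coefXn (inj_eq key_inj) eq_sym (negbTE he) mulr0.
Qed.

Lemma array_sym r (c : {ffun 'I_N -> 'I_r.+1} -> F) (s : 'S_N) :
  (forall l, \sum_e c e * monom r [ffun i => e i : nat] (l \o s) =
             \sum_e c e * monom r [ffun i => e i : nat] l) ->
  forall e : {ffun 'I_N -> 'I_r.+1}, c [ffun i => e (s i)] = c e.
Proof.
move=> hc e; apply/eqP; rewrite -subr_eq0; apply/eqP; move: e.
apply: (@array_uniq r (fun e : {ffun 'I_N -> 'I_r.+1} => c [ffun i => e (s i)] - c e)) => l.
under eq_bigr => e _ do rewrite mulrBl.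
rewrite sumrB; apply/eqP; rewrite subr_eq0; apply/eqP.
rewrite -hc [RHS](reindex_inj (h := fun e : {ffun 'I_N -> 'I_r.+1} => [ffun i => e (s i)])) /=; last first.
  move=> e e' /ffunP h; apply/ffunP => i; have := h (s^-1%g i).
  by rewrite !ffunE permKV.
apply: eq_bigr => e _; congr (_ * _); rewrite /monom (reindex_inj (@perm_inj _ s)) /=.
by apply: eq_bigr => i _; rewrite !ffunE.
Qed.

(** The digits of the sum in base [N.+1] count how often each exponent occurs; no count exceeds [N],
    so the sum determines the multiset of exponents. *)
Lemma pow_sum_perm r (e e' : {ffun 'I_N -> 'I_r.+1}) :
  (\sum_i N.+1 ^ e i = \sum_i N.+1 ^ e' i)%N ->
  exists s : 'S_N, e' = [ffun i => e (s i)].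
Proof.
pose cnt (f : {ffun 'I_N -> 'I_r.+1}) (v : 'I_r.+1) := #|[pred i | f i == v]|.
have sumE (f : {ffun 'I_N -> 'I_r.+1}) : (\sum_i N.+1 ^ f i = \sum_v cnt f v * N.+1 ^ v)%N.
  rewrite (partition_big f xpredT) //=; apply: eq_bigr => v _.
  by rewrite (eq_bigr (fun=> N.+1 ^ v)%N) ?sum_nat_const // => i /eqP->.
have bnd f v : (cnt f v < N.+1)%N by rewrite ltnS -[X in (_ <= X)%N]card_ord max_card.
rewrite !sumE => /(digit_inj (bnd e) (bnd e')) hcnt.
have cntE (f : {ffun 'I_N -> 'I_r.+1}) v : count_mem v [tuple f i | i < N] = cnt f v.
  by rewrite -sum1_count /= big_map big_enum_cond sum1_card.
have : perm_eq [tuple e' i | i < N] [tuple e i | i < N].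
  by apply/allP => v _ /=; rewrite !cntE hcnt.
case/tuple_permP => s hs; exists s; apply/ffunP => i.
by have := congr1 (fun t => tnth t i) (val_inj hs); rewrite !tnth_mktuple ffunE.
Qed.

(* A symmetric multihomogeneous function is a combination of the coefficients in T of
   [prod_i g_T(l_i)] with [g_T = sum_v T^(B^v) X^v Y^(r-v)]; interpolate in T and split each
   [g_t] into linear factors. *)
Lemma symmetric_multihom r I : multihom r I ->
  (forall (s : 'S_N) l, I (l \o s) = I l) ->
  exists n (mu : 'I_n -> F) (u : 'I_n -> seq (F * F)),
    (forall t, size (u t) = r) /\
    forall l, I l = \sum_t mu t * \prod_(v <- u t) \prod_i br (l i) v.
Proof.
move=> /multihom_array[c hI] hsym.
have hc (s : 'S_N) (e : {ffun 'I_N -> 'I_r.+1}) : c [ffun i => e (s i)] = c e.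
  by apply: array_sym => l; rewrite -!hI.
pose key (e : {ffun 'I_N -> 'I_r.+1}) := (\sum_i N.+1 ^ e i)%N.
pose n := (N * N.+1 ^ r).+1.
have key_lt e : (key e < n)%N.
  rewrite ltnS -[X in (_ <= X * _)%N]card_ord -sum_nat_const leq_sum // => i _.
  by rewrite leq_pexp2l // -ltnS.
(* By [pow_sum_perm] two arrays with the same key differ by a permutation, on which [c] is constant,
   so the representative picked is immaterial. *)
pose d k := if [pick e | key e == k] is Some e then c e else 0.
have dE e : d (key e) = c e.
  rewrite /d; case: pickP => [e' /eqP he|/(_ e)]; last by rewrite eqxx.
  by have [s ->] := pow_sum_perm he; rewrite hc.
pose g x : {poly F} := \poly_(v < r.+1) x ^+ (N.+1 ^ v).
pose Q l : {poly F} := \sum_(e : {ffun 'I_N -> 'I_r.+1}) monom r [ffun i => e i : nat] l *: 'X^(key e).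
have QE l x : (Q l).[x] = \prod_i heval r (g x) (l i).1 (l i).2.
  rewrite /heval bigA_distr_bigA horner_sum; apply: eq_bigr => e _ /=.
  rewrite hornerZ hornerXn mulrC -prodrXr -big_split; apply: eq_bigr => i _ /=.
  by rewrite coef_poly ltn_ord !ffunE mulrA.
have sQ l : (size (Q l) <= n)%N.
  rewrite (leq_trans (size_sum _ _ _)) //; apply/bigmax_leqP => e _.
  by rewrite (leq_trans (size_scale_leq _ _)) // size_polyXn key_lt.
have IE l : I l = \sum_(k < n) d k * (Q l)`_k.
  under eq_bigr => k _ do rewrite coef_sum mulr_sumr.
  rewrite exchange_big hI; apply: eq_bigr => e _ /=.
  rewrite (bigD1 (Ordinal (key_lt e))) //= coefZ coefXn eqxx mulr1 dE big1 ?addr0 // => k hk.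
  by rewrite coefZ coefXn -[(k == key e :> nat)]/(k == Ordinal (key_lt e)) (negbTE hk) !mulr0.
have gform x : is_form r (g x) by rewrite /is_form size_poly.
have split_g x : exists cL : F * seq (F * F), size cL.2 = r /\ g x = cL.1 *: linprod cL.2.
  by have [a [L [h1 h2 _]]] := form_split hF (gform x); exists (a, L).
have evg x (cL : F * seq (F * F)) l : size cL.2 = r /\ g x = cL.1 *: linprod cL.2 ->
    (Q l).[x] = ((-1) ^+ r * cL.1) ^+ N * \prod_(v <- cL.2) \prod_i br (l i) v.
  case=> h1 h2; rewrite QE exchange_big -[X in _ ^+ X]card_ord -prodr_const -big_split /=.
  apply: eq_bigr => i _; rewrite h2 hevalZ -h1 heval_linprod [_ ^+ _ * _]mulrC -mulrA.
  congr (_ * _); rewrite -[X in _ ^+ X]sum1_size -prodrXr -big_split /=.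
  by apply: eq_bigr => v _; rewrite expr1 /br; case: (l i) => * /=; ring.
have [x [lam hlam]] := coef_interpolation hF n.
have [cL hcL] := fin_all_exists (fun t => split_g (x t)).
exists n, (fun t => (\sum_(k < n) d k * lam k t) * ((-1) ^+ r * (cL t).1) ^+ N), (fun t => (cL t).2).
split => [t|l]; first by have [] := hcL t.
rewrite IE; under eq_bigr => k _ do rewrite (hlam _ _ (sQ l)) mulr_sumr.
rewrite exchange_big /=; apply: eq_bigr => t _; rewrite -mulrA -(evg _ _ _ (hcL t)).
by rewrite mulr_suml; apply: eq_bigr => k _; rewrite mulrA.
Qed.

End MultiHomogeneous.

(** * Matching the roots of a form into pairs of distinct points *)

Section Matching.
Variable F : fieldType.
Implicit Types (l v : F * F) (L : seq (F * F)).

Lemma br_opp l v : br l v = - br v l. Proof. by rewrite /br; ring. Qed.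

Lemma br_sym0 l v : (br l v == 0) = (br v l == 0).
Proof. by rewrite br_opp oppr_eq0. Qed.

Lemma brr l : br l l = 0. Proof. by rewrite /br mulrC subrr. Qed.

Lemma br_trans0 v l l' : v != 0 -> br l v = 0 -> br v l' = 0 -> br l l' = 0.
Proof.
move=> v0 /eqP; rewrite subr_eq0 => /eqP h1 h2.
have e1 : v.1 * br l l' = l.1 * br v l'.
  by rewrite /br !mulrBr ![v.1 * _]mulrA [v.1 * l.2]mulrC h1; ring.
have e2 : v.2 * br l l' = l.2 * br v l'.
  by rewrite /br !mulrBr ![v.2 * (l.1 * _)]mulrA [v.2 * l.1]mulrC -h1; ring.
move: e1 e2; rewrite h2 !mulr0 => /eqP e1 /eqP e2; apply/eqP; move: e1 e2.
rewrite !mulf_eq0; case: (br l l' == 0); rewrite ?orbF // => /eqP e1 /eqP e2.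
by case/eqP: v0; rewrite (surjective_pairing v) e1 e2.
Qed.

Lemma exists_max_seq (T : eqType) (s : seq T) (f : T -> nat) : s != [::] ->
  exists2 x, x \in s & forall y, y \in s -> (f y <= f x)%N.
Proof.
elim: s => // a [|b s] IH _.
  by exists a; rewrite ?mem_head // => y; rewrite inE => /eqP->.
have [x hx hmax] := IH isT; have [h|h] := leqP (f a) (f x).
  by exists x => [|y]; rewrite in_cons ?hx ?orbT // => /orP[/eqP->|/hmax].
exists a; rewrite ?mem_head // => y; rewrite in_cons => /orP[/eqP->|/hmax] //.
by move=> /leq_trans; apply; apply: ltnW.
Qed.

Lemma count_disjoint3 (T : eqType) (a b c : pred T) (s : seq T) :
  (forall x, x \in s -> (a x + b x + c x <= 1)%N) ->
  (count a s + count b s + count c s <= size s)%N.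
Proof.
elim: s => // x s IH h /=.
have h1 := h x (mem_head _ _); have := IH (fun y hy => h y (@mem_behead _ (x :: s) y hy)).
by move: h1; case: (a x); case: (b x); case: (c x) => //=; lia.
Qed.

(* Greedy choice: pair a most frequent direction with a most frequent remaining one. *)
Lemma matching_exists m L : size L = (m + m)%N -> all (fun l => l != 0%R) L ->
  (forall v, v != 0 -> (count (fun l => br l v == 0%R) L <= m)%N) ->
  exists P : seq ((F * F) * (F * F)),
    [/\ size P = m, all (fun p => br p.1 p.2 != 0%R) P & perm_eq (unzip1 P ++ unzip2 P) L].
Proof.
elim: m L => [|m IH] L hL hall hc.
  by exists [::]; split => //=; rewrite (size0nil hL).
pose c v := count (fun l => br l v == 0%R) L.
have L0 : L != [::] by rewrite -size_eq0 hL.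
have [x hx xmax] := exists_max_seq c L0.
have x0 := allP hall x hx.
pose L2 := [seq y <- L | br y x != 0].
have L20 : L2 != [::].
  rewrite -size_eq0 size_filter -lt0n.
  have -> : count (fun y => br y x != 0%R) L = (size L - c x)%N.
    by rewrite -(count_predC (fun l => br l x == 0%R) L) addKn.
  by rewrite subn_gt0 hL (leq_ltn_trans (hc x x0)) // addSn ltnS addnS ltnS leq_addr.
have [y hy ymax] := exists_max_seq c L20.
move: hy; rewrite mem_filter => /andP[hyx hy]; have y0 := allP hall y hy.
have yx : y != x by apply: contra hyx => /eqP ->; rewrite brr.
pose L' := rem y (rem x L).
have pL : perm_eq L (x :: y :: L').
  rewrite (perm_trans (perm_to_rem hx)) // perm_cons perm_to_rem //.
  by have := perm_mem (perm_to_rem hx) y; rewrite hy inE (negbTE yx).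
have cE v : c v = ((br x v == 0%R) + ((br y v == 0%R) + count (fun l => br l v == 0%R) L'))%N.
  by rewrite /c (seq.permP pL).
have [|||P [hP1 hP2 hP3]] := IH L'.
- by have := perm_size pL; rewrite hL /=; lia.
- by move: hall; rewrite (perm_all _ pL) /= => /and3P[].
- move=> v v0; have := hc v v0; rewrite -/(c v) cE.
  case: (boolP (br x v == 0%R)) => [_|hxv].
    by rewrite add1n ltnS; apply: leq_trans; rewrite leq_addl.
  case: (boolP (br y v == 0%R)) => [_|hyv]; first by rewrite add0n add1n ltnS.
  (* Otherwise the direction of [v], distinct from those of [x] and [y], occurs more than [m] times.
     By the two maximal choices the directions of [x] and [y] occur at least as often, and three
     disjoint classes of more than [m] elements do not fit into a list of length m.+1 + m.+1. *)
  rewrite !add0n => _; rewrite leqNgt; apply/negP => hgt.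
  have /hasP[w hw hwv] : has (fun l => br l v == 0%R) L' by rewrite has_count (leq_ltn_trans _ hgt).
  have wL : w \in L by rewrite (perm_mem pL) !inE hw !orbT.
  have w0 := allP hall w wL.
  have cw : c w = c v.
    apply: eq_in_count => l hl; apply/eqP/eqP => h.
      exact: (br_trans0 w0 h (eqP hwv)).
    by apply: (br_trans0 v0 h); apply/eqP; rewrite br_sym0.
  have cwx := xmax w wL; have cwy : (c w <= c y)%N.
    apply: ymax; rewrite mem_filter wL andbT; apply: contra hxv => /eqP h; apply/eqP.
    by apply: (br_trans0 w0 _ (eqP hwv)); apply/eqP; rewrite br_sym0 h.
  have cv : (m < c v)%N by rewrite cE (negbTE hxv) (negbTE hyv).
  have := @count_disjoint3 _ (fun l => br l x == 0%R) (fun l => br l y == 0%R) (fun l => br l v == 0%R) L.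
  rewrite -/(c x) -/(c y) -/(c v) hL.
  suff h : forall l, l \in L -> ((br l x == 0%R) + (br l y == 0%R) + (br l v == 0%R) <= 1)%N.
    move=> /(_ h); rewrite leqNgt => /negP; apply; rewrite cw in cwx cwy.
    rewrite (leq_trans _ (leq_add (leq_add (leq_trans cv cwx) (leq_trans cv cwy)) cv)) //.
    by rewrite -[X in (X < _)%N]addn0 ltn_add2l.
  move=> l hl; have l0 := allP hall l hl.
  have ab a b : br a b != 0 -> (br l a == 0%R) && (br l b == 0%R) = false.
    move=> hab; apply/negP => /andP[/eqP h1 /eqP h2]; case/eqP: hab.
    by apply: (br_trans0 l0 _ h2); apply/eqP; rewrite br_sym0 h1.
  move: (ab _ _ hyx) (ab _ _ hxv) (ab _ _ hyv).
  by case: (br l x == 0%R); case: (br l y == 0%R); case: (br l v == 0%R).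
exists ((x, y) :: P); split => /=; first by rewrite hP1.
  by rewrite br_sym0 hyx hP2.
rewrite perm_sym (perm_trans pL) // perm_cons perm_sym.
by rewrite -cat1s perm_catCA /= perm_cons.
Qed.

End Matching.

(** * Invariants from symmetrized bracket products *)

Section BinaryFormInvariants.
Variable F : fieldType.
Hypothesis hF : root_closed F.
Variable m : nat.
Implicit Types (l : 'I_(m + m) -> F * F) (s : 'S_(m + m)) (M : 'M[F]_2).

Definition brmatch s l : F :=
  \prod_(i < m) br (l (s (lshift m i))) (l (s (rshift m i))).

Lemma multihom_brmatch s : multihom 1 (brmatch s).
Proof.
pose e (f : {ffun 'I_m -> bool}) : {ffun 'I_(m + m) -> nat} :=
  [ffun k => match fintype.split (s^-1%g k) with inl i => ~~ f i : nat | inr i => f i : nat end].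
pose c (f : {ffun 'I_m -> bool}) : F := \prod_i (if f i then 1 else -1).
exists [seq (c f, e f) | f <- index_enum {ffun 'I_m -> bool}]; split.
  by move=> t /mapP[f _ ->] i /=; rewrite ffunE; case: fintype.split => j; case: (f j).
move=> l; rewrite big_map.
pose H i (b : bool) := if b then (l (s (lshift m i))).2 * (l (s (rshift m i))).1
   else - ((l (s (lshift m i))).1 * (l (s (rshift m i))).2).
rewrite /brmatch (eq_bigr (fun i => \sum_b H i b)) => [|i _]; last by rewrite big_bool.
rewrite bigA_distr_bigA; apply: eq_bigr => f _ /=.
rewrite /monom (reindex_inj (@perm_inj _ s)) /= big_split_ord /= -big_split -big_split /=.
apply: eq_bigr => i _; rewrite !ffunE !permK /H.
rewrite -[lshift m i]/(unsplit (inl i)) -[rshift m i]/(unsplit (inr i)) !unsplitK.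
by case: (f i); rewrite /= ?expr0 ?expr1 ?subnn ?subn0 ?expr0 ?expr1 ?mulr1 ?mul1r ?mulN1r.
Qed.

(** The coefficients are the elementary symmetric functions of the bracket products over all
    permutations. The plain sum over permutations may cancel, whereas these cannot all vanish in
    positive degree once a single product is nonzero, whatever the characteristic. *)
Definition brgen l : {poly F} := \prod_s (1 + brmatch s l *: 'X).

Lemma multihom_brgen j : multihom j (fun l => (brgen l)`_j).
Proof.
rewrite /brgen; move: j; elim: (index_enum _) => [|s r IH] j.
  case: j => [|j].
    by apply: eq_multihom (multihom1 F _) => l; rewrite big_nil coefC.
  by apply: eq_multihom (multihom0 F _ _) => l; rewrite big_nil coefC.
case: j => [|j].
  apply: eq_multihom (IH 0%N) => l.
  by rewrite big_cons mulrDl mul1r coefD -scalerAl coefZ coefXM mulr0 addr0.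
have := multihomD (IH j.+1) (multihomM (multihom_brmatch s) (IH j)).
by apply: eq_multihom => l; rewrite big_cons mulrDl mul1r coefD -scalerAl coefZ coefXM.
Qed.

Lemma brgen_sym s l : brgen (l \o s) = brgen l.
Proof.
rewrite /brgen [RHS](reindex_inj (@mulIg _ s)) /=; apply: eq_bigr => t _.
by congr (1 + _ *: _); apply: eq_bigr => i _; rewrite /= !permM.
Qed.

(** The adjugate of [M] applied to [l]: substituting [M] into a form moves its root [l] to
    [act M l]. *)
Definition act M (l : F * F) : F * F :=
  (l.1 * M ord_max ord_max - l.2 * M ord0 ord_max, l.2 * M ord0 ord0 - l.1 * M ord_max ord0).

Lemma br_act M (l l' : F * F) : br (act M l) (act M l') = \det M * br l l'.
Proof. by rewrite /br /act /= det2; ring. Qed.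

Lemma linprod_act M (L : seq (F * F)) :
  hcomp (size L) (linprod L) (mxnum M) (mxden M) = linprod (map (act M) L).
Proof.
rewrite hcomp_linprod /linprod big_map; apply: eq_bigr => l _.
by rewrite /lin /act /mxnum /mxden /= -!mul_polyC !polyCN !polyCB !polyCM; ring.
Qed.

Lemma brgen_act M l : \det M = 1 -> brgen (act M \o l) = brgen l.
Proof.
move=> hM; apply: eq_bigr => s _; congr (1 + _ *: _).
by apply: eq_bigr => i _; rewrite /= br_act hM mul1r.
Qed.

(** Roots are not polynomial in the coefficients, values are: by [symmetric_multihom] an invariant
    given through the roots takes this shape, which is visibly polynomial in the coefficients of
    [f]. *)
Definition evalcomb D n (mu : 'I_n -> F) (u : 'I_n -> seq (F * F)) (f : {poly F}) : F :=
  \sum_t mu t * \prod_(v <- u t) heval D f v.1 v.2.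

Lemma binary_form_invariant (L : seq (F * F)) : (0 < m)%N -> size L = (m + m)%N ->
  (forall i, (i < m)%N -> br (nth 0 L i) (nth 0 L (m + i)) != 0) ->
  exists r n (mu : 'I_n -> F) (u : 'I_n -> seq (F * F)),
  [/\ (0 < r)%N, forall t, size (u t) = r,
      forall c, c != 0 -> evalcomb (m + m) mu u (c *: linprod L) != 0 &
      forall M f, \det M = 1 -> is_form (m + m) f ->
        evalcomb (m + m) mu u (hcomp (m + m) f (mxnum M) (mxden M)) = evalcomb (m + m) mu u f].
Proof.
move=> hm hL hbr; pose fL (L : seq (F * F)) : 'I_(m + m) -> F * F := fun i => nth 0 L i.
have h1 : brmatch 1%g (fL L) != 0.
  by apply/prodf_neq0 => i _; rewrite !perm1 /fL /= hbr.
(* The polynomial [brgen] is 1 at 0 and vanishes at the root of the factor belonging to the nonzero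
   bracket product, so it is not constant. *)
have [j hj hjL] : exists2 j, (0 < j)%N & (brgen (fL L))`_j != 0.
  have [h|h] := leqP (size (brgen (fL L))) 1; last first.
    exists (size (brgen (fL L))).-1; first by lia.
    by rewrite -/(lead_coef _) lead_coef_eq0 -size_poly_gt0 (ltn_trans _ h).
  have hroot : (brgen (fL L)).[- (brmatch 1%g (fL L))^-1] = 0.
    rewrite /brgen horner_prod (bigD1 1%g) //= !hornerE mulrN mulfV ?subrr ?mul0r //.
  have h0 : (brgen (fL L)).[0] = 1.
    by rewrite horner_prod big1 // => s _; rewrite !hornerE.
  by move: hroot h0; rewrite (size1_polyC h) !hornerC => -> /eqP; rewrite eq_sym oner_eq0.
have [n [mu [u [hu hI]]]] := symmetric_multihom hF (multihom_brgen j)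
  (fun s l => congr1 (fun p : {poly F} => p`_j) (brgen_sym s l)).
have prodfL (L' : seq (F * F)) v : size L' = (m + m)%N ->
    \prod_i br (fL L' i) v = \prod_(l <- L') br l v.
  by move=> hL'; rewrite [RHS](big_nth 0) hL' big_mkord.
have evE c L' : size L' = (m + m)%N ->
    evalcomb (m + m) mu u (c *: linprod L') = c ^+ j * (brgen (fL L'))`_j.
  move=> hL'; rewrite hI mulr_sumr; apply: eq_bigr => t _; rewrite mulrCA; congr (_ * _).
  rewrite -(hu t) -[X in _ ^+ X]sum1_size -prodrXr -big_split; apply: eq_bigr => v _ /=.
  by rewrite expr1 hevalZ prodfL // -{1}hL' heval_linprod; case: v.
exists j, n, mu, u; split => // [c c0|M f hM hf].
  by rewrite evE // mulf_neq0 // expf_neq0.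
have [c [L' [hL' -> _]]] := form_split hF hf.
rewrite hcompZ; have -> : hcomp (m + m) (linprod L') (mxnum M) (mxden M) = linprod (map (act M) L').
  by rewrite -hL' linprod_act.
rewrite !evE ?size_map // -(brgen_act (fL L') hM); congr (_ * (_ : {poly F})`_j).
apply: eq_bigr => s _; congr (1 + _ *: _).
by apply: eq_bigr => i _; rewrite /fL /= !(nth_map 0) ?hL'.
Qed.

End BinaryFormInvariants.

(** * Semistability *)

Section Covariants.
Variable F : fieldType.
Implicit Types (f g p q : {poly F}) (w : {poly F} * {poly F}) (M : 'M[F]_2) (D : nat).

(* Strictly positive weights under z |-> t z; all invariants vanish there. *)
Definition unstable D w : Prop :=
  (forall i, (i.*2 <= D.+1)%N -> w.1`_i = 0) /\ (forall i, (i.*2 < D)%N -> w.2`_i = 0).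

Definition fixform w : {poly F} := 'X * w.2 - w.1.

(** The form of critical points. The Jacobian of a pair of degree-D forms is D times it at Y = 1 and
    so is lost when the characteristic divides D; the Wronskian keeps the covariance without this
    factor. *)
Definition wronskian f g : {poly F} := f^`() * g - f * g^`().

Lemma is_form_fixform D w : is_form2 D w -> is_form D.+1 (fixform w).
Proof.
case/andP=> h1 h2; rewrite is_formD ?is_formN //; last exact: leqW.
by rewrite -add1n is_formM // /is_form size_polyX.
Qed.

Lemma fixform_hconj D M w : is_form2 D w ->
  fixform (hconj D M w) = hcomp D.+1 (fixform w) (mxnum M) (mxden M).
Proof.
case/andP=> h1 h2; rewrite /fixform hcompD hcompN -{1}[w.1]mul1r -add1n.
rewrite !hcompM ?/is_form ?size_polyX ?size_poly1 //.
have -> : hcomp 1 'X (mxnum M) (mxden M) = mxnum M.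
  by have := hcomp_linear (mxnum M) (mxden M) 1 0; rewrite !scale1r addr0 scale0r addr0.
have -> : hcomp 1 1 (mxnum M) (mxden M) = mxden M.
  by have := hcomp_linear (mxnum M) (mxden M) 0 1; rewrite scale0r add0r scale0r add0r scale1r.
by rewrite hconjE /= /mxnum /mxden -!mul_polyC; ring.
Qed.

Lemma hcompMn D f n p q : hcomp D (f *+ n) p q = hcomp D f p q *+ n.
Proof. by rewrite -scaler_nat hcompZ scaler_nat. Qed.

(** The chain rule for forms. By Euler's relation the form substituted in the second summand is the
    partial derivative of [f] in Y. *)
Lemma deriv_hcomp D f p q : is_form D.+1 f ->
  (hcomp D.+1 f p q)^`() = hcomp D f^`() p q * p^`() + hcomp D (f *+ D.+1 - 'X * f^`()) p q * q^`().
Proof.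
move=> hf; have e1 : f^`() = \sum_(i < D.+2) f`_i *: ('X^(i.-1) *+ i).
  rewrite {1}(form_sum hf) raddf_sum; apply: eq_bigr => i _ /=.
  by rewrite linearZ /= derivXn.
have e2 : f *+ D.+1 - 'X * f^`() = \sum_(i < D.+2) f`_i *: ('X^i *+ (D.+1 - i)).
  rewrite e1 [in X in X *+ _](form_sum hf) mulr_sumr -sumrMnl -sumrB; apply: eq_bigr => i _.
  rewrite -scalerAr scalerMnr -scalerBr mulrnBr -1?ltnS //; congr (_ *: (_ - _)).
  by rewrite mulrnAr -exprS; case: (nat_of_ord i) => // j; rewrite !mulr0n.
rewrite e2 e1 [in LHS](form_sum hf) !hcomp_sum [LHS]raddf_sum /= !mulr_suml -big_split.
apply: eq_bigr => i _ /=; rewrite !hcompZ linearZ /= -!scalerAl -scalerDr.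
congr (_ *: _); have hi : (i <= D.+1)%N by rewrite -ltnS.
rewrite hcompXn //.
rewrite derivM !deriv_exp !hcompMn; congr (_ + _).
  case: (nat_of_ord i) hi => [|j] hj; first by rewrite !mulr0n !mul0r.
  by rewrite hcompXn // subSS /= !mulrnAl -mulrA mulrC.
case: (ltnP D i) => hiD.
  have -> : (D.+1 - i = 0)%N by lia.
  by rewrite !mulr0n mulr0 mul0r.
by rewrite hcompXn // subSn //= mulrnAr mulrnAl mulrCA mulrC.
Qed.

Lemma is_form_deriv D f : is_form D.+1 f -> is_form D f^`().
Proof. by move/formP=> hf; apply/formP => i hi; rewrite coef_deriv hf ?mul0rn. Qed.

Lemma is_form_euler D f : is_form D.+1 f -> is_form D (f *+ D.+1 - 'X * f^`()).
Proof.
move/formP=> hf; apply/formP => i hi; rewrite coefB coefMn coefXM coef_deriv.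
case: i hi => // i; rewrite ltnS leq_eqVlt => /orP[/eqP->|hi] /=; first by rewrite subrr.
by rewrite hf ?mul0rn ?subrr // ltnS.
Qed.

Lemma is_form_wronskian D f g : is_form D.+1 f -> is_form D.+1 g ->
  is_form (D + D) (wronskian f g).
Proof.
move=> hf hg; have hW : is_form (D + D).+1 (wronskian f g).
  rewrite is_formD ?is_formN //; first by rewrite -addnS is_formM ?is_form_deriv.
  by rewrite -addSn is_formM ?is_form_deriv.
apply/formP => i; rewrite leq_eqVlt => /orP[/eqP<-|]; last by move/formP: hW; apply.
(* Expressed through the partial derivatives in Y, X times the Wronskian has formal degree 2D + 1,
   which kills the coefficient of degree 2D + 1 of the Wronskian itself. *)
have e : 'X * wronskian f g = (f *+ D.+1 - 'X * g^`() * 0) * 0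
   + f * (g *+ D.+1 - 'X * g^`()) * (-1) * (-1) - (f *+ D.+1 - 'X * f^`()) * g.
  by rewrite /wronskian -(mulr_natl f) -(mulr_natl g); ring.
have /formP h : is_form (D + D).+1 ('X * wronskian f g).
  rewrite e mulr0 add0r mulrN1 mulrN1 opprK is_formD ?is_formN //.
    by rewrite -addSn is_formM ?is_form_euler.
  by rewrite -addnS is_formM ?is_form_euler.
by have := h (D + D).+2 (leqnn _); rewrite coefXM.
Qed.

Lemma wronskian_hcomp D M f g : is_form D.+1 f -> is_form D.+1 g ->
  wronskian (hcomp D.+1 f (mxnum M) (mxden M)) (hcomp D.+1 g (mxnum M) (mxden M)) =
  \det M *: hcomp (D + D) (wronskian f g) (mxnum M) (mxden M).
Proof.
move=> hf hg; have hW := is_form_wronskian hf hg.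
set p := mxnum M; set q := mxden M.
have hX : hcomp 1 'X p q = p.
  by have := hcomp_linear p q 1 0; rewrite !scale1r addr0 scale0r addr0.
have h1 : hcomp 1 1 p q = q.
  by have := hcomp_linear p q 0 1; rewrite scale0r add0r scale0r add0r scale1r.
have e1 : hcomp D f^`() p q * hcomp D.+1 g p q - hcomp D.+1 f p q * hcomp D g^`() p q =
    q * hcomp (D + D) (wronskian f g) p q.
  have -> : q * hcomp (D + D) (wronskian f g) p q = hcomp (1 + (D + D)) (1 * wronskian f g) p q.
    by rewrite hcompM ?h1 // /is_form size_poly1.
  rewrite mul1r hcompD hcompN.
  by rewrite add1n -{1}addnS hcompM ?is_form_deriv // -addSn hcompM ?is_form_deriv.
have e2 : hcomp D.+1 f p q * hcomp D (g *+ D.+1 - 'X * g^`()) p q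
    - hcomp D (f *+ D.+1 - 'X * f^`()) p q * hcomp D.+1 g p q =
    p * hcomp (D + D) (wronskian f g) p q.
  have -> : p * hcomp (D + D) (wronskian f g) p q = hcomp (1 + (D + D)) ('X * wronskian f g) p q.
    by rewrite hcompM ?hX // /is_form size_polyX.
  have -> : 'X * wronskian f g = f * (g *+ D.+1 - 'X * g^`()) - (f *+ D.+1 - 'X * f^`()) * g.
    by rewrite /wronskian -(mulr_natl f) -(mulr_natl g); ring.
  rewrite [RHS]hcompD hcompN add1n -{1}addSn hcompM ?is_form_euler //.
  by rewrite -addnS hcompM ?is_form_euler.
have dp : p^`() = (M ord0 ord0)%:P by rewrite /p /mxnum !derivE addr0 alg_polyC.
have dq : q^`() = (M ord_max ord0)%:P by rewrite /q /mxden !derivE addr0 alg_polyC.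
rewrite [LHS]/wronskian !deriv_hcomp //.
rewrite [LHS](_ : _ = p^`() * (q * hcomp (D + D) (wronskian f g) p q)
   - q^`() * (p * hcomp (D + D) (wronskian f g) p q)); last by rewrite -e1 -e2; ring.
rewrite dp dq /p /q /mxnum /mxden -!mul_polyC det2 !polyCB !polyCM.
by ring.
Qed.

Lemma wronskian_hconj D M w : is_form2 D.+1 w ->
  wronskian (hconj D.+1 M w).1 (hconj D.+1 M w).2 =
  \det M ^+ 2 *: hcomp (D + D) (wronskian w.1 w.2) (mxnum M) (mxden M).
Proof.
case/andP=> h1 h2; rewrite expr2 -scalerA -wronskian_hcomp // hconjE /=.
rewrite /wronskian !derivE -!mul_polyC det2 !polyCB !polyCM.
by ring.
Qed.

(* With [f = X g - theta] one has [f' g - f g' = g^2 - theta' g + theta g']. *)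
Lemma unstable_of_covariants D w :
  (forall j, (j.*2 <= D.+1)%N -> (fixform w)`_j = 0) ->
  (forall j, (j < D)%N -> (wronskian w.1 w.2)`_j = 0) -> unstable D w.
Proof.
case: w => f g; rewrite /fixform /=; set th := 'X * g - f => hth hW.
have fE : f = 'X * g - th by rewrite /th; ring.
have WE : wronskian f g = g * g - th^`() * g + th * g^`().
  by rewrite /wronskian fE !derivE; ring.
have hg i : (i.*2 < D)%N -> g`_i = 0.
  (* In degree 2i the terms containing theta vanish by hypothesis or by induction, and in the square
     of g only the square of the coefficient [g_i] survives. *)
  elim/ltn_ind: i => i IH hi; have := hW i.*2 hi; rewrite WE coefD coefB !coefM.
  have hgj j : (j < i)%N -> g`_j = 0.
    by move=> hj; apply: IH => //; rewrite (leq_ltn_trans _ hi) // leq_double ltnW.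
  rewrite [X in _ - X]big1 ?subr0 => [|j _]; last first.
    case: (leqP j i) => hj.
      by rewrite coef_deriv hth ?mul0rn ?mul0r // doubleS ltnS (leq_trans _ hi) // ltnS leq_double.
    by rewrite (hgj (i.*2 - j)%N) ?mulr0 //; move: (nat_of_ord j) (ltn_ord j) hj; clear; lia.
  rewrite [X in _ + X]big1 ?addr0 => [|j _]; last first.
    case: (leqP j i.+1) => hj.
      by rewrite hth ?mul0r // (leq_trans (_ : _ <= i.+1.*2)%N) ?leq_double // doubleS ltnS.
    rewrite coef_deriv hgj ?mul0rn ?mulr0 //.
    by move: (nat_of_ord j) (ltn_ord j) hj; clear; lia.
  have hii : (i < i.*2.+1)%N by rewrite ltnS -addnn leq_addr.
  rewrite (bigD1 (Ordinal hii)) //= big1 ?addr0 => [|j hj].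
    by rewrite -addnn addnK => /eqP; rewrite mulf_eq0 orbb => /eqP.
  have /orP[h|h] : (j < i)%N || (i < j)%N by rewrite -neq_ltn.
    by rewrite hgj ?mul0r.
  by rewrite (hgj (i.*2 - j)%N) ?mulr0 //; move: (nat_of_ord j) (ltn_ord j) h; clear; lia.
split=> [i hi|]; last exact: hg.
rewrite fE coefB coefXM hth // subr0; case: i hi => // i hi /=; exact: hg.
Qed.

Lemma coef_linprod_mult (L : seq (F * F)) j :
  (j < count (fun l => l.1 == 0%R) L)%N -> (linprod L)`_j = 0.
Proof.
elim: L j => // l L IH j /=; rewrite /linprod big_cons -/(linprod L) /lin.
rewrite mulrDl -scalerAl mul_polyC coefD !coefZ coefXM.
case: eqP => [->|_].
  rewrite oppr0 mul0r addr0 add1n.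
  by case: j => [|j] /=; rewrite ?mulr0 ?ltnS // => /IH->; rewrite mulr0.
rewrite add0n => hj; have h1 := IH j hj; case: j hj h1 => [|j] hj h1 /=.
  by rewrite h1 !mulr0 addr0.
by rewrite h1 (IH j (ltnW hj)) !mulr0 addr0.
Qed.

(** Such an [M] sends the point 0 = (0 : 1) to [v], so that after substitution a multiplicity at [v]
    shows as vanishing low coefficients. *)
Lemma exists_sl2_col (v : F * F) : v != 0 -> exists M,
  [/\ \det M = 1, M ord0 ord_max = v.1 & M ord_max ord_max = v.2].
Proof.
move=> v0; pose mk (a c : F) : 'M[F]_2 := \matrix_(i, j)
  if j == ord0 then (if i == ord0 then a else c) else (if i == ord0 then v.1 else v.2).
have [h|h] := eqVneq v.2 0.
  have h1 : v.1 != 0 by apply: contra v0 => /eqP h1; rewrite (surjective_pairing v) h h1.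
  exists (mk 0 (- v.1^-1)); rewrite det2 !mxE /=; split => //.
  by rewrite mul0r sub0r mulrN opprK mulfV.
exists (mk v.2^-1 0); rewrite det2 !mxE /=; split => //.
by rewrite mulr0 subr0 mulVf.
Qed.

End Covariants.

Section BalancedExponents.
Variable F : fieldType.
Implicit Types (u v l : F * F) (L : seq (F * F)).

Definition rootmult L v : nat := count (fun l => br l v == 0) L.

Lemma rootmult_par L u v : u != 0 -> v != 0 -> br u v = 0 -> rootmult L u = rootmult L v.
Proof.
move=> u0 v0 huv; apply: eq_count => l; apply/eqP/eqP => h; first exact: br_trans0 h huv.
by apply: br_trans0 h _ => //; rewrite br_opp huv oppr0.
Qed.

Lemma rootmult_disjoint L u v : all (fun l => l != 0) L -> br u v != 0 ->
  (rootmult L u + rootmult L v <= size L)%N.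
Proof.
move=> hall huv; rewrite -[X in (X <= _)%N]addn0 -(count_pred0 L).
apply: count_disjoint3 => l hl; rewrite addn0; have l0 := allP hall l hl.
case: eqP => // h1; case: eqP => // h2; case/eqP: huv.
by apply: (br_trans0 l0 _ h2); rewrite br_opp h1 oppr0.
Qed.

Lemma rootmult_le L n : all (fun l => l != 0) L ->
  all (fun l => (rootmult L l).*2 <= n)%N L ->
  forall v, v != 0 -> ((rootmult L v).*2 <= n)%N.
Proof.
move=> hall h v v0; case: (posnP (rootmult L v)) => [->//|].
rewrite -has_count => /hasP[l hl /eqP hlv].
by rewrite -(rootmult_par L (allP hall l hl) v0 hlv) (allP h).
Qed.

(** Here x, y, z are the multiplicities of the two forms at [c], at [c'] and at the point tested.
    The weights give equality at [c']; since the roots at [c] and [c'] are disjoint, the bound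
    follows at [c]; at any other point both multiplicities are below half the degree. *)
Lemma balance_arith a b x1 x2 y1 y2 z1 z2 n1 n2 :
  (n1 < x1.*2 -> n2 < y2.*2 -> a = y2.*2 - n2 -> b = n1 - y1.*2 ->
   x1 + y1 <= n1 -> x2 + y2 <= n2 ->
   z1 = x1 /\ z2 = x2 \/ z1 = y1 /\ z2 = y2 \/ z1 + x1 <= n1 /\ z2 + y2 <= n2 ->
   (a * z1 + b * z2).*2 <= a * n1 + b * n2)%N.
Proof.
move=> h1 h2 -> -> h3 h4.
have e1 : exists k, y2.*2 = (n2 + k)%N by exists (y2.*2 - n2)%N; lia.
have e2 : exists k, n1 = (y1.*2 + k)%N by exists (n1 - y1.*2)%N; lia.
case: e1 e2 => [a' ea] [b' eb]; rewrite ea eb addKn addKn.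
case=> [[-> ->]|[[-> ->]|[h5 h6]]]; nia.
Qed.

(* If the first form is too singular at [c] and the second one at [c'], then neither is
   at the other point, and weights equalizing the two at [c'] also work at [c]. *)
Lemma balanced_exponents L1 L2 (b1 b2 : bool) :
  (0 < size L1)%N -> (0 < size L2)%N ->
  all (fun l => l != 0) L1 -> all (fun l => l != 0) L2 ->
  (forall v, v != 0 -> b1 && ((rootmult L1 v).*2 <= size L1)%N ||
                       b2 && ((rootmult L2 v).*2 <= size L2)%N) ->
  exists a b, [/\ (0 < a * size L1 + b * size L2)%N, (0 < a)%N -> b1, (0 < b)%N -> b2 &
    forall v, v != 0 ->
      ((a * rootmult L1 v + b * rootmult L2 v).*2 <= a * size L1 + b * size L2)%N].
Proof.
move=> n1 n2 hL1 hL2 H; set G := ex _.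
have left : b1 -> (forall v, v != 0 -> ((rootmult L1 v).*2 <= size L1)%N) -> G.
  by move=> h1 h; exists 1%N, 0%N; split => // [|v v0]; rewrite !mul0n !addn0 !mul1n ?h.
have right : b2 -> (forall v, v != 0 -> ((rootmult L2 v).*2 <= size L2)%N) -> G.
  by move=> h1 h; exists 0%N, 1%N; split => // [|v v0]; rewrite !mul0n !add0n !mul1n ?h.
have one0 : ((1, 0) : F * F) != 0 by rewrite xpair_eqE oner_eq0.
have [h1|/negbTE h1] := boolP b1; last first.
  apply: right => [|v v0]; last by have := H v v0; rewrite h1 /= => /andP[].
  by have := H _ one0; rewrite h1 => /andP[].
have [h2|/negbTE h2] := boolP b2; last first.
  by apply: left => // v v0; have := H v v0; rewrite h2 orbF => /andP[].
case: (boolP (all (fun l => (rootmult L1 l).*2 <= size L1)%N L1)) => [/(rootmult_le hL1)|].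
  exact: left.
case: (boolP (all (fun l => (rootmult L2 l).*2 <= size L2)%N L2)) => [/(rootmult_le hL2)|].
  by move=> h _; apply: right.
rewrite -!has_predC => /hasP[c' hc' /= hcc'] /hasP[c hc /= hcc].
have c0 := allP hL1 c hc; have c'0 := allP hL2 c' hc'.
rewrite -ltnNge in hcc; rewrite -ltnNge in hcc'.
have hb : br c c' != 0.
  apply/negP => /eqP e; have := H c c0.
  rewrite (rootmult_par L2 c0 c'0 e) => /orP[/andP[_]|/andP[_]].
    by rewrite leqNgt hcc.
  by rewrite leqNgt hcc'.
have Hc : ((rootmult L1 c').*2 < size L1)%N.
  by have := rootmult_disjoint hL1 hb; move: hcc; rewrite /=; move: (rootmult _ _) (rootmult _ _) (size _); clear; lia.
exists ((rootmult L2 c').*2 - size L2)%N, (size L1 - (rootmult L1 c').*2)%N; split => //.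
  by rewrite addn_gt0 !muln_gt0 subn_gt0 hcc' n1.
move=> v v0; apply: balance_arith hcc hcc' _ _ (rootmult_disjoint hL1 hb) (rootmult_disjoint hL2 hb) _ => //.
have [e|e] := eqVneq (br v c) 0; first by left; rewrite !(rootmult_par _ v0 c0 e).
have [e'|e'] := eqVneq (br v c') 0; first by right; left; rewrite !(rootmult_par _ v0 c'0 e').
by right; right; split; apply: rootmult_disjoint.
Qed.

End BalancedExponents.

Section HomogeneousFunctions.
Import -(notations) mpoly.
Variables (F : fieldType) (n : nat).
Implicit Types (h : ('I_n -> F) -> F) (d : nat).

(** Invariants are built as functions of the coefficient vector; this predicate supplies the
    homogeneous polynomial that [semistable_pt] asks for. *)
Definition hpoly d h : Prop := exists P : mpoly n F,
  all (fun mn => mdeg mn == d) (msupp P) /\ forall v, meval v P = h v.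

Lemma eq_hpoly d h h' : h =1 h' -> hpoly d h -> hpoly d h'.
Proof. by move=> e [P [hP hv]]; exists P; split=> // v; rewrite hv e. Qed.

Lemma hpoly0 d : hpoly d (fun=> 0).
Proof. by exists 0; split => [|v]; [rewrite msupp0 | rewrite meval0]. Qed.

Lemma hpoly1 : hpoly 0 (fun=> 1).
Proof. by exists 1; split => [|v]; [rewrite msupp1 /= mdeg0 | rewrite meval1]. Qed.

Lemma hpoly_coord i : hpoly 1 (fun v => v i).
Proof.
exists (mpolyX F (mnm1 i)); split => [|v]; last by rewrite mevalXU.
by rewrite msuppX /= mdeg1.
Qed.

Lemma hpolyD d h h' : hpoly d h -> hpoly d h' -> hpoly d (fun v => h v + h' v).
Proof.
move=> [P [hP eP]] [Q [hQ eQ]]; exists (P + Q); split => [|v]; last by rewrite mevalD eP eQ.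
by have := @dhomogD n F mdeg d P Q; rewrite !dhomogE; apply.
Qed.

Lemma hpolyZ d c h : hpoly d h -> hpoly d (fun v => c * h v).
Proof.
move=> [P [hP eP]]; exists (c *: P); split => [|v]; last by rewrite mevalZ eP.
by have := @dhomogZ n F mdeg d c P; rewrite !dhomogE; apply.
Qed.

Lemma hpolyM d d' h h' : hpoly d h -> hpoly d' h' -> hpoly (d + d') (fun v => h v * h' v).
Proof.
move=> [P [hP eP]] [Q [hQ eQ]]; exists (P * Q); split => [|v]; last by rewrite mevalM eP eQ.
by have := @dhomogM n F mdeg d P d' Q; rewrite !dhomogE; apply.
Qed.

Lemma hpoly_sum d (I : Type) (r : seq I) (h : I -> ('I_n -> F) -> F) :
  (forall i, hpoly d (h i)) -> hpoly d (fun v => \sum_(i <- r) h i v).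
Proof.
move=> hh; elim: r => [|i r IH].
  by apply: eq_hpoly (hpoly0 d) => v; rewrite big_nil.
by apply: eq_hpoly (hpolyD (hh i) IH) => v; rewrite big_cons.
Qed.

Lemma hpoly_prod d (I : Type) (r : seq I) (h : I -> ('I_n -> F) -> F) :
  (forall i, hpoly d (h i)) -> hpoly (size r * d) (fun v => \prod_(i <- r) h i v).
Proof.
move=> hh; elim: r => [|i r IH].
  by apply: eq_hpoly hpoly1 => v; rewrite big_nil.
by rewrite mulSn; apply: eq_hpoly (hpolyM (hh i) IH) => v; rewrite big_cons.
Qed.

Lemma hpolyX d k h : hpoly d h -> hpoly (k * d) (fun v => h v ^+ k).
Proof.
move=> hh; elim: k => [|k IH]; first by apply: eq_hpoly hpoly1 => v; rewrite expr0.
by rewrite mulSn; apply: eq_hpoly (hpolyM hh IH) => v; rewrite exprS.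
Qed.

End HomogeneousFunctions.

Section Semistability.
Variable F : fieldType.
Implicit Types (f g : {poly F}) (w : {poly F} * {poly F}) (M : 'M[F]_2) (D : nat).

Lemma is_form_hofvec D (v : 'I_(D.+1 + D.+1) -> F) : is_form2 D (hofvec D v).
Proof. by rewrite /is_form2 /is_form !size_poly. Qed.

Lemma hofvecK D w : is_form2 D w -> hofvec D (hcoefs D w) = w.
Proof.
case: w => f g /andP[/formP hf /formP hg]; congr pair; apply/polyP => i; rewrite coef_poly.
  case: ltnP => hi; last by rewrite hf.
  by rewrite /hcoefs -[lshift _ _]/(unsplit (inl _)) unsplitK /= inordK.
case: ltnP => hi; last by rewrite hg.
by rewrite /hcoefs -[rshift _ _]/(unsplit (inr _)) unsplitK /= inordK.
Qed.

Lemma hpoly_coef1 D j : hpoly 1 (fun v => (@hofvec F D v).1`_j).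
Proof.
case: (ltnP j D.+1) => hj; last by apply: eq_hpoly (hpoly0 _ _ _) => v; rewrite coef_poly ltnNge hj.
by apply: eq_hpoly (hpoly_coord _ _) => v; rewrite coef_poly hj.
Qed.

Lemma hpoly_coef2 D j : hpoly 1 (fun v => (@hofvec F D v).2`_j).
Proof.
case: (ltnP j D.+1) => hj; last by apply: eq_hpoly (hpoly0 _ _ _) => v; rewrite coef_poly ltnNge hj.
by apply: eq_hpoly (hpoly_coord _ _) => v; rewrite coef_poly hj.
Qed.

Lemma hpoly_heval n d N (f : ('I_n -> F) -> {poly F}) x y :
  (forall j, hpoly d (fun v => (f v)`_j)) -> hpoly d (fun v => heval N (f v) x y).
Proof.
move=> hf; apply: hpoly_sum => i.
by apply: eq_hpoly (hpolyZ (x ^+ i * y ^+ (N - i)) (hf i)) => v; rewrite mulrC mulrA.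
Qed.

Lemma hpoly_coefM n d e (f g : ('I_n -> F) -> {poly F}) k :
  (forall j, hpoly d (fun v => (f v)`_j)) -> (forall j, hpoly e (fun v => (g v)`_j)) ->
  hpoly (d + e) (fun v => (f v * g v)`_k).
Proof.
move=> hf hg; apply: (eq_hpoly (h := fun v => \sum_(j < k.+1) (f v)`_j * (g v)`_(k - j))).
  by move=> v; rewrite coefM.
by apply: hpoly_sum => j; apply: hpolyM.
Qed.

Lemma hpoly_deriv n d (f : ('I_n -> F) -> {poly F}) k :
  (forall j, hpoly d (fun v => (f v)`_j)) -> hpoly d (fun v => (f v)^`()`_k).
Proof.
move=> hf; apply: eq_hpoly (hpolyZ k.+1%:R (hf k.+1)) => v.
by rewrite coef_deriv mulr_natl.
Qed.

Lemma hpoly_coef_fixform D k : hpoly 1 (fun v => (fixform (@hofvec F D v))`_k).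
Proof.
have h1 := hpolyZ (-1) (hpoly_coef1 D k).
case: k h1 => [|k] h1.
  by apply: eq_hpoly h1 => v; rewrite coefB coefXM sub0r mulN1r.
apply: eq_hpoly (hpolyD (hpoly_coef2 D k) h1) => v.
by rewrite coefB coefXM mulN1r.
Qed.

Lemma hpoly_coef_wronskian D k :
  hpoly 2 (fun v => (wronskian (@hofvec F D v).1 (@hofvec F D v).2)`_k).
Proof.
have h1 : hpoly (1 + 1) (fun v => ((@hofvec F D v).1^`() * (@hofvec F D v).2)`_k).
  by apply: hpoly_coefM => j; [apply: hpoly_deriv => i; apply: hpoly_coef1|apply: hpoly_coef2].
have h2 : hpoly (1 + 1) (fun v => ((@hofvec F D v).1 * (@hofvec F D v).2^`())`_k).
  by apply: hpoly_coefM => j; [apply: hpoly_coef1|apply: hpoly_deriv => i; apply: hpoly_coef2].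
by apply: eq_hpoly (hpolyD h1 (hpolyZ (-1) h2)) => v; rewrite coefB mulN1r.
Qed.

Hypothesis hF : root_closed F.

Lemma coef_hcomp_rootmult (L : seq (F * F)) M j :
  (j < rootmult L (M ord0 ord_max, M ord_max ord_max))%N ->
  (hcomp (size L) (linprod L) (mxnum M) (mxden M))`_j = 0.
Proof.
move=> hj; rewrite linprod_act coef_linprod_mult // count_map.
rewrite (eq_count (a2 := fun l => br l (M ord0 ord_max, M ord_max ord_max) == 0)) // => l /=.
by rewrite /br -oppr_eq0 opprB.
Qed.

(* Hilbert-Mumford for the conjugation action, hard direction: a nonvanishing invariant
   is found among those of the binary form theta^2a omega^2b, where theta is the form
   of fixed points and omega the Wronskian. *)
Lemma semistable_of_stable_points D w : (2 <= D)%N -> is_form2 D w ->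
  (forall M, \det M = 1 -> ~ unstable D (hconj D M w)) -> semistable_pt D w.
Proof.
case: D => [|[|D]] // _; set E := D.+1 => hw hns.
have [c1 [L1 [sL1 eL1 hL1]]] := form_split hF (is_form_fixform hw).
have hW w' : is_form2 E.+1 w' -> is_form (E + E) (wronskian w'.1 w'.2).
  by case/andP=> *; apply: is_form_wronskian.
have [c2 [L2 [sL2 eL2 hL2]]] := form_split hF (hW w hw).
(* Otherwise moving [v] to 0 kills the low coefficients of both covariants and makes the conjugate
   unstable. A covariant that vanishes identically, [c1 = 0] or [c2 = 0], counts as too singular
   everywhere. *)
have H v : v != 0 -> (c1 != 0) && ((rootmult L1 v).*2 <= size L1)%N ||
                     (c2 != 0) && ((rootmult L2 v).*2 <= size L2)%N.
  move=> v0; have [M [dM M1 M2]] := exists_sl2_col v0.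
  apply: contraT => hn; case: (hns M dM); apply: unstable_of_covariants => j hj.
    rewrite fixform_hconj // eL1 hcompZ coefZ; have [->|h1] := eqVneq c1 0; first by rewrite mul0r.
    move: hn; rewrite h1 /= => /norP[hn _].
    rewrite -sL1 coef_hcomp_rootmult ?mulr0 // M1 M2 -surjective_pairing.
    rewrite -ltnNge sL1 in hn; by rewrite -ltn_double (leq_ltn_trans hj).
  rewrite wronskian_hconj // dM expr1n scale1r eL2 hcompZ coefZ.
  have [->|h2] := eqVneq c2 0; first by rewrite mul0r.
  move: hn; rewrite h2 /= => /norP[_ hn].
  rewrite -sL2 coef_hcomp_rootmult ?mulr0 // M1 M2 -surjective_pairing.
  by rewrite -ltnNge sL2 addnn ltn_double in hn; apply: leq_trans hj hn.
have [L1_gt0 L2_gt0] : (0 < size L1)%N /\ (0 < size L2)%N by rewrite sL1 sL2.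
have [a [b [hm ha hb hab]]] := balanced_exponents L1_gt0 L2_gt0 hL1 hL2 H.
set m := (a * size L1 + b * size L2)%N in hm hab.
(* The exponents are doubled to make the degree even, so that the roots can be matched in pairs. *)
pose L := flatten (nseq a.*2 L1) ++ flatten (nseq b.*2 L2).
have count_rep (p : pred (F * F)) k K : count p (flatten (nseq k K)) = (k * count p K)%N.
  by elim: k => //= k IH; rewrite count_cat IH mulSn.
have size_rep k (K : seq (F * F)) : size (flatten (nseq k K)) = (k * size K)%N.
  by rewrite -!count_predT count_rep.
have prod_rep k K : linprod (flatten (nseq k K)) = linprod K ^+ k.
  elim: k => [|k IH] /=; first by rewrite expr0 /linprod big_nil.
  by rewrite /linprod big_cat exprS -/(linprod _) -/(linprod _) IH.
have sL : size L = (m + m)%N.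
  by rewrite size_cat !size_rep /m -!doubleMl addnn doubleD.
have [P [sP allP hP]] : exists P : seq ((F * F) * (F * F)),
    [/\ size P = m, all (fun p => br p.1 p.2 != 0) P & perm_eq (unzip1 P ++ unzip2 P) L].
  apply: matching_exists => //.
    rewrite all_cat; have hrep k K : all (fun l => l != 0) K -> all (fun l => l != 0) (flatten (nseq k K)).
      by move=> hK; elim: k => //= k IH; rewrite all_cat hK.
    by rewrite !hrep.
  move=> v v0; rewrite count_cat !count_rep -!doubleMl -doubleD.
  by have := hab v v0.
set L' := _ ++ _ in hP.
have sL' : size L' = (m + m)%N by rewrite (perm_size hP).
pose B w' := fixform w' ^+ a.*2 * wronskian w'.1 w'.2 ^+ b.*2.
have hBdeg : (m + m = E.+2 * a.*2 + (E + E) * b.*2)%N.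
  by rewrite /m sL1 sL2 addnn doubleD -!doubleMr mulnC [(_ * b)%N]mulnC.
have hB w' : is_form2 E.+1 w' -> is_form (m + m) (B w').
  by move=> hw'; rewrite hBdeg is_formM ?is_formX ?is_form_fixform ?hW.
have BE : B w = (c1 ^+ a.*2 * c2 ^+ b.*2) *: linprod L'.
  have -> : linprod L' = linprod L by rewrite /linprod (perm_big _ hP).
  have -> : linprod L = linprod L1 ^+ a.*2 * linprod L2 ^+ b.*2.
    by rewrite -!prod_rep /linprod big_cat.
  by rewrite /B eL1 eL2 !exprZn -scalerAl -scalerAr scalerA.
have c0 : c1 ^+ a.*2 * c2 ^+ b.*2 != 0.
  rewrite mulf_neq0 // expf_eq0 negb_and double_gt0.
    by case: (posnP a) => //= /ha ->.
  by case: (posnP b) => //= /hb ->.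
have [|r [n [mu [u [r0 hu hne hinv]]]]] := binary_form_invariant hF hm sL'.
  move=> i hi; rewrite !nth_cat !size_map sP hi ltnNge leq_addr /= addKn.
  rewrite !(nth_map 0) ?sP //; apply: (all_nthP _ allP); by rewrite sP.
have [Q [hQ eQ]] : hpoly (r * (a.*2 * 1 + b.*2 * 2))
    (fun v => evalcomb (m + m) mu u (B (@hofvec F E.+1 v))).
  apply: hpoly_sum => t; apply: hpolyZ; rewrite -(hu t); apply: hpoly_prod => x.
  have h1 : hpoly 1 (fun v => heval E.+2 (fixform (@hofvec F E.+1 v)) x.1 x.2).
    by apply: hpoly_heval => j; apply: hpoly_coef_fixform.
  have h2 : hpoly 2 (fun v => heval (E + E) (wronskian (@hofvec F E.+1 v).1 (@hofvec F E.+1 v).2) x.1 x.2).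
    by apply: hpoly_heval => j; apply: hpoly_coef_wronskian.
  apply: eq_hpoly (hpolyM (hpolyX a.*2 h1) (hpolyX b.*2 h2)) => v.
  have hv := @is_form_hofvec E.+1 v.
  by rewrite hBdeg hevalM ?is_formX ?is_form_fixform ?hW // !hevalX ?is_form_fixform ?hW.
exists (r * (a.*2 * 1 + b.*2 * 2))%N; split.
  rewrite muln_gt0 r0 addn_gt0 !muln_gt0 !double_gt0 /= andbT.
  by move: hm; rewrite /m addn_gt0 !muln_gt0 => /orP[/andP[-> _]|/andP[-> _]]; rewrite ?orbT.
exists Q; split => //; last first.
  by rewrite eQ hofvecK // BE hne.
move=> M dM v; rewrite !eQ hofvecK ?is_form_hconj // -[RHS](hinv M) ?hB ?is_form_hofvec //.
have hv := @is_form_hofvec E.+1 v.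
congr (evalcomb _ _ _ _); rewrite /B fixform_hconj // wronskian_hconj // dM expr1n scale1r.
by rewrite hBdeg hcompM ?is_formX ?is_form_fixform ?hW // !hcompX ?is_form_fixform ?hW.
Qed.

End Semistability.

Section Diagonal.
Variable F : comNzRingType.
Implicit Types (f : {poly F}) (w : {poly F} * {poly F}) (M : 'M[F]_2) (D : nat).

Definition mx22 (a b c e : F) : 'M[F]_2 :=
  \matrix_(i, j) if i == ord0 then (if j == ord0 then a else b) else (if j == ord0 then c else e).

Lemma det_mx22 a b c e : \det (mx22 a b c e) = a * e - b * c.
Proof. by rewrite det2 !mxE. Qed.

Lemma mul_mx22 a b c e a' b' c' e' : mx22 a b c e *m mx22 a' b' c' e' =
  mx22 (a * a' + b * c') (a * b' + b * e') (c * a' + e * c') (c * b' + e * e').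
Proof.
by apply/matrixP => i j; rewrite mul2E !mxE /=; case: (i == ord0); case: (j == ord0).
Qed.

Lemma scale_mx22 k a b c e : k *: mx22 a b c e = mx22 (k * a) (k * b) (k * c) (k * e).
Proof. by apply/matrixP => i j; rewrite !mxE; case: ifP; case: ifP. Qed.

Lemma mx22_eta M : M = mx22 (M ord0 ord0) (M ord0 ord_max) (M ord_max ord0) (M ord_max ord_max).
Proof.
apply/matrixP => i j; rewrite !mxE; case: (unliftP ord0 i) => [i' ->|->];
  case: (unliftP ord0 j) => [j' ->|->] //=; by congr (M _ _); apply: val_inj; rewrite /= ?ord1.
Qed.

Lemma coef_hcomp_diag D f a e j : (j <= D)%N ->
  (hcomp D f (a *: 'X + 0%:P) (0 *: 'X + e%:P))`_j = f`_j * (a ^+ j * e ^+ (D - j)).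
Proof.
move=> hj; rewrite scale0r add0r addr0 coef_sum.
have hj' : (j < D.+1)%N by [].
rewrite (bigD1 (Ordinal hj')) //= big1 => [|i hi].
  by rewrite addr0 exprZn -rmorphXn /= -scalerAl mulrC mul_polyC !coefZ coefXn eqxx mulr1.
rewrite exprZn -rmorphXn /= -scalerAl mulrC mul_polyC !coefZ coefXn.
by rewrite -[(j == i :> nat)]/(Ordinal hj' == i) eq_sym (negbTE hi) !mulr0.
Qed.

Lemma coef_hconj_diag1 D w a e j : (j <= D)%N ->
  (hconj D (mx22 a 0 0 e) w).1`_j = e * (w.1`_j * (a ^+ j * e ^+ (D - j))).
Proof.
move=> hj; rewrite hconjE /= /mxnum /mxden !mxE /= coefB !coefZ mul0r subr0.
by rewrite coef_hcomp_diag.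
Qed.

Lemma coef_hconj_diag2 D w a e j : (j <= D)%N ->
  (hconj D (mx22 a 0 0 e) w).2`_j = a * (w.2`_j * (a ^+ j * e ^+ (D - j))).
Proof.
move=> hj; rewrite hconjE /= /mxnum /mxden !mxE /= coefD coefN !coefZ mul0r oppr0 add0r.
by rewrite coef_hcomp_diag.
Qed.

End Diagonal.

Section Unstable.
Import -(notations) mpoly.
Variable F : fieldType.
Hypothesis hF : root_closed F.
Implicit Types (f : {poly F}) (w : {poly F} * {poly F}) (M : 'M[F]_2) (D m : nat).

Lemma meval_homog0 n m (P : mpoly.mpoly n F) : (0 < m)%N ->
  all (fun mn => mpoly.mdeg mn == m) (mpoly.msupp P) -> mpoly.meval (fun=> 0) P = 0.
Proof.
move=> m0 hP; rewrite mpoly.mevalE big_seq big1 // => mn hmn.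
have : ~~ [forall i, mn i == 0%N].
  apply/negP => /forallP h; have := allP hP mn hmn.
  by rewrite mpoly.mdegE big1 ?(ltn_eqF m0) // => i _; apply/eqP.
rewrite negb_forall => /existsP[i hi].
by rewrite (bigD1 i) //= expr0n (negbTE hi) mul0r mulr0.
Qed.

Lemma meval_homogZ n m (P : mpoly.mpoly n F) c (v : 'I_n -> F) :
  all (fun mn => mpoly.mdeg mn == m) (mpoly.msupp P) ->
  mpoly.meval (fun i => c * v i) P = c ^+ m * mpoly.meval v P.
Proof.
move=> hP; rewrite !mpoly.mevalE mulr_sumr big_seq [RHS]big_seq; apply: eq_bigr => mn hmn.
rewrite mulrCA; congr (_ * _); rewrite -(eqP (allP hP mn hmn)) mpoly.mdegE.
by rewrite -prodrXr -big_split; apply: eq_bigr => i _; rewrite exprMn.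
Qed.

Lemma semistable_pt_scale D c w : c != 0 -> semistable_pt D w -> semistable_pt D (scale_pair c w).
Proof.
move=> c0 [m [m0 [P [hP inv ne]]]]; exists m; split=> //; exists P; split=> //.
have -> : mpoly.meval (hcoefs D (scale_pair c w)) P = c ^+ m * mpoly.meval (hcoefs D w) P.
  rewrite -(meval_homogZ c _ hP); apply: mpoly.meval_eq => i.
  by rewrite /hcoefs; case: fintype.split => j /=; rewrite coefZ.
by rewrite mulf_neq0 ?expf_neq0.
Qed.

(** The easy direction of Hilbert-Mumford: along diag(t, 1/t) all nonzero coefficients have positive
    weight, so an invariant becomes a polynomial in t that is constant for t nonzero and vanishes at
    t = 0. *)
Lemma semistable_not_unstable D w M : is_form2 D w -> semistable_pt D w -> \det M = 1 ->
  ~ unstable D (hconj D M w).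
Proof.
move=> hw [m [m0 [P [hP inv ne]]]] dM.
have := inv M dM (hcoefs D w); rewrite hofvecK // => e.
rewrite -e in ne => {e}; move: (hconj D M w) ne (is_form_hconj D M w) => {hw dM M w} w ne hw [h1 h2].
(* The weight of the coefficient under diag(t, 1/t): 2j - (D + 1) in the first form, 2j + 1 - D in
   the second. Truncated subtraction only matters where instability makes the coefficient zero. *)
pose n i : nat := match @fintype.split D.+1 D.+1 i with inl j => (j.*2 - D.+1)%N | inr j => (j.*2.+1 - D)%N end.
pose Q : {poly F} := \sum_(mn <- mpoly.msupp P)
  mpoly.mcoeff mn P *: \prod_i (hcoefs D w i *: 'X^(n i)) ^+ mn i.
have QE t : Q.[t] = mpoly.meval (fun i => hcoefs D w i * t ^+ n i) P.
  rewrite mpoly.mevalE horner_sum; apply: eq_bigr => mn _; rewrite hornerZ horner_prod.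
  by congr (_ * _); apply: eq_bigr => i _; rewrite horner_exp hornerZ hornerXn.
have npos i : hcoefs D w i != 0 -> (0 < n i)%N.
  rewrite /hcoefs /n; case: fintype.split => j; apply: contraR; rewrite -leqNgt leqn0 subn_eq0 => hj.
    by rewrite h1.
  by rewrite h2.
have Q0 : Q.[0] = 0.
  rewrite QE -[RHS](meval_homog0 m0 hP); apply: mpoly.meval_eq => i.
  have [->|h] := eqVneq (hcoefs D w i) 0; first by rewrite mul0r.
  by rewrite expr0n (gtn_eqF (npos i h)) mulr0.
have Qt t : t \notin [:: 0] -> (Q - (mpoly.meval (hcoefs D w) P)%:P).[t] = 0.
  rewrite inE => t0; rewrite hornerD hornerN hornerC; apply/eqP; rewrite subr_eq0; apply/eqP.
  have dT : \det (mx22 t 0 0 t^-1) = 1 by rewrite det_mx22 mulfV // mul0r subr0.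
  have := inv _ dT (hcoefs D w); rewrite hofvecK // => <-; rewrite QE; apply: mpoly.meval_eq => i.
  rewrite /hcoefs; move: (npos i); rewrite /n /hcoefs; case: fintype.split => j hj.
    have hjD : (j <= D)%N by rewrite -ltnS.
    rewrite coef_hconj_diag1 //; have [->|hne] := eqVneq (w.1)`_j 0; first by rewrite !mul0r mulr0.
    rewrite mulrCA; congr (_ * _); have := hj hne; rewrite subn_gt0 => hj'.
    apply: (mulfI (expf_neq0 (D - j).+1 t0)); rewrite -exprD.
    have -> : ((D - j).+1 + (j.*2 - D.+1) = j)%N by move: (nat_of_ord j) hjD hj'; clear; lia.
    rewrite exprVn exprS; move: (t ^+ (D - j)) (expf_neq0 (D - j) t0) (t ^+ j) => u u0 x.
    by field; rewrite u0 t0.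
  have hjD : (j <= D)%N by rewrite -ltnS.
  rewrite coef_hconj_diag2 //; have [->|hne] := eqVneq (w.2)`_j 0; first by rewrite !mul0r mulr0.
  rewrite mulrCA; congr (_ * _); have := hj hne; rewrite subn_gt0 => hj'.
  apply: (mulfI (expf_neq0 (D - j) t0)); rewrite -exprD.
  have -> : ((D - j) + (j.*2.+1 - D) = j.+1)%N by move: (nat_of_ord j) hjD hj'; clear; lia.
  rewrite exprVn exprS; move: (t ^+ (D - j)) (expf_neq0 (D - j) t0) (t ^+ j) => u u0 x.
  by field; rewrite u0.
have /(congr1 (fun q : {poly F} => q.[0])) := poly_fun_eq0 hF Qt.
rewrite hornerD hornerN hornerC horner0 Q0 sub0r => /eqP; rewrite oppr_eq0.
by rewrite (negbTE ne).
Qed.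

End Unstable.

(** * Vanishing of iterates and the set I(d) *)

Section IterationLocus.
Variable F : fieldType.
Hypothesis hF : root_closed F.
Implicit Types (f p q : {poly F}) (w : {poly F} * {poly F}) (D d n : nat).

(** The zero pair qualifies too, so that not being constant is an induction hypothesis strong enough
    to give nonvanishing. *)
Definition constant_map w : Prop := exists2 l : F * F, l != 0 & l.2 *: w.1 = l.1 *: w.2.

Lemma hcomp_eq0 D f p q : is_form D f -> f != 0 -> hcomp D f p q = 0 -> constant_map (p, q).
Proof.
move=> /(form_split hF)[c [L [<- -> hL]]] hf; rewrite hcompZ hcomp_linprod => /eqP.
have c0 : c != 0 by apply: contraNneq hf => ->; rewrite scale0r.
rewrite scaler_eq0 (negbTE c0) prodf_seq_eq0 => /hasP[l hl /eqP /= h].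
by exists l; [exact: (allP hL) | apply/eqP; rewrite -subr_eq0 h].
Qed.

Lemma constant_mapE w : constant_map w ->
  exists l A, l != 0 /\ w = (l.1 *: A, l.2 *: A).
Proof.
case: w => f g [l l0 /= e]; exists l; have [h|h] := eqVneq l.1 0.
  have h2 : l.2 != 0 by apply: contraNneq l0 => h2; rewrite (surjective_pairing l) h h2.
  exists (l.2^-1 *: g); split=> //; rewrite h scale0r scalerA mulfV // scale1r; congr pair.
  by apply: (scalerI h2); rewrite e h !scale0r scaler0.
exists (l.1^-1 *: f); split=> //; rewrite scalerA mulfV // scale1r; congr pair.
by apply: (scalerI h); rewrite -e !scalerA mulrAC mulfV // mul1r.
Qed.

(** If w = (l.1 A, l.2 A), every further iterate is [l] times a multiple of a power of [A] by powers
    of A(l), and A(l) is nonzero outside I(d). Otherwise no iterate is constant: by [hcomp_eq0] a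
    constant iterate would force the preceding one to be constant, down to the identity. *)
Lemma hiter_neq0 d w n : is_form2 d w -> w != 0 -> ~ in_I d w -> hiter d w n != 0.
Proof.
move=> hw w0 hI; have [cw|ncw] := boolp.EM (constant_map w).
  have [l [A [l0 wE]]] := constant_mapE cw.
  have A0 : A != 0 by apply: contraNneq w0 => A0; rewrite wE A0 !scaler0.
  have hA : is_form d A.
    have [h|h] := eqVneq l.1 0.
      have h2 : l.2 != 0 by apply: contraNneq l0 => h2; rewrite (surjective_pairing l) h h2.
      by case/andP: hw => _; rewrite wE /is_form /= size_scale.
    by case/andP: hw; rewrite wE /is_form /= size_scale.
  have hev : heval d A l.1 l.2 != 0.
    apply/eqP => h; apply: hI; exists A, l.1, l.2; split=> //.
  have pair0 (B : {poly F}) : B != 0 -> (l.1 *: B, l.2 *: B) != 0.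
    move=> B0; apply/eqP => h; have h1 : l.1 *: B = 0 := congr1 fst h.
    have h2 : l.2 *: B = 0 := congr1 snd h.
    move/eqP: h1; move/eqP: h2; rewrite !scaler_eq0 (negbTE B0) !orbF => /eqP h2 /eqP h1.
    by case/eqP: l0; rewrite (surjective_pairing l) h1 h2.
  case: n => [|n]; first by rewrite xpair_eqE polyX_eq0.
  suff [B B0 ->] : exists2 B, B != 0 & hiter d w n.+1 = (l.1 *: B, l.2 *: B) by apply: pair0.
  elim: n => [|n [B B0 IH]].
    by exists A => //; case/andP: hw => h1 h2; rewrite hiterS /hcomp2 /= !hcomp_id // -surjective_pairing.
  exists (heval d A l.1 l.2 *: B ^+ d); first by rewrite scaler_eq0 negb_or hev expf_neq0.
  by rewrite hiterS IH /hcomp2 wE /= !hcompZ !hcomp_heval.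
suff h : ~ constant_map (hiter d w n).
  apply/eqP => h0; apply: h; rewrite h0; exists (1, 0); last by rewrite !scaler0.
  by rewrite xpair_eqE oner_eq0.
elim: n => [|n IH] [l l0] /=.
  rewrite -mul_polyC => /(congr1 (fun p : {poly F} => (p`_1, p`_0))).
  rewrite !coefCM !coefX !coefZ !coefC /= !mulr0 !mulr1 => -[h2 h1].
  by case/eqP: l0; rewrite (surjective_pairing l) h2 -h1.
set v := hiter d w n => e; case/andP: hw => h1 h2.
have h0 : hcomp d (l.2 *: w.1 - l.1 *: w.2) v.1 v.2 = 0.
  by rewrite hcompD hcompN !hcompZ e subrr.
have hf : is_form d (l.2 *: w.1 - l.1 *: w.2) by rewrite is_formD ?is_formN ?is_formZ.
have [z|nz] := eqVneq (l.2 *: w.1 - l.1 *: w.2) 0.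
  by apply: ncw; exists l => //; apply/eqP; rewrite -subr_eq0 z.
by apply: IH; rewrite -/v (surjective_pairing v); apply: hcomp_eq0 h0.
Qed.

Lemma in_I_hiter2 d w : is_form2 d w -> (0 < d)%N -> in_I d w -> hiter d w 2 = 0.
Proof.
move=> /andP[h1 h2] d0 [A [a [b [A0 hA ab wE hev]]]].
rewrite !hiterS /hcomp2 /= !hcomp_id // {2 3 5 6}wE /= !hcomp_heval.
by rewrite wE /= !hevalZ hev !mulr0 !scale0r.
Qed.

Lemma in_I_scale d c w : c != 0 -> in_I d (scale_pair c w) -> in_I d w.
Proof.
move=> c0 [A [a [b [A0 hA ab [e1 e2] hev]]]].
exists (c^-1 *: A), a, b; split; rewrite ?is_formZ //.
- by rewrite scaler_eq0 invr_eq0 (negbTE c0).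
- by rewrite (surjective_pairing w); congr pair; apply: (scalerI c0);
    rewrite ?e1 ?e2 !scalerA mulrAC mulfV // mul1r.
- by rewrite hevalZ hev mulr0.
Qed.

End IterationLocus.

From mathcomp Require Import all_classical all_reals all_analysis.
Import Order.TTheory GRing.Theory Num.Theory.

(** * Reduction and minimal conjugates *)

Section Valuation.
Variables (K : closedFieldType) (R : realType) (absK : K -> R).
Hypothesis habs : nonarch_abs absK.
Implicit Types (x y : K) (f p q : {poly K}) (w : {poly K} * {poly K}) (D n : nat).

Lemma abs_ge0 x : 0 <= absK x. Proof. by have [h _ _ _] := habs; apply: h. Qed.

Lemma absM : {morph absK : x y / x * y}. Proof. by have [_ _ h _] := habs; apply: h. Qed.

Lemma abs_eq0 x : (absK x == 0) = (x == 0).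
Proof. by have [_ h _ _] := habs; apply/eqP/eqP => /h. Qed.

Lemma abs0 : absK 0 = 0. Proof. by apply/eqP; rewrite abs_eq0. Qed.

Lemma abs_gt0 x : (0 < absK x) = (x != 0).
Proof. by rewrite lt_neqAle abs_ge0 andbT eq_sym abs_eq0. Qed.

Lemma abs1 : absK 1 = 1.
Proof.
have h : absK 1 != 0 by rewrite abs_eq0 oner_eq0.
by apply: (mulfI h); rewrite -absM !mulr1.
Qed.

Lemma absN x : absK (- x) = absK x.
Proof.
have : absK (-1) ^+ 2 = 1 by rewrite expr2 -absM mulrNN mulr1 abs1.
move/eqP; rewrite pexpr_eq1 ?abs_ge0 // => /eqP h.
by rewrite -mulN1r absM h mul1r.
Qed.

Lemma absX x n : absK (x ^+ n) = absK x ^+ n.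
Proof. by elim: n => [|n IH]; rewrite ?abs1 // !exprS absM IH. Qed.

Lemma absV x : absK x^-1 = (absK x)^-1.
Proof.
have [->|x0] := eqVneq x 0; first by rewrite !(invr0, abs0).
have h : absK x != 0 by rewrite abs_eq0.
by apply: (mulfI h); rewrite -absM !mulfV // abs1.
Qed.

Lemma abs_leD x y (B : R) : absK x <= B -> absK y <= B -> absK (x + y) <= B.
Proof.
have [_ _ _ h] := habs => hx hy; apply: le_trans (h x y) _.
by rewrite ge_max hx hy.
Qed.

Lemma abs_le_sum (I : Type) (r : seq I) (P : pred I) (h : I -> K) (B : R) : 0 <= B ->
  (forall i, P i -> absK (h i) <= B) -> absK (\sum_(i <- r | P i) h i) <= B.
Proof.
move=> B0 hh; apply: (big_ind (fun x => absK x <= B)) => //; first by rewrite abs0.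
by move=> x y; apply: abs_leD.
Qed.

Lemma root_closedK : root_closed K.
Proof. by move=> p hp; apply/closed_rootP; rewrite gtn_eqF. Qed.

Lemma exists_root n x : (0 < n)%N -> exists y, y ^+ n = x.
Proof.
move=> n0; have [y hy] : exists y, root ('X^n - x%:P) y.
  by apply: root_closedK; rewrite size_XnsubC.
by exists y; apply/eqP; rewrite -subr_eq0; move: hy; rewrite /root !hornerE.
Qed.

Definition nrm D w : R := absK (norm_const absK D w).

Lemma nrm_ge D w : (forall i, (i <= D)%N -> absK w.1`_i <= nrm D w) /\
  (forall i, (i <= D)%N -> absK w.2`_i <= nrm D w).
Proof.
rewrite /nrm /norm_const; case: arg_maxP => //= i0 _ hmax; split => i hi.
  have := hmax (lshift D.+1 (Ordinal (hi : (i < D.+1)%N))) isT.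
  by rewrite {1}/hcoefs -[lshift _ _]/(unsplit (inl _)) unsplitK.
have := hmax (rshift D.+1 (Ordinal (hi : (i < D.+1)%N))) isT.
by rewrite {1}/hcoefs -[rshift _ _]/(unsplit (inr _)) unsplitK.
Qed.

Lemma nrm_le D w (B : R) : (forall i, (i <= D)%N -> absK w.1`_i <= B) ->
  (forall i, (i <= D)%N -> absK w.2`_i <= B) -> nrm D w <= B.
Proof.
move=> h1 h2; rewrite /nrm /norm_const /hcoefs.
by case: fintype.split => j; rewrite ?h1 ?h2 // -ltnS.
Qed.

Lemma nrm_lt D w (B : R) : (forall i, (i <= D)%N -> absK w.1`_i < B) ->
  (forall i, (i <= D)%N -> absK w.2`_i < B) -> nrm D w < B.
Proof.
move=> h1 h2; rewrite /nrm /norm_const /hcoefs.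
by case: fintype.split => j; rewrite ?h1 ?h2 // -ltnS.
Qed.

Lemma nrm_ge0 D w : 0 <= nrm D w. Proof. exact: abs_ge0. Qed.

Lemma nrm_scale D c w : nrm D (scale_pair c w) = absK c * nrm D w.
Proof.
have [h1 h2] := nrm_ge D w.
apply: le_anti; apply/andP; split.
  by apply: nrm_le => i hi; rewrite coefZ absM ler_wpM2l ?abs_ge0 ?h1 ?h2.
have [->|c0] := eqVneq c 0; first by rewrite abs0 mul0r nrm_ge0.
have [h3 h4] := nrm_ge D (scale_pair c w).
rewrite -ler_pdivlMl ?abs_gt0 //; apply: nrm_le => i hi; rewrite ler_pdivlMl ?abs_gt0 // -absM -coefZ.
  exact: h3.
exact: h4.
Qed.

Lemma nrm_gt0 D w : is_form2 D w -> w != 0 -> 0 < nrm D w.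
Proof.
move=> /andP[/formP f1 /formP f2] w0; rewrite lt_neqAle nrm_ge0 andbT eq_sym.
have [h1 h2] := nrm_ge D w; apply: contra w0 => /eqP h; rewrite h in h1 h2.
have z (p : {poly K}) : (forall i, (D < i)%N -> p`_i = 0) ->
    (forall i, (i <= D)%N -> absK p`_i <= 0) -> p = 0.
  move=> hf hp; apply/polyP => i; rewrite coef0; case: (ltnP D i) => hi; first exact: hf.
  by apply/eqP; rewrite -abs_eq0 eq_le hp ?abs_ge0.
by rewrite (surjective_pairing w) (z _ f1 h1) (z _ f2 h2).
Qed.

End Valuation.

(** * Reduction modulo the maximal ideal *)

Section Reduction.
Variables (K : closedFieldType) (R : realType) (absK : K -> R).
Hypothesis habs : nonarch_abs absK.
Variables (k : fieldType) (red : K -> k).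
Hypothesis hres : residue_map absK red.

(** A relation rather than a map, since [red] is a morphism only on the valuation ring: integrality
    travels together with the residue. *)
Definition reduces_to (p : {poly K}) (p' : {poly k}) : Prop :=
  forall i, absK p`_i <= 1 /\ red p`_i = p'`_i.

Definition reduces_to1 (x : K) (x' : k) : Prop := absK x <= 1 /\ red x = x'.

Lemma red0P x : absK x <= 1 -> (red x = 0 <-> absK x < 1).
Proof. by have [_ _ _ h _] := hres; apply: h. Qed.

Lemma red0 : red 0 = 0. Proof. by apply/red0P; rewrite (abs0 habs) ?ltr01 ?ler01. Qed.

Lemma reduces1_0 : reduces_to1 0 0. Proof. by split; rewrite ?(abs0 habs) ?ler01 ?red0. Qed.

Lemma reduces1_1 : reduces_to1 1 1.
Proof. by have [h _ _ _ _] := hres; split; rewrite ?(abs1 habs). Qed.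

Lemma reduces1D x x' y y' : reduces_to1 x x' -> reduces_to1 y y' -> reduces_to1 (x + y) (x' + y').
Proof.
by have [_ h _ _ _] := hres; case=> hx <- [hy <-]; split; rewrite ?(abs_leD habs) ?h.
Qed.

Lemma reduces1M x x' y y' : reduces_to1 x x' -> reduces_to1 y y' -> reduces_to1 (x * y) (x' * y').
Proof.
have [_ _ h _ _] := hres; case=> hx <- [hy <-]; split; rewrite ?h // (absM habs).
by rewrite mulr_ile1 ?(abs_ge0 habs).
Qed.

Lemma reduces1N x x' : reduces_to1 x x' -> reduces_to1 (- x) (- x').
Proof.
move=> hx; have h : reduces_to1 (- x) (red (- x)) by split; rewrite // (absN habs); case: hx.
have [_] := reduces1D h hx; rewrite addNr red0 => /esym/eqP.
by rewrite addr_eq0 => /eqP <-.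
Qed.

Lemma reduces1_sum (I : Type) (r : seq I) (h : I -> K) (h' : I -> k) :
  (forall i, reduces_to1 (h i) (h' i)) -> reduces_to1 (\sum_(i <- r) h i) (\sum_(i <- r) h' i).
Proof.
move=> hh; apply: (big_ind2 reduces_to1) => //; first exact: reduces1_0.
by move=> *; apply: reduces1D.
Qed.

Lemma reduces1X x x' n : reduces_to1 x x' -> reduces_to1 (x ^+ n) (x' ^+ n).
Proof.
by move=> hx; elim: n => [|n IH]; [exact: reduces1_1|rewrite !exprS; apply: reduces1M].
Qed.

Lemma reducesD p p' q q' : reduces_to p p' -> reduces_to q q' -> reduces_to (p + q) (p' + q').
Proof. by move=> h1 h2 i; rewrite !coefD; apply: reduces1D. Qed.

Lemma reducesM p p' q q' : reduces_to p p' -> reduces_to q q' -> reduces_to (p * q) (p' * q').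
Proof.
by move=> h1 h2 i; rewrite !coefM; apply: reduces1_sum => j; apply: reduces1M.
Qed.

Lemma reducesZ a a' p p' : reduces_to1 a a' -> reduces_to p p' -> reduces_to (a *: p) (a' *: p').
Proof. by move=> h1 h2 i; rewrite !coefZ; apply: reduces1M. Qed.

Lemma reducesN p p' : reduces_to p p' -> reduces_to (- p) (- p').
Proof. by move=> h i; rewrite !coefN; apply: reduces1N. Qed.

Lemma reducesC a a' : reduces_to1 a a' -> reduces_to a%:P a'%:P.
Proof. by move=> h i; rewrite !coefC; case: eqP => _; [exact: h|exact: reduces1_0]. Qed.

Lemma reduces_polyX : reduces_to 'X 'X.
Proof. by move=> i; rewrite !coefX; case: eqP => _; [exact: reduces1_1|exact: reduces1_0]. Qed.

Lemma reducesX p p' n : reduces_to p p' -> reduces_to (p ^+ n) (p' ^+ n).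
Proof.
move=> hp; elim: n => [|n IH]; first by apply: (reducesC reduces1_1).
by rewrite !exprS; apply: reducesM.
Qed.

Lemma reduces_sum (I : Type) (r : seq I) (h : I -> {poly K}) (h' : I -> {poly k}) :
  (forall i, reduces_to (h i) (h' i)) -> reduces_to (\sum_(i <- r) h i) (\sum_(i <- r) h' i).
Proof.
move=> hh; apply: (big_ind2 reduces_to) => //; first by apply: (reducesC reduces1_0).
by move=> *; apply: reducesD.
Qed.

Lemma reduces_hcomp D f f' p p' q q' : reduces_to f f' -> reduces_to p p' -> reduces_to q q' ->
  reduces_to (hcomp D f p q) (hcomp D f' p' q').
Proof.
move=> hf hp hq; apply: reduces_sum => i; apply: reducesZ; first exact: hf.
by apply: reducesM; apply: reducesX.
Qed.

Definition reduces2 w (w' : {poly k} * {poly k}) : Prop :=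
  reduces_to w.1 w'.1 /\ reduces_to w.2 w'.2.

Lemma reduces2_hconj D (M : 'M[K]_2) (M' : 'M[k]_2) w w' :
  (forall i j, reduces_to1 (M i j) (M' i j)) -> reduces2 w w' ->
  reduces2 (hconj D M w) (hconj D M' w').
Proof.
move=> hM [h1 h2].
have hnum : reduces_to (mxnum M) (mxnum M').
  by apply: reducesD; [apply: reducesZ => //; apply: reduces_polyX|apply: reducesC].
have hden : reduces_to (mxden M) (mxden M').
  by apply: reducesD; [apply: reducesZ => //; apply: reduces_polyX|apply: reducesC].
split; rewrite !hconjE /=; apply: reducesD; rewrite ?reducesN //;
  do ?apply: reducesN; by apply: reducesZ => //; apply: reduces_hcomp.
Qed.

Lemma reduces2_hiter d w w' n : reduces2 w w' -> reduces2 (hiter d w n) (hiter d w' n).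
Proof.
case=> h1 h2; elim: n => [|n [h3 h4]].
  by split; [exact: reduces_polyX|apply: (reducesC reduces1_1)].
by split; apply: reduces_hcomp.
Qed.

Lemma exists_lift (a : k) : exists x, reduces_to1 x a.
Proof. by have [_ _ _ _ h] := hres; have [x hx] := h a; exists x. Qed.

Lemma reduces_horner n p p' x x' : is_form n p -> is_form n p' ->
  reduces_to p p' -> reduces_to1 x x' -> reduces_to1 p.[x] p'.[x'].
Proof.
move=> hp hp' h hx; rewrite (horner_coef_wide _ hp) (horner_coef_wide _ hp').
by apply: reduces1_sum => i; apply: reduces1M; [exact: h|exact: reduces1X].
Qed.

(** A monic polynomial over [k] lifts to a monic one with integral coefficients. A root of the lift
    has absolute value at most 1, since otherwise its leading term would dominate, and therefore
    reduces to a root. *)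
Lemma root_closed_residue : root_closed k.
Proof.
move=> p hp; pose n := (size p).-1; pose p1 := (lead_coef p)^-1 *: p.
have p0 : p != 0 by rewrite -size_poly_gt0 (ltn_trans _ hp).
have lc0 : (lead_coef p)^-1 != 0 by rewrite invr_eq0 lead_coef_eq0.
have n0 : (0 < n)%N by rewrite /n -ltnS prednK // (ltn_trans _ hp).
have [lift hlift] := boolp.choice exists_lift.
pose P := 'X^n + \poly_(i < n) lift p1`_i.
have sp1 : size p1 = n.+1 by rewrite size_scale // /n prednK // (ltn_trans _ hp).
have hP : reduces_to P p1.
  move=> i; rewrite coefD coefXn coef_poly; case: (ltngtP i n) => hi.
  - by rewrite add0r; apply: hlift.
  - by rewrite addr0 nth_default ?sp1 //; apply: reduces1_0.
  rewrite addr0 hi coefZ -/(lead_coef p) mulVf ?lead_coef_eq0 //; exact: reduces1_1.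
have sP : size P = n.+1.
  by rewrite size_polyDl size_polyXn // ltnS size_poly.
have [x /rootP hx] : exists x, root P x by apply: (root_closedK (K := K)); rewrite sP ltnS.
have hx1 : absK x <= 1.
  rewrite leNgt; apply/negP => h.
  have x0 : 0 < absK x by apply: lt_trans h; apply: ltr01.
  have : absK (x ^+ n) <= absK x ^+ n.-1.
    move: hx; rewrite hornerD hornerXn => /eqP; rewrite addr_eq0 => /eqP ->; rewrite (absN habs).
    rewrite horner_poly; apply: (abs_le_sum habs) => [|i _]; first by rewrite exprn_ge0 ?ltW.
    have [hl _] := hlift p1`_i.
    rewrite (absM habs) (absX habs) -[leRHS]mul1r ler_pM ?(abs_ge0 habs) ?exprn_ge0 ?(ltW x0) //.
    by rewrite ler_weXn2l ?(ltW h) // -ltnS prednK.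
  rewrite (absX habs) leNgt -{2}(prednK n0) exprS -[X in X < _]mul1r ltr_pM2r ?h //.
  by rewrite exprn_gt0.
have hx2 : reduces_to1 x (red x) by [].
have fP : is_form n P by rewrite /is_form sP.
have fp1 : is_form n p1 by rewrite /is_form sp1.
exists (red x); have [_] := reduces_horner fP fp1 hP hx2.
rewrite hx red0 hornerZ => /esym /eqP.
by rewrite mulf_eq0 (negbTE lc0).
Qed.

End Reduction.

(** * Cartan decomposition and norms of conjugates *)

Section ReductionAndCost.
Variables (K : closedFieldType) (R : realType) (absK : K -> R).
Hypothesis habs : nonarch_abs absK.
Variables (k : fieldType) (red : K -> k).
Hypothesis hres : residue_map absK red.

Notation nrm := (nrm absK).
Notation reduces2 := (reduces2 absK red).
Notation reduces_to1 := (reduces_to1 absK red).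

Definition redp (p : {poly K}) : {poly k} := \poly_(i < size p) red p`_i.

Lemma coef_redp p i : (redp p)`_i = red p`_i.
Proof.
rewrite coef_poly; case: ltnP => // h.
by rewrite nth_default // (red0 habs hres).
Qed.

Lemma exists_reduction D w : is_form2 D w -> nrm D w <= 1 -> exists w', reduces2 w w'.
Proof.
move=> /andP[/formP f1 /formP f2] h; have [h1 h2] := nrm_ge absK D w.
exists (redp w.1, redp w.2); split => i; rewrite coef_redp; split=> //.
  case: (leqP i D) => hi; first exact: le_trans (h1 i hi) h.
  by rewrite f1 // (abs0 habs) ler01.
case: (leqP i D) => hi; first exact: le_trans (h2 i hi) h.
by rewrite f2 // (abs0 habs) ler01.
Qed.

Lemma nrm_reduces_le D w w' : reduces2 w w' -> nrm D w <= 1.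
Proof. by case=> h1 h2; apply: nrm_le => i _; [case: (h1 i)|case: (h2 i)]. Qed.

Lemma nrm_reduces_lt D w : reduces2 w 0 -> nrm D w < 1.
Proof.
case=> h1 h2; apply: nrm_lt => i _.
  by have [h e] := h1 i; apply/(red0P hres h); rewrite e coef0.
by have [h e] := h2 i; apply/(red0P hres h); rewrite e coef0.
Qed.

Lemma abs_reduces_eq1 x x' : reduces_to1 x x' -> x' != 0 -> absK x = 1.
Proof.
move=> [h <-] hx; apply/eqP; rewrite eq_le h leNgt /=; apply/negP => h'.
by case/eqP: hx; apply/(red0P hres h).
Qed.

Lemma reduces_form D p p' : reduces_to absK red p p' -> is_form D p -> is_form D p'.
Proof.
move=> h /formP hp; apply/formP => i hi; have [_ <-] := h i.
by rewrite hp // (red0 habs hres).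
Qed.

Lemma nrm_reduces_eq1 D w w' : is_form2 D w -> reduces2 w w' -> w' != 0 -> nrm D w = 1.
Proof.
move=> /andP[f1 f2] hw w0; apply/eqP; rewrite eq_le (nrm_reduces_le D hw) leNgt /=.
apply/negP => h; have [h1 h2] := nrm_ge absK D w; case: hw => r1 r2.
have z p p' : is_form D p -> reduces_to absK red p p' ->
    (forall i, (i <= D)%N -> absK p`_i <= nrm D w) -> p' = 0.
  move=> fp rp hp; apply/polyP => i; rewrite coef0; case: (leqP i D) => hi.
    by have [hp1 <-] := rp i; apply/(red0P hres hp1); apply: le_lt_trans (hp i hi) h.
  by have /formP -> := reduces_form rp fp.
by case/eqP: w0; rewrite (surjective_pairing w') (z _ _ f1 r1 h1) (z _ _ f2 r2 h2).
Qed.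

(** Normalization divides by one chosen coefficient of maximal absolute value, so [hred] agrees with
    another reduction only up to the residue of a unit. *)
Lemma hred_scale D c v v' : c != 0 -> is_form2 D v -> reduces2 v v' -> v' != 0 ->
  exists2 a, a != 0 & hred absK red D (scale_pair c v) = scale_pair a v'.
Proof.
move=> c0 hv hr v0; have n1 := nrm_reduces_eq1 hv hr v0.
pose c1 := norm_const absK D (scale_pair c v).
have hc1 : absK c1 = absK c by rewrite -/(nrm D _) (nrm_scale habs) n1 mulr1.
have c10 : c1 != 0 by rewrite -(abs_eq0 habs) hc1 (abs_eq0 habs).
have hu : absK (c1^-1 * c) = 1.
  by rewrite (absM habs) (absV habs) hc1 mulVf // (abs_eq0 habs).
have ru : reduces_to1 (c1^-1 * c) (red (c1^-1 * c)) by split; rewrite ?hu.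
exists (red (c1^-1 * c)).
  by apply/eqP => h; have := (red0P hres (proj1 ru)).1 h; rewrite hu ltxx.
case/andP: hv => f1 f2; case: hr => r1 r2.
rewrite /hred /normalize -/c1; congr pair; apply/polyP => i; rewrite coef_poly !coefZ.
  case: ltnP => hi; first by rewrite mulrA; have [_ ->] := reduces1M habs hres ru (r1 i).
  by have /formP -> := reduces_form r1 f1; rewrite ?mulr0.
case: ltnP => hi; first by rewrite mulrA; have [_ ->] := reduces1M habs hres ru (r2 i).
by have /formP -> := reduces_form r2 f2; rewrite ?mulr0.
Qed.

Lemma exists_normalization D w : is_form2 D w -> w != 0 ->
  exists c v v', [/\ c != 0, w = scale_pair c v, is_form2 D v, reduces2 v v' & v' != 0].
Proof.
move=> hw w0; pose c := norm_const absK D w.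
have c0 : c != 0 by rewrite -(abs_gt0 habs); apply: (nrm_gt0 habs).
have hv : is_form2 D (scale_pair c^-1 w).
  by case/andP: hw => h1 h2; rewrite /is_form2 /= !is_formZ.
have hn : nrm D (scale_pair c^-1 w) = 1.
  by rewrite (nrm_scale habs) (absV habs) mulVf // (abs_eq0 habs).
have hn1 : nrm D (scale_pair c^-1 w) <= 1 by rewrite hn.
have [v' hv'] := exists_reduction hv hn1.
exists c, (scale_pair c^-1 w), v'; split=> //.
  by rewrite /scale_pair /= !scalerA mulfV // !scale1r; case: (w).
apply/eqP => v0; rewrite v0 in hv'.
by have := nrm_reduces_lt D hv'; rewrite hn ltxx.
Qed.

Definition intmx (M : 'M[K]_2) : Prop := forall i j, absK (M i j) <= 1.

Lemma intmxM M N : intmx M -> intmx N -> intmx (M *m N).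
Proof.
move=> hM hN i j; rewrite mxE; apply: (abs_le_sum habs) => [|l _]; first exact: ler01.
by rewrite (absM habs) mulr_ile1 ?(abs_ge0 habs).
Qed.

Lemma intmx22 a b c e : absK a <= 1 -> absK b <= 1 -> absK c <= 1 -> absK e <= 1 ->
  intmx (mx22 a b c e).
Proof. by move=> *; move=> i j; rewrite mxE; case: ifP; case: ifP. Qed.

Lemma intmx_reduces M : intmx M -> forall i j, reduces_to1 (M i j) (map_mx red M i j).
Proof. by move=> hM i j; rewrite mxE. Qed.

Lemma det_reduces (M : 'M[K]_2) (M' : 'M[k]_2) : (forall i j, reduces_to1 (M i j) (M' i j)) ->
  reduces_to1 (\det M) (\det M').
Proof.
move=> h; rewrite !det2; apply: (reduces1D habs hres); first exact: (reduces1M habs hres).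
by apply: (reduces1N habs hres); apply: (reduces1M habs hres).
Qed.

Lemma is_form2_scale D (F : comNzRingType) (c : F) (w : {poly F} * {poly F}) : is_form2 D w -> is_form2 D (scale_pair c w).
Proof. by case/andP => h1 h2; rewrite /is_form2 !is_formZ. Qed.

Lemma nrm_hconj_le D V w : is_form2 D w -> intmx V -> nrm D (hconj D V w) <= nrm D w.
Proof.
move=> hw hV; have [->|w0] := eqVneq w 0.
  have e0 : 0 = scale_pair 0 (0 : {poly K} * {poly K}) by rewrite /scale_pair !scale0r.
  by rewrite e0 hconj_scale !(nrm_scale habs) (abs0 habs) !mul0r.
have [c [v [v' [c0 -> hv hr v0]]]] := exists_normalization hw w0.
rewrite hconj_scale !(nrm_scale habs) ler_wpM2l ?(abs_ge0 habs) //.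
rewrite (nrm_reduces_eq1 hv hr v0).
by apply: nrm_reduces_le; apply: (reduces2_hconj habs hres D (intmx_reduces hV) hr).
Qed.

Lemma cartan_max (M : 'M[K]_2) : \det M != 0 ->
  (forall i j, absK (M i j) <= absK (M ord_max ord_max)) ->
  exists U V a e, [/\ intmx U /\ \det U = 1, intmx V /\ absK (\det V) = 1,
    M *m V = U *m mx22 a 0 0 e & absK a <= absK e].
Proof.
rewrite (mx22_eta M); move: (M ord0 ord0) (M ord0 ord_max) (M ord_max ord0) (M ord_max ord_max) => a b c e.
rewrite det_mx22 => hdet hmax.
have hb := hmax ord0 ord_max; have hc := hmax ord_max ord0; have ha := hmax ord0 ord0.
rewrite !mxE /= in ha hb hc.
have e0 : e != 0.
  apply: contraNneq hdet => e0; rewrite e0 (abs0 habs) in hb.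
  have /eqP -> : b == 0 by rewrite -(abs_eq0 habs) eq_le hb (abs_ge0 habs).
  by rewrite e0 mulr0 mul0r subr0.
have pe : 0 < absK e by rewrite (abs_gt0 habs).
have h1 : absK 1 <= 1 by rewrite (abs1 habs).
have h0 : absK 0 <= 1 by rewrite (abs0 habs) ler01.
have div x : absK x <= absK e -> absK (x / e) <= 1.
  by move=> h; rewrite (absM habs) (absV habs) ler_pdivrMr ?mul1r.
exists (mx22 1 (b / e) 0 1), (mx22 1 0 (- (c / e)) 1), (a - b * c / e), e; split.
- by rewrite det_mx22 mulr1 mulr0 subr0; split=> //; apply: intmx22; rewrite ?div.
- rewrite det_mx22 mulr1 mul0r subr0; split; rewrite ?(abs1 habs) //.
  by apply: intmx22; rewrite ?(absN habs) ?div.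
- by rewrite !mul_mx22; congr mx22; field.
apply: (abs_leD habs) => //; rewrite (absN habs) -mulrA (absM habs) -[leRHS]mulr1.
by rewrite ler_pM ?(abs_ge0 habs) ?div.
Qed.

(** Swaps of rows and columns bring an entry of maximal absolute value to the corner, where it
    serves as pivot. The left factor must have determinant exactly 1, as its reduction has to lie in
    SL_2, hence the signed swap [S]; on the right a unit determinant is enough, and [P] will do. *)
Lemma cartan (M : 'M[K]_2) : \det M != 0 ->
  exists U V a e, [/\ intmx U /\ \det U = 1, intmx V /\ absK (\det V) = 1,
    M *m V = U *m mx22 a 0 0 e & absK a <= absK e].
Proof.
move=> hdet.
have h1 : absK 1 <= 1 by rewrite (abs1 habs).
have h0 : absK 0 <= 1 by rewrite (abs0 habs) ler01.
have hN1 : absK (-1) <= 1 by rewrite (absN habs).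
suff [U0 [V0 [M' [hU0 [hV0 [eM hmax]]]]]] : exists U0 V0 M',
    (intmx U0 /\ \det U0 = 1) /\ (intmx V0 /\ absK (\det V0) = 1) /\
    M *m V0 = U0 *m M' /\ forall i j, absK (M' i j) <= absK (M' ord_max ord_max).
  have hM' : \det M' != 0.
    have := congr1 (fun A => absK (\det A)) eM; rewrite !det_mulmx !(absM habs).
    rewrite (proj2 hU0) (proj2 hV0) (abs1 habs) mulr1 mul1r => e.
    by rewrite -(abs_eq0 habs) -e (abs_eq0 habs).
  have [U [V [a [e [[iU dU] [iV dV] eq le]]]]] := cartan_max hM' hmax.
  exists (U0 *m U), (V0 *m V), a, e; split => //.
  - by split; [apply: intmxM => //; case: hU0|rewrite det_mulmx (proj2 hU0) dU mulr1].
  - split; first by apply: intmxM => //; case: hV0.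
    by rewrite det_mulmx (absM habs) (proj2 hV0) dV mulr1.
  by rewrite mulmxA eM -!mulmxA eq.
pose I2 := mx22 (1 : K) 0 0 1; pose P := mx22 (0 : K) 1 1 0; pose S := mx22 (0 : K) 1 (-1) 0.
have iI : intmx I2 by apply: intmx22.
have iP : intmx P by apply: intmx22.
have iS : intmx S by apply: intmx22.
have dI : \det I2 = 1 by rewrite det_mx22; ring.
have dP : absK (\det P) = 1 by rewrite det_mx22 mul0r sub0r mul1r (absN habs) (abs1 habs).
have dS : \det S = 1 by rewrite det_mx22; ring.
have dI' : absK (\det I2) = 1 by rewrite dI (abs1 habs).
rewrite (mx22_eta M); move: (M ord0 ord0) (M ord0 ord_max) (M ord_max ord0) (M ord_max ord_max) => a b c e.
have maxE (x y z t : K) : absK x <= absK t -> absK y <= absK t -> absK z <= absK t ->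
    forall i j, absK (mx22 x y z t i j) <= absK (mx22 x y z t ord_max ord_max).
  by move=> hx hy hz i j; rewrite !mxE /=; case: ifP; case: ifP.
case: (leP (absK a) (absK b)) => hab; case: (leP (absK c) (absK e)) => hce.
- case: (leP (absK b) (absK e)) => hbe.
    exists I2, I2, (mx22 a b c e); do 3!split=> //; first by rewrite !mul_mx22; congr mx22; ring.
    by apply: maxE => //; apply: le_trans hab hbe.
  exists S, I2, (mx22 (- c) (- e) a b); do 3!split=> //; first by rewrite !mul_mx22; congr mx22; ring.
  by apply: maxE; rewrite ?(absN habs) // ?(ltW hbe) // (le_trans hce) // ltW.
- case: (leP (absK b) (absK c)) => hbc.
    exists I2, P, (mx22 b a e c); do 3!split=> //; first by rewrite !mul_mx22; congr mx22; ring.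
    by apply: maxE; rewrite // ?(ltW hce) // (le_trans hab).
  exists S, I2, (mx22 (- c) (- e) a b); do 3!split=> //; first by rewrite !mul_mx22; congr mx22; ring.
  by apply: maxE; rewrite ?(absN habs) // ?(ltW hbc) // (le_trans (ltW hce)) // ltW.
- case: (leP (absK a) (absK e)) => hae.
    exists I2, I2, (mx22 a b c e); do 3!split=> //; first by rewrite !mul_mx22; congr mx22; ring.
    by apply: maxE => //; apply: le_trans (ltW hab) hae.
  exists S, P, (mx22 (- e) (- c) b a); do 3!split=> //; first by rewrite !mul_mx22; congr mx22; ring.
  by apply: maxE; rewrite ?(absN habs) // ?(ltW hae) ?(ltW hab) // (le_trans hce) // ltW.
case: (leP (absK a) (absK c)) => hac.
  exists I2, P, (mx22 b a e c); do 3!split=> //; first by rewrite !mul_mx22; congr mx22; ring.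
  by apply: maxE; rewrite // ?(ltW hce) // (le_trans (ltW hab)).
exists S, P, (mx22 (- e) (- c) b a); do 3!split=> //; first by rewrite !mul_mx22; congr mx22; ring.
by apply: maxE; rewrite ?(absN habs) // ?(ltW hac) ?(ltW hab) // (le_trans (ltW hce)) // ltW.
Qed.

Lemma pow_balance (x y : R) j n : 0 <= x -> x <= y -> (j.*2 <= n)%N ->
  (x * y) ^+ n <= (x ^+ j * y ^+ (n - j)) ^+ 2.
Proof.
move=> x0 xy hj; have y0 := le_trans x0 xy.
have -> : (x * y) ^+ n = x ^+ j.*2 * y ^+ n * x ^+ (n - j.*2).
  by rewrite exprMn -{1}(subnKC hj) exprD; ring.
have -> : (x ^+ j * y ^+ (n - j)) ^+ 2 = x ^+ j.*2 * y ^+ n * y ^+ (n - j.*2).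
  rewrite exprMn -!exprM !muln2 -mulrA -exprD; congr (_ * _ ^+ _).
  by move: hj; clear; lia.
by rewrite ler_wpM2l ?mulr_ge0 ?exprn_ge0 // lerXn2r ?nnegrE.
Qed.

Lemma not_unstable_coef (F : fieldType) D (w : {poly F} * {poly F}) : is_form2 D w ->
  ~ unstable D w ->
  (exists i, [/\ (i <= D)%N, (i.*2 <= D.+1)%N & w.1`_i != 0]) \/
  (exists i, [/\ (i <= D)%N, (i.*2 < D)%N & w.2`_i != 0]).
Proof.
move=> /andP[/formP f1 /formP f2] h; apply: contrapT => /not_orP[h1 h2]; apply: h; split=> i hi.
  apply/eqP; apply: contrapT => /negP hne; apply: h1; exists i; split => //.
  by rewrite leqNgt; apply: contra hne => hi'; rewrite f1.
apply/eqP; apply: contrapT => /negP hne; apply: h2; exists i; split => //.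
by rewrite leqNgt; apply: contra hne => hi'; rewrite f2.
Qed.

(** A reduction that is not unstable leaves a coefficient of absolute value 1 and nonpositive
    weight; as |a| <= |e|, conjugation multiplies its absolute value by at least |ae|^((D+1)/2). *)
Lemma nrm_diag_ge D v v' a e : is_form2 D v -> reduces2 v v' -> ~ unstable D v' ->
  absK a <= absK e -> absK (a * e) ^+ D.+1 <= nrm D (hconj D (mx22 a 0 0 e) v) ^+ 2.
Proof.
move=> hv [r1 r2] hns hae; have [h1 h2] := nrm_ge absK D (hconj D (mx22 a 0 0 e) v).
have hv' : is_form2 D v' by case/andP: hv => *; apply/andP; split; [apply: (reduces_form r1)|apply: (reduces_form r2)].
have n0 := nrm_ge0 habs D (hconj D (mx22 a 0 0 e) v).
rewrite (absM habs); case: (not_unstable_coef hv' hns) => [] [i [hiD hi hne]].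
  apply: le_trans (pow_balance (abs_ge0 habs a) hae hi) _.
  rewrite lerXn2r ?nnegrE ?mulr_ge0 ?exprn_ge0 ?(abs_ge0 habs) //.
  apply: le_trans (h1 i hiD); rewrite coef_hconj_diag1 // !(absM habs) !(absX habs).
  by rewrite (abs_reduces_eq1 (r1 i) hne) mul1r subSn // exprS mulrCA.
have hi' : (i.+1.*2 <= D.+1)%N by rewrite doubleS ltnS.
apply: le_trans (pow_balance (abs_ge0 habs a) hae hi') _.
rewrite lerXn2r ?nnegrE ?mulr_ge0 ?exprn_ge0 ?(abs_ge0 habs) //.
apply: le_trans (h2 i hiD); rewrite coef_hconj_diag2 // !(absM habs) !(absX habs).
by rewrite (abs_reduces_eq1 (r2 i) hne) mul1r subSS exprS mulrA.
Qed.

(* Cartan decomposition reduces the general case to diagonal matrices. *)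
Lemma nrm_hconj_ge D w w' M : is_form2 D w -> reduces2 w w' ->
  (forall g, \det g = 1 -> ~ unstable D (hconj D g w')) -> \det M != 0 ->
  absK (\det M) ^+ D.+1 <= nrm D (hconj D M w) ^+ 2.
Proof.
move=> hw hr hns hM; have [U [V [a [e [[iU dU] [iV dV] eq hae]]]]] := cartan hM.
have -> : absK (\det M) = absK (a * e).
  have := congr1 (fun A => absK (\det A)) eq; rewrite !det_mulmx det_mx22 !(absM habs) dV dU.
  by rewrite mulr1 (abs1 habs) mul1r mul0r subr0 (absM habs).
apply: le_trans (_ : nrm D (hconj D (M *m V) w) ^+ 2 <= _); last first.
  by rewrite lerXn2r ?nnegrE ?(nrm_ge0 habs) // hconjM nrm_hconj_le // is_form_hconj.
have hU := reduces2_hconj habs hres D (intmx_reduces iU) hr.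
have dU' : \det (map_mx red U) = 1.
  have [_ <-] := det_reduces (intmx_reduces iU); rewrite dU.
  by have [_ ->] := reduces1_1 habs hres.
by rewrite eq hconjM; apply: (nrm_diag_ge (is_form_hconj _ _ _) hU (hns _ dU') hae).
Qed.

Hypothesis hnontriv : nontrivial_abs absK.

Lemma exists_small : exists x, 0 < absK x /\ absK x < 1.
Proof.
have [x [x0 x1]] := hnontriv; have px : 0 < absK x by rewrite lt_neqAle eq_sym x0 (abs_ge0 habs).
have [h|h] := ltP (absK x) 1; first by exists x.
exists x^-1; rewrite (absV habs) invr_gt0 px invf_lt1 //.
by rewrite lt_neqAle eq_sym x1 h.
Qed.

Lemma exists_small_bound (s : seq K) : (forall x, x \in s -> absK x < 1) ->
  exists z, [/\ 0 < absK z, absK z < 1 & forall x, x \in s -> absK x <= absK z].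
Proof.
elim: s => [|y s IH] hs.
  by have [z [h1 h2]] := exists_small; exists z.
have [|z [h1 h2 h3]] := IH; first by move=> x hx; apply: hs; rewrite inE hx orbT.
have [h|h] := leP (absK y) (absK z).
  by exists z; split=> // x; rewrite inE => /orP[/eqP->|/h3].
exists y; split; first exact: lt_trans h.
  by apply: hs; rewrite mem_head.
move=> x; rewrite inE => /orP[/eqP->//|/h3 hx]; exact: le_trans hx (ltW h).
Qed.

Lemma not_unstable_of_min D w w' : is_form2 D w -> reduces2 w w' ->
  (forall M, \det M != 0 -> absK (\det M) ^+ D.+1 <= nrm D (hconj D M w) ^+ 2) ->
  forall g, \det g = 1 -> ~ unstable D (hconj D g w').
Proof.
move=> hw hr hmin g dg [u1 u2].
have [lift hlift] := boolp.choice (exists_lift hres).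
pose U : 'M[K]_2 := \matrix_(i, j) lift (g i j).
have hU i j : reduces_to1 (U i j) (g i j) by rewrite mxE.
have dU : absK (\det U) = 1.
  by apply: (abs_reduces_eq1 (det_reduces hU)); rewrite dg oner_eq0.
have [r1 r2] := reduces2_hconj habs hres D hU hr; set v := hconj D U w in r1 r2.
pose s := [seq v.1`_i | i <- iota 0 D.+1 & (i.*2 <= D.+1)%N] ++
          [seq v.2`_i | i <- iota 0 D.+1 & (i.*2 < D)%N].
have [|z [z0 z1 hz]] := @exists_small_bound s.
  move=> x; rewrite mem_cat => /orP[] /mapP[i]; rewrite mem_filter => /andP[hi _] ->.
    by have [h e] := r1 i; apply/(red0P hres h); rewrite e u1.
  by have [h e] := r2 i; apply/(red0P hres h); rewrite e u2.
(* With |t|^(D+1) = |z| every coefficient drops below |z|^(1/2), the bound for the cheaper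
   conjugate: those that reduce to zero are at most |z|, and the others gain a factor |t|^j with 2j
   > D + 1. *)
have [t ht] := @exists_root K D.+1 z isT.
have tD : absK t ^+ D.+1 = absK z by rewrite -(absX habs) ht.
have t0 : 0 <= absK t by apply: abs_ge0.
have t1 : absK t < 1.
  by rewrite -(@expr_lt1 R D.+1) // tD.
have tp : 0 < absK t.
  by rewrite (abs_gt0 habs); apply: contraTneq z0 => t00; rewrite -tD t00 (abs0 habs) expr0n ltxx.
have dM : absK (\det (U *m mx22 t 0 0 1)) = absK t.
  by rewrite det_mulmx (absM habs) dU mul1r det_mx22 mulr1 mul0r subr0.
have := hmin (U *m mx22 t 0 0 1); rewrite -(abs_eq0 habs) dM gt_eqF // => /(_ isT).
rewrite tD hconjM -/v leNgt => /negP; apply.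
have sq (x : R) : 0 <= x -> x <= absK z -> x ^+ 2 < absK z.
  move=> x0 hx; apply: le_lt_trans (_ : absK z * absK z < _); first by rewrite expr2 ler_pM.
  by rewrite -[ltRHS]mulr1 ltr_pM2l.
have pw (x : R) j : 0 <= x -> x <= 1 -> (D.+1 < j.*2)%N -> (x * absK t ^+ j) ^+ 2 < absK z.
  move=> x0 x1 hj; apply: le_lt_trans (_ : absK t ^+ D.+2 < _); last first.
    by rewrite exprS tD -[ltRHS]mul1r ltr_pM2r.
  rewrite exprMn -exprM muln2 -[leRHS]mul1r ler_pM ?exprn_ge0 //; first by rewrite exprn_ile1.
  by rewrite ler_wiXn2l // ltW.
have hs1 i : (i <= D)%N -> (i.*2 <= D.+1)%N -> absK v.1`_i <= absK z.
  by move=> hi hi2; apply: hz; rewrite mem_cat map_f // mem_filter hi2 mem_iota.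
have hs2 i : (i <= D)%N -> (i.*2 < D)%N -> absK v.2`_i <= absK z.
  by move=> hi hi2; apply: hz; rewrite mem_cat orbC map_f // mem_filter hi2 mem_iota.
have tn n : absK t ^+ n <= 1 by rewrite exprn_ile1 // ltW.
have nind (P : R -> Prop) : (forall i, (i <= D)%N -> P (absK (hconj D (mx22 t 0 0 1) v).1`_i)) ->
    (forall i, (i <= D)%N -> P (absK (hconj D (mx22 t 0 0 1) v).2`_i)) ->
    P (nrm D (hconj D (mx22 t 0 0 1) v)).
  move=> h1 h2; rewrite /nrm /norm_const {1}/hcoefs.
  by case: fintype.split => j; [apply: h1|apply: h2]; rewrite -ltnS.
apply: (nind (fun x => x ^+ 2 < absK z)) => i hi.
  rewrite coef_hconj_diag1 // mul1r expr1n mulr1 (absM habs) (absX habs).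
  have [h|h] := leqP i.*2 D.+1; last by apply: pw => //; [apply: abs_ge0|case: (r1 i)].
  apply: sq; first by rewrite mulr_ge0 ?exprn_ge0 ?(abs_ge0 habs).
  by rewrite -[leRHS]mulr1 ler_pM ?exprn_ge0 ?(abs_ge0 habs) ?hs1.
rewrite coef_hconj_diag2 // expr1n mulr1 mulrCA -exprS (absM habs) (absX habs).
have [h|h] := ltnP i.*2 D.
  apply: sq; first by rewrite mulr_ge0 ?exprn_ge0 ?(abs_ge0 habs).
  by rewrite -[leRHS]mulr1 ler_pM ?exprn_ge0 ?(abs_ge0 habs) ?hs2.
by apply: pw; [apply: abs_ge0|case: (r2 i)|rewrite doubleS ltnS ltnS].
Qed.

End ReductionAndCost.

Lemma exists_min_seq (R : realType) (T : eqType) (s : seq T) (f : T -> R) : s != [::] ->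
  exists2 x, x \in s & forall y, y \in s -> f x <= f y.
Proof.
elim: s => // a [|b s] IH _.
  by exists a; rewrite ?mem_head // => y; rewrite inE => /eqP->.
have [x hx hmin] := IH isT; have [h|h] := leP (f x) (f a).
  by exists x => [|y]; rewrite in_cons ?hx ?orbT // => /orP[/eqP->|/hmin].
exists a; rewrite ?mem_head // => y; rewrite in_cons => /orP[/eqP->|/hmin] //.
exact: le_trans (ltW h).
Qed.

(** * The cost as a function of discs *)

Section MinimalConjugate.
Variables (K : closedFieldType) (R : realType) (absK : K -> R).
Hypothesis habs : nonarch_abs absK.
Variables (k : fieldType) (red : K -> k).
Hypothesis hres : residue_map absK red.

Notation nrm := (nrm absK).
Implicit Types (M V : 'M[K]_2) (D : nat) (w : {poly K} * {poly K}).

Definition cost D w M : R := nrm D (hconj D M w) ^+ 2 / absK (\det M) ^+ D.+1.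

Lemma cost_scale D w c M : c != 0 -> cost D w (c *: M) = cost D w M.
Proof.
move=> c0; rewrite /cost hconj_scalemx (nrm_scale habs) detZ !(absM habs) !(absX habs).
have h : absK c != 0 by rewrite (abs_eq0 habs).
have e : (absK c ^+ 2) ^+ D.+1 = (absK c ^+ D.+1) ^+ 2 by rewrite -!exprM mulnC.
rewrite [(_ * nrm _ _) ^+ 2]exprMn [(_ * absK (\det M)) ^+ _]exprMn e invfM mulrACA mulfV ?mul1r //.
by rewrite !expf_neq0.
Qed.

Lemma nrm_hconj_unit D w V : is_form2 D w -> intmx absK V -> absK (\det V) = 1 ->
  nrm D (hconj D V w) = nrm D w.
Proof.
move=> hw iV dV; apply: le_anti; rewrite (nrm_hconj_le habs hres) //=.
have d0 : \det V != 0 by rewrite -(abs_eq0 habs) dV oner_eq0.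
pose V' := (\det V)^-1 *: mx22 (V ord_max ord_max) (- V ord0 ord_max) (- V ord_max ord0) (V ord0 ord0).
have iV' : intmx absK V'.
  rewrite /V' scale_mx22; apply: intmx22;
    by rewrite (absM habs) (absV habs) dV invr1 mul1r ?(absN habs).
have VV' : V *m V' = 1%:M.
  rewrite /V' -scalemxAr [X in X *m _]mx22_eta mul_mx22 scale_mx22.
  apply/matrixP => i j; rewrite !mxE -(mulVf d0) det2.
  by case: (unliftP ord0 i) => [i' ->|->]; case: (unliftP ord0 j) => [j' ->|->];
    rewrite ?(ord1 i') ?(ord1 j') /= ?mulr1n ?mulr0n; ring.
rewrite -{1}(hconj1 hw) -VV' hconjM (nrm_hconj_le habs hres) //.
exact: is_form_hconj.
Qed.

Lemma cost_gl D w M V : intmx absK V -> absK (\det V) = 1 ->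
  cost D w (M *m V) = cost D w M.
Proof.
move=> iV dV; rewrite /cost hconjM nrm_hconj_unit ?is_form_hconj //.
by rewrite det_mulmx (absM habs) dV mulr1.
Qed.

(** Together with [cost_gl] and [cost_scale] this makes the cost a function of discs: [mx22 r s 0 1]
    stands for the disc of center [s] and radius |r|, the image of the unit disc. *)
Lemma iwasawa M : \det M != 0 -> exists V c r s,
  [/\ intmx absK V, absK (\det V) = 1, c != 0, r != 0 & M *m V = c *: mx22 r s 0 1].
Proof.
have h1 : absK 1 <= 1 by rewrite (abs1 habs).
have h0 : absK 0 <= 1 by rewrite (abs0 habs) ler01.
have key (a b c e : K) : a * e - b * c != 0 -> absK c <= absK e ->
    exists V c' r s, [/\ intmx absK V, absK (\det V) = 1, c' != 0, r != 0 &
      mx22 a b c e *m V = c' *: mx22 r s 0 1].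
  move=> hdet hce; have e0 : e != 0.
    apply: contraNneq hdet => e0; rewrite e0 (abs0 habs) in hce.
    have /eqP -> : c == 0 by rewrite -(abs_eq0 habs) eq_le hce (abs_ge0 habs).
    by rewrite e0 !mulr0 subr0.
  exists (mx22 1 0 (- (c / e)) 1), e, ((a * e - b * c) / e ^+ 2), (b / e); split => //.
  - apply: intmx22 => //; rewrite (absN habs) (absM habs) (absV habs).
    by rewrite ler_pdivrMr ?mul1r // (abs_gt0 habs).
  - by rewrite det_mx22 mulr1 mul0r subr0 (abs1 habs).
  - by rewrite mulf_neq0 // invr_eq0 expf_neq0.
  by rewrite scale_mx22 mul_mx22; congr mx22; field.
rewrite (mx22_eta M); move: (M ord0 ord0) (M ord0 ord_max) (M ord_max ord0) (M ord_max ord_max) => a b c e.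
rewrite det_mx22 => hdet; have [h|h] := leP (absK c) (absK e); first exact: key.
have hdet' : b * c - a * e != 0 by rewrite -opprB oppr_eq0.
have [V [c' [r [s [iV dV c0 r0 eq]]]]] := key b a e c hdet' (ltW h).
exists (mx22 0 1 1 0 *m V), c', r, s; split => //.
- by apply: (intmxM habs) => //; apply: intmx22.
- by rewrite det_mulmx (absM habs) dV det_mx22 mul0r sub0r mul1r (absN habs) (abs1 habs) mulr1.
by rewrite mulmxA -eq mul_mx22; congr (mx22 _ _ _ _ *m _); ring.
Qed.

Lemma large_roots (h : {poly K}) : (forall x, root h x -> 1 <= absK x) ->
  forall i, absK h`_i <= absK h`_0.
Proof.
move=> hr; have [rs hrs] := closed_field_poly_normal h.
have [l0|l0] := eqVneq (lead_coef h) 0.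
  move=> i; have /eqP -> : h == 0 by rewrite -lead_coef_eq0 l0.
  by rewrite !coef0.
have {}hr : forall x, x \in rs -> 1 <= absK x.
  by move=> x hx; apply: hr; rewrite hrs rootZ // root_prod_XsubC.
have main : forall i, absK (\prod_(z <- rs) ('X - z%:P))`_i <= absK (\prod_(z <- rs) ('X - z%:P))`_0.
  elim: rs {hrs} hr => [|z rs IH] hr i.
    by rewrite !big_nil !coefC; case: i => //=; rewrite (abs0 habs) (abs_ge0 habs).
  have {}IH := IH (fun x hx => hr x (mem_behead (s := z :: rs) hx)).
  have hz := hr z (mem_head _ _); rewrite !big_cons !mulrBl !coefB !coefXM !coefCM /=.
  set q := \prod_(_ <- _) _ in IH *; rewrite sub0r (absN habs) (absM habs).
  have q0 : absK q`_0 <= absK z * absK q`_0 by rewrite -[leLHS]mul1r ler_wpM2r ?(abs_ge0 habs).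
  apply: (abs_leD habs); first by case: i => [|i] /=; rewrite ?(abs0 habs) ?mulr_ge0 ?(abs_ge0 habs) // (le_trans (IH i)).
  by rewrite (absN habs) (absM habs) ler_wpM2l ?(abs_ge0 habs).
by move=> i; rewrite hrs !coefZ !(absM habs) ler_wpM2l ?(abs_ge0 habs).
Qed.

Lemma reduces_no_zero_root (h : {poly K}) (h' : {poly k}) : reduces_to absK red h h' ->
  (forall x, root h x -> 1 <= absK x) -> h'`_0 = 0 -> h' = 0.
Proof.
move=> hr hroot h0; apply/polyP => i; rewrite coef0; have [le1 <-] := hr i.
apply/(red0P hres le1); apply: le_lt_trans (large_roots hroot i) _.
by have [le0 e0] := hr 0%N; apply/(red0P hres le0); rewrite e0.
Qed.

Lemma horner_hcomp_affine n (h : {poly K}) r s x : is_form n h ->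
  (hcomp n h (mxnum (mx22 r s 0 1)) (mxden (mx22 r s 0 1))).[x] = h.[r * x + s].
Proof.
move=> hh; set T := mx22 r s 0 1.
have e1 (f : {poly K}) y : is_form n f -> heval n f y 1 = f.[y].
  by move=> hf; rewrite heval_root ?oner_eq0 // expr1n mul1r divr1.
rewrite -e1 -?e1 //; last exact: is_form_comp1.
have := heval_hcomp n h x 1 (is_form_mxnum T) (is_form_mxden T); rewrite muln1 => ->.
by rewrite !heval_linear !mxE /= !mulr1 mul0r add0r.
Qed.

(* If the smallest disc around s meeting S is strictly larger than the disc of T(r,s), the
   reduction at that larger disc has neither a pole nor a fixed point in the residue
   class of s, so it is not unstable in that direction and moving there does not raise the cost. *)
Lemma cost_recenter D w (S : seq K) r s : (0 < D)%N -> is_form2 D w -> w != 0 -> S != [::] ->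
  (forall x, w.2 != 0 -> root w.2 x -> x \in S) ->
  (forall x, fixform w != 0 -> root (fixform w) x -> x \in S) -> r != 0 ->
  exists sigma r', [/\ sigma \in S, r' != 0 &
    cost D w (mx22 r' sigma 0 1) <= cost D w (mx22 r s 0 1)].
Proof.
move=> D0 hw w0 S0 hSg hSt r0.
have h1 : absK 1 <= 1 by rewrite (abs1 habs).
have h0 : absK 0 <= 1 by rewrite (abs0 habs) ler01.
have same r1 sigma : r1 != 0 -> absK (s - sigma) <= absK r1 ->
    cost D w (mx22 r1 sigma 0 1) = cost D w (mx22 r1 s 0 1).
  move=> r10 hle.
  have -> : mx22 r1 sigma 0 1 = mx22 r1 s 0 1 *m mx22 1 ((sigma - s) / r1) 0 1.
    by rewrite mul_mx22; congr mx22; field.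
  apply: cost_gl; last by rewrite det_mx22 mulr1 mulr0 subr0 (abs1 habs).
  apply: intmx22 => //; rewrite (absM habs) (absV habs) ler_pdivrMr ?(abs_gt0 habs) // mul1r.
  by rewrite -(absN habs) opprB.
have [sigma hS hmin] := exists_min_seq (fun x => absK (s - x)) S0.
have [hle|hgt] := leP (absK (s - sigma)) (absK r).
  by exists sigma, r; rewrite same.
pose q := s - sigma; have q0 : q != 0.
  by rewrite -(abs_gt0 habs); apply: le_lt_trans hgt; apply: (abs_ge0 habs).
exists sigma, q; split => //; rewrite same //.
have dT a b : \det (mx22 a b 0 1) = a :> K by rewrite det_mx22 mulr1 mulr0 subr0.
have -> : mx22 r s 0 1 = mx22 q s 0 1 *m mx22 (r / q) 0 0 1.
  by rewrite mul_mx22; congr mx22; field.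
rewrite /cost hconjM det_mulmx !dT.
have hconj0 : hconj D (mx22 q s 0 1) w != 0.
  apply: contraNneq w0 => z.
  have : hconj D (mx22 q s 0 1 *m mx22 q^-1 (- s / q) 0 1) w = 0.
    rewrite hconjM z; have -> : 0 = scale_pair 0 (0 : {poly K} * {poly K}) by rewrite /scale_pair !scale0r.
    by rewrite hconj_scale /scale_pair !scale0r.
  rewrite mul_mx22 (_ : mx22 _ _ _ _ = 1%:M) ?hconj1 // => [->//|].
  apply/matrixP => i j; rewrite !mxE.
  case: (unliftP ord0 i) => [i' ->|->]; case: (unliftP ord0 j) => [j' ->|->];
    rewrite ?(ord1 i') ?(ord1 j') /=; rewrite ?mulr1n ?mulr0n; by field.
have [c [v [v' [c0 eqv hv hr v0]]]] := exists_normalization habs hres (is_form_hconj _ _ _) hconj0.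
(* [sigma] is a point of [S] nearest to [s], at distance |q|. In the coordinate of the disc of
   radius |q| around [s], the finite poles and fixed points therefore all lie outside the open unit
   disc. *)
have big_root (h : {poly K}) n (h1' : {poly K}) a : a != 0 -> is_form n h -> h1' != 0 ->
    h1' = a *: hcomp n h (mxnum (mx22 q s 0 1)) (mxden (mx22 q s 0 1)) ->
    (forall x, h != 0 -> root h x -> x \in S) -> forall x, root h1' x -> 1 <= absK x.
  move=> a0 fh hn eqh hh x; rewrite eqh rootZ // /root horner_hcomp_affine // => hx.
  have hne : h != 0.
    by apply: contraNneq hn => h0'; rewrite eqh h0' hcomp0 scaler0.
  have := hmin _ (hh _ hne hx); rewrite -/q (_ : s - (q * x + s) = - (q * x)); last by ring.
  by rewrite (absN habs) (absM habs) -[leLHS]mulr1 ler_pM2l // (abs_gt0 habs).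
(* Instability would kill the constant coefficients of [v'.2] and of [fixform v']. Having no small
   roots, both forms would then reduce to zero by [reduces_no_zero_root], and so would [v']. *)
have hns : ~ unstable D v'.
  case=> u1 u2; have [r1 r2] := hr; have /andP[fw1 fw2] := hw.
  have ev2 : v.2 = (c^-1 * q) *: hcomp D w.2 (mxnum (mx22 q s 0 1)) (mxden (mx22 q s 0 1)).
    have T10 : mx22 q s 0 1 ord_max ord0 = 0 by rewrite mxE.
    have T00 : mx22 q s 0 1 ord0 ord0 = q by rewrite mxE.
    have := congr1 snd eqv; rewrite hconjE /= T10 T00 scale0r oppr0 add0r => e.
    by apply: (scalerI c0); rewrite -e scalerA mulrA mulfV // mul1r.
  have v2' : v'.2 = 0.
    have [z|hne] := eqVneq v.2 0.
      by apply/polyP => i; have [_ <-] := r2 i; rewrite z !coef0 (red0 habs hres).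
    apply: (reduces_no_zero_root r2); last by apply: u2; rewrite double0.
    by apply: (big_root w.2 D _ (c^-1 * q)) => //; rewrite mulf_neq0 ?invr_eq0.
  have rf : reduces_to absK red (fixform v) (fixform v').
    apply: (reducesD habs hres); [apply: (reducesM habs hres) => //; apply: (reduces_polyX habs hres)|exact: (reducesN habs hres)].
  have evf : fixform v = c^-1 *: hcomp D.+1 (fixform w) (mxnum (mx22 q s 0 1)) (mxden (mx22 q s 0 1)).
    rewrite -fixform_hconj // eqv /fixform /scale_pair /= -scalerAr -scalerBr scalerA mulVf // scale1r.
    by [].
  have : fixform v' = 0.
    have [z|hne] := eqVneq (fixform v) 0.
      by apply/polyP => i; have [_ <-] := rf i; rewrite z !coef0 (red0 habs hres).
    apply: (reduces_no_zero_root rf).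
      by apply: (big_root (fixform w) D.+1 _ c^-1) => //; rewrite ?invr_eq0 ?is_form_fixform.
    by rewrite /fixform coefB coefXM /= u1 ?subr0 // double0.
  rewrite /fixform v2' mulr0 sub0r => /eqP; rewrite oppr_eq0 => /eqP v1'.
  by case/eqP: v0; rewrite (surjective_pairing v') v1' v2'.
rewrite eqv hconj_scale !(nrm_scale habs) (nrm_reduces_eq1 habs hres hv hr v0) mulr1.
have hle : absK (r / q) <= absK 1.
  by rewrite (abs1 habs) (absM habs) (absV habs) ler_pdivrMr ?(abs_gt0 habs) // mul1r ltW.
have := nrm_diag_ge habs hres hv hr hns hle; rewrite mulr1 => hd.
rewrite (absM habs q) exprMn exprMn invfM mulrACA ler_peMr //.
  by rewrite mulr_ge0 ?exprn_ge0 ?invr_ge0 ?exprn_ge0 ?(abs_ge0 habs).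
by rewrite ler_pdivlMr ?mul1r // exprn_gt0 // (abs_gt0 habs) mulf_neq0 // invr_eq0.
Qed.

End MinimalConjugate.

(** * Existence of a minimal conjugate *)

Section MinimumAttained.
Variables (K : closedFieldType) (R : realType) (absK : K -> R).
Hypothesis habs : nonarch_abs absK.
Variables (k : fieldType) (red : K -> k).
Hypothesis hres : residue_map absK red.

Notation nrm := (nrm absK).
Notation cost := (cost absK).

Lemma ler_pow_inv (x y : R) n : (0 < n)%N -> 0 <= x -> 0 <= y -> (x ^+ n <= y ^+ n) = (x <= y).
Proof. by move=> n0 x0 y0; rewrite ler_pXn2r. Qed.

Lemma ler_monom_ratio (a y r : R) n m : 0 <= y -> 0 <= r ->
  ((m <= n.*2)%N /\ y <= r) \/ ((n.*2 <= m)%N /\ r <= y) ->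
  (a * y ^+ n) ^+ 2 * r ^+ m <= (a * r ^+ n) ^+ 2 * y ^+ m.
Proof.
move=> y0 r0 h; rewrite [(a * y ^+ n) ^+ 2]exprMn [(a * r ^+ n) ^+ 2]exprMn -!exprM !muln2 -2!(mulrA (a ^+ 2)).
apply: ler_wpM2l; first exact: sqr_ge0.
case: h => [[hm yr]|[hm ry]]; rewrite -(subnK hm) !exprD.
  rewrite -!mulrA [r ^+ m * _]mulrC ler_wpM2r ?mulr_ge0 ?exprn_ge0 //.
  by rewrite lerXn2r ?nnegrE.
rewrite mulrCA [leRHS]mulrCA [r ^+ n.*2 * _]mulrC ler_wpM2r ?mulr_ge0 ?exprn_ge0 //.
by rewrite lerXn2r ?nnegrE.
Qed.

(* A maximum of monomials |x_i| rho^(n_i), divided by rho^(m/2), is piecewise monotone in rho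
   and can be decreased by moving to a crossing point of two monomials. *)
Lemma crossing_candidates (I : finType) (n : I -> nat) (x : I -> K) m :
  (exists i, x i != 0 /\ ((n i).*2 < m)%N) -> (exists i, x i != 0 /\ (m < (n i).*2)%N) ->
  exists C : seq K, (forall y, y \in C -> y != 0) /\
    forall r, r != 0 -> exists2 y, y \in C & exists i,
      (forall j, absK (x j) * absK y ^+ n j <= absK (x i) * absK y ^+ n i) /\
      (absK (x i) * absK y ^+ n i) ^+ 2 * absK r ^+ m <=
      (absK (x i) * absK r ^+ n i) ^+ 2 * absK y ^+ m.
Proof.
move=> [il [xl nl]] [ih [xh nh]].
pose ok (p : I * I) := [&& x p.1 != 0, x p.2 != 0 & (n p.2 < n p.1)%N].
(* A point of [K] whose absolute value is the crossing radius of the two monomials; algebraic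
   closedness provides it, so that it can serve as a matrix entry. Pairs that are not [ok] get a
   junk value. *)
have cand (p : I * I) : exists y, ok p -> y != 0 /\ y ^+ (n p.1 - n p.2) = x p.2 / x p.1.
  case: (boolP (ok p)) => [/and3P[h1 h2 h3]|]; last by exists 0.
  have e0 : (0 < n p.1 - n p.2)%N by rewrite subn_gt0.
  have [y hy] := exists_root (x p.2 / x p.1) e0; exists y => _; split=> //.
  apply: contra_eq_neq hy => ->; rewrite expr0n gtn_eqF // eq_sym mulf_neq0 // invr_eq0 //.
have {cand} [Y hY] := fin_all_exists cand.
exists [seq Y p | p <- enum [pred p | ok p]]; split.
  by move=> y /mapP[p]; rewrite mem_enum => /hY[h _] ->.
have memC p : ok p -> Y p \in [seq Y p | p <- enum [pred p | ok p]].
  by move=> hp; apply: map_f; rewrite mem_enum.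
have aY p : ok p -> absK (Y p) ^+ (n p.1 - n p.2) * absK (x p.1) = absK (x p.2).
  move=> hp; have [_ e] := hY p hp; rewrite -(absX habs) e -(absM habs) mulfVK //.
  by case/and3P: hp.
move=> r r0; have pr : 0 < absK r by rewrite (abs_gt0 habs).
have [i0 _ hact] : exists2 i, true & forall j, absK (x j) * absK r ^+ n j <= absK (x i) * absK r ^+ n i.
  have [i _ hmax] := @arg_maxP _ _ I il xpredT (fun i => absK (x i) * absK r ^+ n i) isT.
  by exists i => // j; apply: hmax.
have xi0 : x i0 != 0.
  rewrite -(abs_gt0 habs) -(pmulr_lgt0 _ (exprn_gt0 (n i0) pr)).
  by apply: lt_le_trans (hact il); rewrite mulr_gt0 ?exprn_gt0 ?(abs_gt0 habs).
have pxi : 0 < absK (x i0) by rewrite (abs_gt0 habs).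
have split_pow (z : R) a b : (a <= b)%N -> z ^+ b = z ^+ (b - a) * z ^+ a.
  by move=> h; rewrite -exprD subnK.
(* The exponent of the monomial active at [r] tells which way to move. If the quotient increases
   with the radius, shrink to the first crossing with a monomial of smaller exponent, which [il]
   guarantees; otherwise enlarge symmetrically, using [ih]. *)
have [hm|hm] := ltnP m (n i0).*2.
  have hil : ok (i0, il).
    by rewrite /ok /= xi0 xl -ltn_double (ltn_trans nl).
  have [j hj jmax] := @arg_maxP _ _ I il (fun j => ok (i0, j)) (fun j => absK (Y (i0, j))) hil.
  pose y := Y (i0, j); exists y; first exact: memC.
  have [y0 _] := hY _ hj; have py : 0 < absK y by rewrite (abs_gt0 habs).
  have hyr : absK y <= absK r.
    have /and3P[/= _ xj hn] := hj.
    rewrite -(@ler_pow_inv _ _ (n i0 - n j)) ?subn_gt0 ?(abs_ge0 habs) //.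
    rewrite -(ler_pM2r pxi) (aY _ hj) /= -(ler_pM2r (exprn_gt0 (n j) pr)).
    by apply: le_trans (hact j) _; rewrite mulrAC -split_pow ?(ltnW hn) // mulrC.
  exists i0; split => [j'|].
    have [z|xj'] := eqVneq (x j') 0.
      by rewrite z (abs0 habs) mul0r mulr_ge0 ?exprn_ge0 ?(abs_ge0 habs).
    have [hn|hn] := ltnP (n j') (n i0).
      have hj' : ok (i0, j') by rewrite /ok /= xi0 xj' hn.
      rewrite -(aY _ hj') /= (split_pow _ _ _ (ltnW hn)) [leRHS]mulrA.
      rewrite ler_pM2r ?exprn_gt0 // mulrC ler_pM2l // lerXn2r ?nnegrE ?(abs_ge0 habs) //.
      exact: jmax.
    rewrite (split_pow _ _ _ hn) mulrA ler_pM2r ?exprn_gt0 //.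
    have h := hact j'; rewrite (split_pow (absK r) _ _ hn) mulrA ler_pM2r ?exprn_gt0 // in h.
    apply: le_trans h; rewrite ler_wpM2l ?(abs_ge0 habs) // lerXn2r ?nnegrE ?(abs_ge0 habs) //.
  by apply: ler_monom_ratio; rewrite ?(abs_ge0 habs) //; left; rewrite ltnW.
have hih : ok (ih, i0).
  by rewrite /ok /= xi0 xh -ltn_double (leq_ltn_trans hm).
have [j hj jmin] := @arg_minP _ _ I ih (fun j => ok (j, i0)) (fun j => absK (Y (j, i0))) hih.
pose y := Y (j, i0); exists y; first exact: memC.
have [y0 _] := hY _ hj; have py : 0 < absK y by rewrite (abs_gt0 habs).
have hyr : absK r <= absK y.
  have /and3P[/= xj _ hn] := hj; have pxj : 0 < absK (x j) by rewrite (abs_gt0 habs).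
  rewrite -(@ler_pow_inv _ _ (n j - n i0)) ?subn_gt0 ?(abs_ge0 habs) //.
  rewrite -(ler_pM2r pxj) (aY _ hj) /= -(ler_pM2r (exprn_gt0 (n i0) pr)).
  by apply: le_trans (hact j); rewrite mulrAC -split_pow ?(ltnW hn) // mulrC.
exists i0; split => [j'|]; last first.
  by apply: ler_monom_ratio; rewrite ?(abs_ge0 habs) //; right.
have [z|xj'] := eqVneq (x j') 0.
  by rewrite z (abs0 habs) mul0r mulr_ge0 ?exprn_ge0 ?(abs_ge0 habs).
have [hn|hn] := ltnP (n i0) (n j').
  have hj' : ok (j', i0) by rewrite /ok /= xi0 xj' hn.
  rewrite (split_pow _ _ _ (ltnW hn)) -(aY _ hj') /= mulrA ler_pM2r ?exprn_gt0 // mulrC.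
  rewrite ler_wpM2r ?(abs_ge0 habs) // lerXn2r ?nnegrE ?(abs_ge0 habs) //.
  exact: jmin.
rewrite (split_pow _ _ _ hn) mulrA ler_pM2r ?exprn_gt0 //.
have h := hact j'; rewrite (split_pow (absK r) _ _ hn) mulrA ler_pM2r ?exprn_gt0 // in h.
apply: le_trans h _; rewrite ler_wpM2l ?(abs_ge0 habs) // lerXn2r ?nnegrE ?(abs_ge0 habs) //.
Qed.

(** The exponent of [r] gained under conjugation by diag(r, 1); the extra 1 for the second form
    comes from the adjugate. *)
Definition weight D (i : 'I_(D.+1 + D.+1)) : nat :=
  match fintype.split i with inl j => j : nat | inr j => j.+1 end.

Lemma nrm_diag D w r : (forall i, absK (hcoefs D w i) * absK r ^+ weight i <=
    nrm D (hconj D (mx22 r 0 0 1) w)) /\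
  (exists i, nrm D (hconj D (mx22 r 0 0 1) w) = absK (hcoefs D w i) * absK r ^+ weight i).
Proof.
have e i : absK (hcoefs D w i) * absK r ^+ weight i = absK (hcoefs D (hconj D (mx22 r 0 0 1) w) i).
  rewrite -(absX habs) -(absM habs) /hcoefs /weight; case: fintype.split => j; congr absK.
    by rewrite coef_hconj_diag1 -1?ltnS // expr1n mulr1 mul1r.
  by rewrite coef_hconj_diag2 -1?ltnS // expr1n mulr1 mulrCA -exprS.
split => [i|]; last by eexists; rewrite e /nrm /norm_const.
have [h1 h2] := nrm_ge absK D (hconj D (mx22 r 0 0 1) w).
by rewrite e /hcoefs; case: fintype.split => j; rewrite ?h1 ?h2 // -ltnS.
Qed.

Lemma diag_candidates D w : (2 <= D)%N ->
  (exists i, hcoefs D w i != 0 /\ ((weight i).*2 < D.+1)%N) ->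
  (exists i, hcoefs D w i != 0 /\ (D.+1 < (weight i).*2)%N) ->
  exists C : seq K, (forall y, y \in C -> y != 0) /\
    forall r, r != 0 -> exists2 y, y \in C &
      cost D w (mx22 y 0 0 1) <= cost D w (mx22 r 0 0 1).
Proof.
move=> hD h1 h2; have [C [hC hr]] := crossing_candidates h1 h2.
exists C; split=> // r r0; have [y hy [i [hmax hle]]] := hr r r0; exists y => //.
have y0 := hC y hy; rewrite /cost !det_mx22 !mulr1 !mulr0 !subr0.
have py : 0 < absK y by rewrite (abs_gt0 habs).
have pr : 0 < absK r by rewrite (abs_gt0 habs).
have [_ [j ej]] := nrm_diag D w y; have [hr1 _] := nrm_diag D w r.
rewrite ler_pdivrMr ?exprn_gt0 // mulrAC ler_pdivlMr ?exprn_gt0 //.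
have n0 a b : 0 <= absK a * absK b ^+ weight i by rewrite mulr_ge0 ?exprn_ge0 ?(abs_ge0 habs).
apply: le_trans (_ : (absK (hcoefs D w i) * absK y ^+ weight i) ^+ 2 * absK r ^+ D.+1 <= _).
  rewrite ler_wpM2r ?exprn_ge0 ?(abs_ge0 habs) // lerXn2r ?nnegrE ?(nrm_ge0 habs) //.
  by rewrite ej.
apply: le_trans hle _; rewrite ler_wpM2r ?exprn_ge0 ?(abs_ge0 habs) //.
by rewrite lerXn2r ?nnegrE ?(nrm_ge0 habs).
Qed.

Lemma lift_neq0 D (w : {poly K} * {poly K}) : (0 < D)%N -> is_lift D w -> w != 0.
Proof.
move=> D0 hl; have := hres_neq0 (@root_closedK K) D0 hl; apply: contraNneq => ->.
have e : (0 : {poly K} * {poly K}) = scale_pair 0 0 by rewrite /scale_pair !scale0r.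
by rewrite e hres_scale expr0n addn_eq0 gtn_eqF //= mul0r.
Qed.

Lemma exists_min_cost D (w : {poly K} * {poly K}) : (2 <= D)%N -> is_lift D w ->
  exists M, \det M != 0 /\ forall N, \det N != 0 -> cost D w M <= cost D w N.
Proof.
move=> hD hl; have D0 : (0 < D)%N by apply: leq_trans hD.
have w0 := lift_neq0 D0 hl; have [f1 f2 hcop] := hl.
have hw : is_form2 D w by rewrite /is_form2 f1 f2.
have rts (p : {poly K}) : exists s : seq K, forall x, p != 0 -> root p x -> x \in s.
  have [s hs] := closed_field_poly_normal p; exists s => x p0.
  by rewrite hs rootZ ?lead_coef_eq0 // root_prod_XsubC.
have [s1 hs1] := rts w.2; have [s2 hs2] := rts (fixform w).
pose S := 0 :: s1 ++ s2.
have dT r s : \det (mx22 r s 0 1) = r :> K by rewrite det_mx22 mulr1 mulr0 subr0.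
have cand sigma : exists C : seq K, (forall y, y \in C -> y != 0) /\
    forall r, r != 0 -> exists2 y, y \in C &
      cost D w (mx22 y sigma 0 1) <= cost D w (mx22 r sigma 0 1).
  pose v := hconj D (mx22 1 sigma 0 1) w.
  have fv : is_form2 D v := is_form_hconj _ _ _.
  have ecost y : cost D w (mx22 y sigma 0 1) = cost D v (mx22 y 0 0 1).
    have -> : mx22 y sigma 0 1 = mx22 1 sigma 0 1 *m mx22 y 0 0 1.
      by rewrite mul_mx22; congr mx22; ring.
    by rewrite /cost hconjM det_mulmx !dT mul1r.
  have ev x y : heval D v.1 x y = heval D w.1 (x + sigma * y) y - sigma * heval D w.2 (x + sigma * y) y
      /\ heval D v.2 x y = heval D w.2 (x + sigma * y) y.
    have hc h : heval D (hcomp D h (mxnum (mx22 1 sigma 0 1)) (mxden (mx22 1 sigma 0 1))) x y =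
        heval D h (x + sigma * y) y.
      have := heval_hcomp D h x y (is_form_mxnum (mx22 1 sigma 0 1)) (is_form_mxden (mx22 1 sigma 0 1)).
      by rewrite muln1 => ->; rewrite !heval_linear !mxE /= !mul1r mul0r add0r.
    rewrite /v hconjE /=; split; rewrite hevalD ?hevalZ -?scaleNr ?hevalZ !hc !mxE /= ?mul1r ?mulNr //.
    by rewrite mul0r oppr0 add0r.
  (* Coprimality survives conjugation. Applied at (0, 1) and (1, 0) it yields a nonzero coefficient
     of weight 0 or 1 and one of weight D or D + 1, strictly on either side of (D+1)/2 because D >=
     2. *)
  have nz x y : (x, y) != 0 -> (heval D v.1 x y != 0) || (heval D v.2 x y != 0).
    move=> hxy; rewrite -negb_and; apply: contra hxy => /andP[/eqP e1 /eqP e2].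
    have [e3 e4] := ev x y; rewrite e2 in e4; rewrite e1 -e4 mulr0 subr0 in e3.
    have /eqP := hcoprime_heval f1 f2 hcop (esym e3) (esym e4) D0.
    rewrite xpair_eqE => /andP[h1 /eqP h2]; rewrite h2 mulr0 addr0 in h1.
    by rewrite xpair_eqE h1 h2 eqxx.
  have e01 (f : {poly K}) : heval D f 0 1 = f`_0.
    rewrite /heval big_ord_recl big1 ?addr0 => [|i _]; first by rewrite !expr1n !mulr1.
    by rewrite expr0n mulr0 mul0r.
  have lo : exists i, hcoefs D v i != 0 /\ ((weight i).*2 < D.+1)%N.
    have := nz 0 1; rewrite xpair_eqE oner_eq0 andbF !e01 => /(_ isT) /orP[h|h].
      exists (lshift D.+1 ord0); rewrite /hcoefs /weight -[lshift _ _]/(unsplit (inl _)) unsplitK.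
      by split.
    exists (rshift D.+1 ord0); rewrite /hcoefs /weight -[rshift _ _]/(unsplit (inr _)) unsplitK.
    by split.
  have hi : exists i, hcoefs D v i != 0 /\ (D.+1 < (weight i).*2)%N.
    have := nz 1 0; rewrite xpair_eqE oner_eq0 !heval_inf expr1n !mulr1 => /(_ isT) /orP[h|h].
      exists (lshift D.+1 ord_max); rewrite /hcoefs /weight -[lshift _ _]/(unsplit (inl _)) unsplitK.
      by split=> //=; rewrite -addnn -addn1 ltn_add2l.
    exists (rshift D.+1 ord_max); rewrite /hcoefs /weight -[rshift _ _]/(unsplit (inr _)) unsplitK.
    by split=> //=; rewrite -addnn addnS ltnS leq_addr.
  have [C [hC hr]] := diag_candidates hD lo hi; exists C; split=> // r r0.
  by have [y hy hle] := hr r r0; exists y; rewrite ?ecost.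
have [C hC] := boolp.choice cand.
pose Ms := [seq mx22 y sigma 0 1 | sigma <- S, y <- C sigma].
have red1 N : \det N != 0 -> exists2 M, M \in Ms & cost D w M <= cost D w N.
  move=> hN; have [V [c [r [s [iV dV c0 r0 eq]]]]] := iwasawa habs hN.
  rewrite -(cost_gl habs hres D w N iV dV) eq cost_scale //.
  have [||sigma [r' [hS r'0 hle]]] := @cost_recenter _ _ _ habs _ _ hres D w S r s D0 hw w0 isT _ _ r0.
  - by move=> x h1 h2; rewrite inE mem_cat (hs1 x h1 h2) orbT.
  - by move=> x h1 h2; rewrite inE mem_cat (hs2 x h1 h2) !orbT.
  have [_ hr] := hC sigma; have [y hy hle'] := hr r' r'0.
  exists (mx22 y sigma 0 1); last exact: le_trans hle' hle.
  by apply/allpairsPdep; exists sigma, y.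
have Ms0 : Ms != [::].
  have [|M hM _] := red1 1%:M; first by rewrite det1 oner_eq0.
  by apply/eqP => e; rewrite e in hM.
have [M hM hmin] := exists_min_seq (cost D w) Ms0.
exists M; split => [|N hN].
  have /allpairsPdep[sigma [y [_ hy ->]]] := hM.
  by rewrite dT; have [h _] := hC sigma; apply: h.
by have [M' hM' hle] := red1 N hN; apply: le_trans (hmin _ hM') hle.
Qed.

End MinimumAttained.

Lemma scale_pairK (F : fieldType) (c : F) (w : {poly F} * {poly F}) : c != 0 ->
  scale_pair c^-1 (scale_pair c w) = w.
Proof. by move=> c0; rewrite /scale_pair /= !scalerA mulVf // !scale1r; case: w. Qed.

Lemma scale_pair1 (F : fieldType) (w : {poly F} * {poly F}) : scale_pair 1 w = w.
Proof. by rewrite /scale_pair !scale1r; case: w. Qed.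

(** * The minimal resultant *)

Section ResultantOrder.
Variables (K : closedFieldType) (R : realType) (absK : K -> R).
Hypothesis habs : nonarch_abs absK.
Variables (k : fieldType) (red : K -> k).
Hypothesis hrm : residue_map absK red.
Hypothesis hnontriv : nontrivial_abs absK.

Notation nrm := (nrm absK).
Notation cost := (cost absK).
Implicit Types (w v : {poly K} * {poly K}) (M N : 'M[K]_2) (D d n : nat).

Lemma ln_qv_gt0 : 0 < ln (qv R k).
Proof.
rewrite /qv; case: eqP => [_|]; first by rewrite expRK ltr01.
rewrite /char_res; case: xgetP => // p _ hp _.
by rewrite ln_gt0 // ltr1n prime_gt1 // (pcharf_prime hp).
Qed.

Lemma pair0_scale : (0 : {poly K} * {poly K}) = scale_pair 0 0.
Proof. by rewrite /scale_pair !scale0r. Qed.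

Lemma hres_pair_neq0 D w : (0 < D)%N -> hres D w.1 w.2 != 0 -> w != 0.
Proof.
move=> D0; apply: contraNneq => ->.
by rewrite pair0_scale hres_scale expr0n addn_eq0 gtn_eqF //= mul0r.
Qed.

Lemma normalizeE D w : normalize absK D w = scale_pair (norm_const absK D w)^-1 w.
Proof. by []. Qed.

Lemma RresE D w : (0 < D)%N -> is_form2 D w -> hres D w.1 w.2 != 0 ->
  Rres absK k D w = (ln (nrm D w) *+ (D + D) - ln (absK (hres D w.1 w.2))) / ln (qv R k).
Proof.
move=> D0 hw h; have w0 := hres_pair_neq0 D0 h; have pn := nrm_gt0 habs hw w0.
rewrite /Rres normalizeE hres_scale /ord (absM habs) (absX habs) (absV habs) -/(nrm D w).
have ph : 0 < absK (hres D w.1 w.2) by rewrite (abs_gt0 habs).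
rewrite lnM ?posrE ?exprn_gt0 ?invr_gt0 // lnXn ?invr_gt0 // lnV ?posrE //.
by rewrite -mulNr opprD mulNrn opprK.
Qed.

Lemma Rres_scale D c w : (0 < D)%N -> is_form2 D w -> hres D w.1 w.2 != 0 -> c != 0 ->
  Rres absK k D (scale_pair c w) = Rres absK k D w.
Proof.
move=> D0 hw h c0; have w0 := hres_pair_neq0 D0 h; have pn := nrm_gt0 habs hw w0.
have hc : hres D (scale_pair c w).1 (scale_pair c w).2 != 0.
  by rewrite hres_scale mulf_neq0 ?expf_neq0.
have pc : 0 < absK c by rewrite (abs_gt0 habs).
rewrite !RresE ?is_form2_scale // (nrm_scale habs) hres_scale (absM habs) (absX habs).
have ph : 0 < absK (hres D w.1 w.2) by rewrite (abs_gt0 habs).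
rewrite lnM ?posrE // lnM ?posrE ?exprn_gt0 // lnXn //.
by congr (_ / _); rewrite mulrnDl; ring.
Qed.

Lemma abs_hres_le1 D (f g : {poly K}) : (forall i, absK f`_i <= 1) -> (forall i, absK g`_i <= 1) ->
  absK (hres D f g) <= 1.
Proof.
move=> hf hg; apply: (abs_le_sum habs) => // s _.
rewrite (absM habs) (absX habs) (absN habs) (abs1 habs) expr1n mul1r.
apply: (big_ind (fun x => absK x <= 1)) => [|x y hx hy|i _]; first by rewrite (abs1 habs).
  by rewrite (absM habs) mulr_ile1 ?(abs_ge0 habs).
by rewrite mxE; case: ifP => _; case: ifP => _; rewrite ?(abs0 habs) ?ler01.
Qed.

Lemma Rres_ge0 D w : (0 < D)%N -> is_form2 D w -> hres D w.1 w.2 != 0 -> 0 <= Rres absK k D w.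
Proof.
move=> D0 hw h; have w0 := hres_pair_neq0 D0 h.
have [c [v [v' [c0 eqv hv hr v0]]]] := exists_normalization habs hrm hw w0.
have hv0 : hres D v.1 v.2 != 0.
  by move: h; rewrite eqv hres_scale mulf_eq0 negb_or => /andP[].
rewrite eqv Rres_scale // RresE // (nrm_reduces_eq1 habs hrm hv hr v0) ln1 mul0rn sub0r.
rewrite divr_ge0 ?(ltW ln_qv_gt0) // oppr_ge0 ln_le0 //.
by case: hr => r1 r2; apply: abs_hres_le1 => i; [case: (r1 i)|case: (r2 i)].
Qed.

Lemma hres_hconj_neq0 D w M : is_form2 D w -> hres D w.1 w.2 != 0 -> \det M != 0 ->
  hres D (hconj D M w).1 (hconj D M w).2 != 0.
Proof.
by move=> hw h hM; rewrite (hres_hconj (@root_closedK K)) // mulf_neq0 ?expf_neq0.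
Qed.

Lemma cost_gt0 D w M : (0 < D)%N -> is_form2 D w -> hres D w.1 w.2 != 0 -> \det M != 0 ->
  0 < cost D w M.
Proof.
move=> D0 hw h hM; have h0 := hres_pair_neq0 D0 (hres_hconj_neq0 hw h hM).
have pn := nrm_gt0 habs (is_form_hconj D M w) h0.
by rewrite divr_gt0 ?exprn_gt0 // (abs_gt0 habs).
Qed.

(** The norm enters to the power 2D and the resultant brings |det M|^(D(D+1)); together these form
    the D-th power of the cost, so the order of the resultant depends on [M] through the cost
    alone. *)
Lemma Rres_hconj D w M : (0 < D)%N -> is_form2 D w -> hres D w.1 w.2 != 0 -> \det M != 0 ->
  Rres absK k D (hconj D M w) = (ln (cost D w M) *+ D - ln (absK (hres D w.1 w.2))) / ln (qv R k).
Proof.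
move=> D0 hw h hM; have hc := hres_hconj_neq0 hw h hM.
have pn := nrm_gt0 habs (is_form_hconj D M w) (hres_pair_neq0 D0 hc).
have pd : 0 < absK (\det M) by rewrite (abs_gt0 habs).
have ph : 0 < absK (hres D w.1 w.2) by rewrite (abs_gt0 habs).
rewrite RresE ?is_form_hconj //; congr (_ / _).
rewrite (hres_hconj (@root_closedK K)) // (absM habs) (absX habs) lnM ?posrE ?exprn_gt0 // lnXn //.
rewrite /cost ln_div ?posrE ?exprn_gt0 // !lnXn // mulrnBl opprD addrA; congr (_ - _ - _).
  by rewrite -mulrnA mul2n addnn.
by rewrite -mulrnA.
Qed.

Lemma Rres_le D w M N : (0 < D)%N -> is_form2 D w -> hres D w.1 w.2 != 0 ->
  \det M != 0 -> \det N != 0 ->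
  (Rres absK k D (hconj D M w) <= Rres absK k D (hconj D N w)) = (cost D w M <= cost D w N).
Proof.
move=> D0 hw h hM hN; rewrite !Rres_hconj // ler_pM2r ?invr_gt0 ?ln_qv_gt0 //.
by rewrite lerD2r lerMn2r gtn_eqF //= ler_ln ?posrE ?cost_gt0.
Qed.

Lemma unitmx_det M : (M \in unitmx) = (\det M != 0).
Proof. by rewrite unitmxE unitfE. Qed.

Lemma minres_le D w M : (0 < D)%N -> is_form2 D w -> hres D w.1 w.2 != 0 -> \det M != 0 ->
  minres absK k D w <= Rres absK k D (hconj D M w).
Proof.
move=> D0 hw h hM; apply: ge_inf; last by exists M => //=; rewrite unitmx_det.
exists 0 => _ [N /= hN <-]; rewrite unitmx_det in hN.
by rewrite Rres_ge0 ?is_form_hconj ?hres_hconj_neq0.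
Qed.

Lemma minresE D w M : (0 < D)%N -> is_form2 D w -> hres D w.1 w.2 != 0 -> \det M != 0 ->
  (forall N, \det N != 0 -> cost D w M <= cost D w N) ->
  minres absK k D w = Rres absK k D (hconj D M w).
Proof.
move=> D0 hw h hM hmin; apply: le_anti; rewrite minres_le //=.
apply: lb_le_inf; first by exists (Rres absK k D (hconj D M w)), M => //=; rewrite unitmx_det.
by move=> _ [N /= hN <-]; rewrite unitmx_det in hN; rewrite Rres_le ?hmin.
Qed.

Lemma ss_redP D w : (2 <= D)%N -> is_form2 D w -> w != 0 ->
  ss_red absK red D w <->
  (forall M, \det M != 0 -> absK (\det M) ^+ D.+1 * nrm D w ^+ 2 <= nrm D (hconj D M w) ^+ 2).
Proof.
move=> hD hw w0; have [c [v [v' [c0 eqv hv hr v0]]]] := exists_normalization habs hrm hw w0.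
have [a a0 ha] := hred_scale habs hrm c0 hv hr v0.
have hv' : is_form2 D v'.
  by case: hr hv => r1 r2 /andP[g1 g2]; apply/andP; split;
    [apply: (reduces_form habs hrm r1)|apply: (reduces_form habs hrm r2)].
have hk := root_closed_residue habs hrm.
have pc : 0 < absK c by rewrite (abs_gt0 habs).
have sv : ss_red absK red D w <-> semistable_pt D v'.
  rewrite /ss_red eqv ha; split => h; last exact: semistable_pt_scale.
  by rewrite -(scale_pairK v' a0); apply: semistable_pt_scale; rewrite // invr_eq0.
have sn M : (absK (\det M) ^+ D.+1 * nrm D w ^+ 2 <= nrm D (hconj D M w) ^+ 2) =
    (absK (\det M) ^+ D.+1 <= nrm D (hconj D M v) ^+ 2).
  rewrite eqv hconj_scale !(nrm_scale habs) (nrm_reduces_eq1 habs hrm hv hr v0) mulr1.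
  by rewrite exprMn mulrC ler_pM2l // exprn_gt0.
rewrite sv; split => [h M hM|h].
  rewrite sn; apply: (nrm_hconj_ge habs hrm hv hr) => // g dg.
  exact: semistable_not_unstable.
apply: semistable_of_stable_points => //.
by apply: (not_unstable_of_min habs hrm hnontriv hv hr) => M hM; rewrite -sn h.
Qed.

(** [ss_redP] compares the conjugate by [M] with its own conjugates; replacing [N] by M^-1 N turns
    this into minimality of the cost over all matrices. The scalar [c] absorbs the determinants that
    [hiter_hconj] produces. *)
Lemma ss_red_hconjP D w M c : (2 <= D)%N -> is_form2 D w -> hres D w.1 w.2 != 0 ->
  \det M != 0 -> c != 0 ->
  ss_red absK red D (scale_pair c (hconj D M w)) <->
  (forall N, \det N != 0 -> cost D w M <= cost D w N).
Proof.
move=> hD hw h hM c0; have D0 : (0 < D)%N by apply: leq_trans hD.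
have hc0 := hres_pair_neq0 D0 (hres_hconj_neq0 hw h hM).
have hs0 : scale_pair c (hconj D M w) != 0.
  apply: contraNneq hc0 => e; rewrite -(scale_pairK (hconj D M w) c0) e.
  by rewrite /scale_pair !scaler0.
rewrite ss_redP ?is_form2_scale ?is_form_hconj //.
have eqc N : (absK (\det N) ^+ D.+1 * nrm D (scale_pair c (hconj D M w)) ^+ 2 <=
     nrm D (hconj D N (scale_pair c (hconj D M w))) ^+ 2) =
     (absK (\det N) ^+ D.+1 * nrm D (hconj D M w) ^+ 2 <= nrm D (hconj D (M *m N) w) ^+ 2).
  rewrite hconj_scale !(nrm_scale habs) !exprMn -hconjM mulrCA ler_pM2l //.
  by rewrite exprn_gt0 // (abs_gt0 habs).
have eqc2 N : \det N != 0 -> (cost D w M <= cost D w (M *m N)) =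
     (absK (\det N) ^+ D.+1 * nrm D (hconj D M w) ^+ 2 <= nrm D (hconj D (M *m N) w) ^+ 2).
  move=> hN; have pM : 0 < absK (\det M) by rewrite (abs_gt0 habs).
  have pN : 0 < absK (\det N) by rewrite (abs_gt0 habs).
  rewrite /cost det_mulmx (absM habs) exprMn ler_pdivlMr ?mulr_gt0 ?exprn_gt0 //.
  by rewrite mulrA mulfVK ?expf_neq0 ?lt0r_neq0 // mulrC.
split => [hmin N hN|hmin N hN]; last by rewrite eqc -eqc2 // hmin // det_mulmx mulf_neq0.
have hMu : M \in unitmx by rewrite unitmx_det.
have hN' : \det (invmx M *m N) != 0 by rewrite det_mulmx mulf_neq0 // det_inv invr_eq0.
by have := hmin _ hN'; rewrite eqc -eqc2 // mulmxA mulmxV // mul1mx.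
Qed.

End ResultantOrder.

Theorem theorem3p1 (K : closedFieldType) (R : realType) (absK : K -> R)
    (k : fieldType) (red : K -> k)
    (habs : nonarch_abs absK) (hnontriv : nontrivial_abs absK)
    (hcompl : complete_abs absK) (hres : residue_map absK red)
    (d : nat) (hd : (2 <= d)%N) (phi : {poly K} * {poly K})
    (hphi : is_lift d phi) :
  (forall n : nat, (1 <= n)%N ->
     minres absK k (d ^ n) (hiter d phi n)
     = ((d ^ n * (d ^ n - 1))%:R / (d * (d - 1))%:R) * minres absK k d phi)
  <->
  (forall gamma : 'M[K]_2, gamma \in unitmx ->
     ss_red absK red d (hconj d gamma phi) ->
     ~ in_I d (hred absK red d (hconj d gamma phi)) /\
     (forall n : nat, (1 <= n)%N ->
        ss_red absK red (d ^ n) (hiter d (hconj d gamma phi) n))).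
Proof.
have hK := @root_closedK K; have hk := root_closed_residue habs hres.
have d0 : (0 < d)%N by apply: leq_trans hd.
have fphi : is_form2 d phi by case: hphi => h1 h2 _; rewrite /is_form2 h1 h2.
have rphi : Defs.hres d phi.1 phi.2 != 0 := hres_neq0 hK d0 hphi.
have dn0 n : (0 < d ^ n)%N by rewrite expn_gt0 d0.
have dn2 n : (1 <= n)%N -> (2 <= d ^ n)%N.
  by move=> hn; apply: leq_trans hd _; rewrite -{1}(expn1 d) leq_pexp2l.
have fit n : is_form2 (d ^ n) (hiter d phi n) := is_form_hiter n fphi.
have rit (v : {poly K} * {poly K}) n : is_form2 d v -> Defs.hres d v.1 v.2 != 0 ->
    Defs.hres (d ^ n) (hiter d v n).1 (hiter d v n).2 != 0.
  move=> fv rv; have [s ->] := hres_hiter hK n fv.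
  by rewrite mulf_neq0 ?expf_neq0 // oppr_eq0 oner_eq0.
have NE n : (d ^ n * (d ^ n - 1))%:R / (d * (d - 1))%:R = (res_expo d n)%:R :> R.
  rewrite !subn1 -res_expoE natrM mulrAC mulfV ?mul1r // pnatr_eq0 muln_eq0.
  by move: hd; case: (d) => [|[|]].
have q0 : 0 < ln (qv R k) := ln_qv_gt0 R k.
(* [v] is a normalized lift of the conjugate, [v'] its reduction, and [lam n] is 2 d^n times the
   logarithm to base q_v of the norm of the n-th iterate of [v]. By integrality that norm is at most
   1, and it equals 1 exactly when the iterate of [v'] is nonzero. *)
have setup gamma : \det gamma != 0 -> exists v v' (lam : nat -> R),
  [/\ forall n, reduces2 absK red (hiter d v n) (hiter d v' n) /\ is_form2 d v',
      v' != 0 /\ (exists2 a, a != 0 & hred absK red d (hconj d gamma phi) = scale_pair a v'),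
      forall n, (1 <= n)%N -> Rres absK k (d ^ n) (hconj (d ^ n) gamma (hiter d phi n)) =
         lam n + (res_expo d n)%:R * Rres absK k d (hconj d gamma phi),
      forall n, lam n <= 0 & forall n, (lam n == 0) = (hiter d v' n != 0)].
  move=> hg; have fw := is_form_hconj d gamma phi.
  have rw := hres_hconj_neq0 fphi rphi hg.
  have [c [v [v' [c0 eqv fv hr v0]]]] := exists_normalization habs hres fw (hres_pair_neq0 d0 rw).
  have rv : Defs.hres d v.1 v.2 != 0.
    by move: rw; rewrite eqv hres_scale mulf_eq0 negb_or => /andP[].
  have hrn n := reduces2_hiter habs hres d n hr.
  have fv' : is_form2 d v'.
    by case: hr fv => r1 r2 /andP[g1 g2]; apply/andP; split;
      [apply: (reduces_form habs hres r1)|apply: (reduces_form habs hres r2)].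
  have pn n : 0 < nrm absK (d ^ n) (hiter d v n).
    by apply: (nrm_gt0 habs); [apply: is_form_hiter|apply: (hres_pair_neq0 (dn0 n)); apply: rit].
  have n1 n := nrm_reduces_le (d ^ n) (hrn n).
  exists v, v', (fun n => ln (nrm absK (d ^ n) (hiter d v n)) *+ (d ^ n + d ^ n) / ln (qv R k)).
  split => [n|||n|n]; first by split.
  - by split=> //; rewrite eqv; apply: hred_scale.
  - move=> n hn; have fvn := is_form_hiter n fv; have rvn := rit v n fv rv.
    have [j hj] : exists j, hiter d (hconj d gamma phi) n =
        scale_pair (\det gamma ^+ j) (hconj (d ^ n) gamma (hiter d phi n)).
      by case: n hn {fvn rvn} => // n _; apply: hiter_hconj.
    rewrite -(Rres_scale habs k (dn0 n) (is_form_hconj _ _ _)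
      (hres_hconj_neq0 (fit n) (rit _ n fphi rphi) hg) (expf_neq0 j hg)) -hj.
    rewrite eqv hiter_scale !(Rres_scale habs k) ?expf_neq0 // !(RresE habs k) //.
    rewrite (nrm_reduces_eq1 habs hres fv hr v0) ln1 mul0rn sub0r mulrBl mulrA; congr (_ + _).
    have [s ->] := hres_hiter hK n fv; rewrite (absM habs) !(absX habs) (absN habs) (abs1 habs).
    by rewrite expr1n mul1r lnXn ?(abs_gt0 habs) // mulr_natl mulNrn mulNr.
  - by rewrite pmulr_lle0 ?invr_gt0 // -mulr_natl pmulr_rle0 ?ltr0n ?addn_gt0 ?dn0 // ln_le0.
  rewrite mulf_eq0 invr_eq0 (gt_eqF q0) orbF mulrn_eq0 addn_eq0 (gtn_eqF (dn0 n)) /=.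
  rewrite ln_eq0 //; apply/eqP/idP => [e|h].
    apply/eqP => z; have := hrn n; rewrite z => /(nrm_reduces_lt hres (d ^ n)).
    by rewrite e ltxx.
  exact: (nrm_reduces_eq1 habs hres (is_form_hiter n fv) (hrn n) h).
split => [hi gamma hgu hss|hii].
  have hg : \det gamma != 0 by rewrite -unitmx_det.
  have [v [v' [lam [hr [v0 [a a0 ha]] hlam lam0 lamE]]]] := setup gamma hg.
  have hmin : forall N, \det N != 0 -> cost absK d phi gamma <= cost absK d phi N.
    apply/(ss_red_hconjP habs hres hnontriv hd fphi rphi hg (oner_neq0 K)).
    by rewrite scale_pair1.
  have mE := minresE habs hres d0 fphi rphi hg hmin.
  (* The minimal resultant of the iterate is at most its value at [gamma], which is the value
     predicted by (i) plus [lam n]. Since [lam n <= 0], equality holds throughout, so [gamma] also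
     minimizes for the iterate. *)
  have key n : (1 <= n)%N -> lam n = 0 /\
      minres absK k (d ^ n) (hiter d phi n) = Rres absK k (d ^ n) (hconj (d ^ n) gamma (hiter d phi n)).
    move=> hn; have hle := minres_le habs hres (dn0 n) (fit n) (rit _ n fphi rphi) hg.
    have e := hi n hn; rewrite NE mE in e; rewrite hlam // e in hle *.
    have l0 : lam n = 0 by apply/eqP; rewrite eq_le lam0 -(lerD2r ((res_expo d n)%:R * Rres absK k d (hconj d gamma phi))) add0r.
    by rewrite l0 add0r.
  split.
    rewrite ha => /(in_I_scale a0) hI; have [l2 _] := key 2%N isT.
    have := lamE 2%N; rewrite l2 eqxx => /esym/eqP; apply.
    by apply: (in_I_hiter2 (proj2 (hr 0%N)) d0 hI).
  move=> n hn; have [j hj] : exists j, hiter d (hconj d gamma phi) n =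
      scale_pair (\det gamma ^+ j) (hconj (d ^ n) gamma (hiter d phi n)).
    by case: n hn => // n _; apply: hiter_hconj.
  rewrite hj; apply/(ss_red_hconjP habs hres hnontriv (dn2 n hn) (fit n) (rit _ n fphi rphi) hg (expf_neq0 j hg)).
  move=> N hN; rewrite -(Rres_le habs k (dn0 n) (fit n) (rit _ n fphi rphi) hg hN).
  have [_ <-] := key n hn.
  exact: (minres_le habs hres (dn0 n) (fit n) (rit _ n fphi rphi) hN).
(* A minimizer of the cost for [phi] has semistable reduction, so (ii) applies to it. It shows that
   the same [gamma] minimizes for the iterate and that [lam n = 0], and the two minimal resultants
   are compared at this one matrix. *)
move=> n hn; have [gamma [hg hmin]] := exists_min_cost habs hres hd hphi.
have hgu : gamma \in unitmx by rewrite unitmx_det.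
have hss : ss_red absK red d (hconj d gamma phi).
  have := (ss_red_hconjP habs hres hnontriv hd fphi rphi hg (oner_neq0 K)).2 hmin.
  by rewrite scale_pair1.
have [hI hssn] := hii gamma hgu hss.
have [v [v' [lam [hr [v0 [a a0 ha]] hlam lam0 lamE]]]] := setup gamma hg.
have l0 : lam n = 0.
  apply/eqP; rewrite lamE; apply: (hiter_neq0 hk) => //; first by case: (hr 0%N).
  move=> hI'; apply: hI; rewrite ha; apply: (@in_I_scale _ _ a^-1); first by rewrite invr_eq0.
  by rewrite scale_pairK.
have [j hj] : exists j, hiter d (hconj d gamma phi) n =
    scale_pair (\det gamma ^+ j) (hconj (d ^ n) gamma (hiter d phi n)).
  by case: n hn {l0} => // n _; apply: hiter_hconj.
have := hssn n hn; rewrite hj.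
move/(ss_red_hconjP habs hres hnontriv (dn2 n hn) (fit n) (rit _ n fphi rphi) hg (expf_neq0 j hg)) => hminn.
rewrite (minresE habs hres (dn0 n) (fit n) (rit _ n fphi rphi) hg hminn) hlam // l0 add0r NE.
by rewrite (minresE habs hres d0 fphi rphi hg hmin).
Qed.
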